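(* Let $F$, $\Lambda$, $E^c$ and $Q=(0,0,0)$ be as described in the context (for any admissible choice of parameters). Consider the one-parameter family $(\phi_t)_{t\in\mathbb{R}}$ of $C^\infty$ potentials defined for $X=(x,y,z)\in R_0\cup R_1$ by $$\phi_t(X)=t\log\big|DF(X)|_{E^c}\big|=\begin{cases} t\log f'(y), & z\le 1/6,\\ t\log\sigma, & z\ge 5/6.\end{cases}$$ There exists a positive real number $t_0$ such that: 1. For $t>t_0$, $\delta_Q$ is the unique equilibrium state for $\phi_t$. 2. For $t<t_0$, any equilibrium state for $\phi_t$ has negative central Lyapunov exponent. In particular, this measure is singular with $\delta_Q$. 3. For $t=t_0$, $\delta_Q$ is an equilibrium state for $\phi_t$, and there exists at least one other equilibrium state for $\phi_t$, singular with $\delta_Q$.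
   Context: Let $I=[0,1]$, $R=I^3\subset\mathbb{R}^3$, $R_0=I\times I\times[0,1/6]$, $R_1=I\times I\times[5/6,1]$. Fix parameters $0<\lambda_0<1/3$, $\beta_0>6$, $0<\lambda_1<1/3$, $0<\sigma<1/3$, $3<\beta_1<4$. Let $f:I\to I$ be the time-one map of the vector field $x'=x(1-x)$, i.e. $f(y)=\dfrac{y}{y+(1-y)e^{-1}}$; thus $f(0)=0$, $f(1)=1$, $f'(0)=e$, $f'(1)=1/e$. The map $F$ is defined on $R_0\cup R_1$ by $F(x,y,z)=(\lambda_0x,\,f(y),\,\beta_0z)$ if $(x,y,z)\in R_0$, and $F(x,y,z)=(\tfrac34-\lambda_1x,\ \sigma(1-y),\ \beta_1(z-\tfrac56))$ if $(x,y,z)\in R_1$. $F$ is injective on $R_0\cup R_1$. $\Lambda$ is the maximal invariant set of $F$ in the cube: the compact set of points having a full (forward and backward) $F$-orbit contained in $R_0\cup R_1$. $F$ restricts to a homeomorphism of $\Lambda$. The point $Q=(0,0,0)$ is fixed by $F$, and $\delta_Q$ is the Dirac measure at $Q$. $E^c$ is the direction of the $y$-axis. $F$-invariant measures are Borel probability measures on $\Lambda$ invariant under $F$. The central Lyapunov exponent of an invariant measure $\mu$ is $\lambda^c_\mu=\int\log|DF|_{E^c}|\,d\mu$. For a continuous potential $\phi$ and an $F$-invariant probability $\eta$, the $\phi$-pressure of $\eta$ is $h_\eta(F)+\int\phi\,d\eta$, where $h_\eta(F)$ is the metric entropy; $\eta$ is an equilibrium state for $\phi$ if its $\phi$-pressure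 is maximal among the $\phi$-pressures of all $F$-invariant probabilities. ''Singular with'' means mutually singular. *)

(* Defs.v *)
From mathcomp Require Import all_boot all_order all_algebra.
From mathcomp Require Import all_classical all_reals all_analysis.
From mathcomp Require Import lra.

Set Implicit Arguments.
Unset Strict Implicit.
Unset Printing Implicit Defensive.

Import Order.TTheory GRing.Theory Num.Theory.
Import numFieldNormedType.Exports.

Local Open Scope classical_set_scope.
Local Open Scope ring_scope.

Definition mutually_singular (d : measure_display) (T : measurableType d)
    (R : realType) (mu nu : set T -> \bar R) : Prop :=
  exists N : set T, [/\ measurable N, mu N = 0%E & nu (~` N) = 0%E].

Definition finite_partition (d : measure_display) (T : measurableType d)
    (k : nat) (P : 'I_k -> set T) : Prop :=
  [/\ forall i, measurable (P i), trivIset [set: 'I_k] P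
    & \bigcup_i P i = [set: T]].

(* The cell of the join of P, F^-1 P, ..., F^-(n-1) P with itinerary w; cells
   of distinct itineraries are disjoint, and some of them may be empty. *)
Definition join_cell (T : Type) (F : T -> T) (k : nat) (P : 'I_k -> set T)
    (n : nat) (w : {ffun 'I_n -> 'I_k}) : set T :=
  [set X | forall i : 'I_n, P (w i) (iter i F X)].

Definition join_entropy (d : measure_display) (T : measurableType d)
    (R : realType) (mu : probability T R) (F : T -> T)
    (k : nat) (P : 'I_k -> set T) (n : nat) : R :=
  - \sum_(w : {ffun 'I_n -> 'I_k})
      fine (mu (join_cell F P w)) * ln (fine (mu (join_cell F P w))).

Definition partition_entropy (d : measure_display) (T : measurableType d)
    (R : realType) (mu : probability T R) (F : T -> T)
    (k : nat) (P : 'I_k -> set T) : R :=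
  limn (fun n : nat => join_entropy mu F P n / n%:R).

Definition metric_entropy (d : measure_display) (T : measurableType d)
    (R : realType) (mu : probability T R) (F : T -> T) : \bar R :=
  ereal_sup [set h | exists (k : nat) (P : 'I_k -> set T),
    finite_partition P /\ h = (partition_entropy mu F P)%:E].

(* Points of R^3 are triples ((x, y), z); the product sigma-algebra of
   R * R * R is the Borel sigma-algebra of R^3. *)
Definition slab0 (R : realType) : set (R * R * R) :=
  [set X | [/\ 0 <= X.1.1 <= 1, 0 <= X.1.2 <= 1 & 0 <= X.2 <= 1 / 6]].

Definition slab1 (R : realType) : set (R * R * R) :=
  [set X | [/\ 0 <= X.1.1 <= 1, 0 <= X.1.2 <= 1 & 5 / 6 <= X.2 <= 1]].

Arguments slab0 R : clear implicits.
Arguments slab1 R : clear implicits.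

(* Time-one map of the vector field x' = x (1 - x). *)
Definition timeone (R : realType) (y : R) : R := y / (y + (1 - y) * expR (-1)).

(* Only the values on [slab0 `|` slab1] matter: orbits in the maximal invariant
   set stay there, and invariant probabilities are carried by that set. *)
Definition horseshoe (R : realType) (lambda0 beta0 lambda1 sigma beta1 : R)
    (X : R * R * R) : R * R * R :=
  let: (x, y, z) := X in
  if z <= 1 / 6 then (lambda0 * x, timeone y, beta0 * z)
  else (3 / 4 - lambda1 * x, sigma * (1 - y), beta1 * (z - 5 / 6)).

Definition maximal_invariant (R : realType) (F : R * R * R -> R * R * R) :
    set (R * R * R) :=
  [set X | exists u : int -> R * R * R, u 0 = X /\
    forall n : int, (slab0 R `|` slab1 R) (u n) /\ F (u n) = u (n + 1)].

(* Borel probabilities on the compact set Lambda are represented as Borel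
   probabilities on R^3 giving Lambda full measure. *)
Definition invariant_probability (R : realType) (F : R * R * R -> R * R * R)
    (mu : probability (R * R * R)%type R) : Prop :=
  mu (maximal_invariant F) = 1%E /\
  forall A : set (R * R * R), measurable A -> mu (F @^-1` A) = mu A.

(* log |DF(X) e_y|, where e_y spans E^c.  The line through X parallel to e_y
   stays at a fixed height z, hence inside one branch of the horseshoe map. *)
Definition log_central_jacobian (R : realType) (F : R * R * R -> R * R * R)
    (X : R * R * R) : R :=
  ln `| 'D_((0, 1, 0) : R * R * R) F X |.

Section central_jacobian.
Variables (R : realType) (lambda0 beta0 lambda1 sigma beta1 : R).
Let F := horseshoe lambda0 beta0 lambda1 sigma beta1.

Lemma timeone_den_gt0 (y : R) : 0 <= y <= 1 -> 0 < y + (1 - y) * expR (-1).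
Proof.
move=> h. have := expR_gt0 (-1 : R). have : expR (-1) < 1 :> R by rewrite expR_lt1; lra. nra.
Qed.

Lemma derivable_timeone (y : R) : 0 <= y <= 1 -> derivable (@timeone R) y 1.
Proof.
move=> h; apply: derivableM => //.
apply: derivableV; first by rewrite gt_eqF// timeone_den_gt0.
apply: derivableD => //; apply: derivableM => //.
Qed.

Lemma derive_central (G : R -> R) (X : R * R * R) :
 derivable G X.1.2 1 ->
 (\forall h \near (0:R)^', F (h *: (0,1,0) + X) - F X = (0, G (h + X.1.2) - G X.1.2, 0)) ->
 'D_((0,1,0) : R*R*R) F X = (0, derive1 G X.1.2, 0).
Proof.
move=> dG H; rewrite /derive; apply/cvg_lim => //.
apply: (@cvg_trans _ ((fun h : R => ((0:R, h^-1 *: (G (h *: (1:R) + X.1.2) - G X.1.2)),0:R) : R*R*R) @ 0^')).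
  apply: near_eq_cvg; near=> h.
  have -> : F (h *: (0,1,0) + X) - F X = (0, G (h + X.1.2) - G X.1.2, 0) by near: h.
  have sp (a b c : R) : h^-1 *: ((a, b, c) : R * R * R) = (h^-1 * a, h^-1 * b, h^-1 * c) by [].
  by rewrite sp !mulr0 [h *: 1]mulr1.
apply: (@cvg_pair _ _ _ (0^') (nbhs ((0:R, derive1 G X.1.2))) (nbhs (0:R))); last exact: cvg_cst.
apply: (@cvg_pair _ _ _ (0^') (nbhs (0:R)) (nbhs (derive1 G X.1.2))); first exact: cvg_cst.
rewrite derive1E; exact: dG.
Unshelve. all: by end_near.
Qed.

Lemma normr_central (a : R) : `|((0, a, 0) : R * R * R)| = `|a|.
Proof.
rewrite prod_normE /= prod_normE /= normr0 max_l ?max_r//.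
Qed.

Lemma log_central_jacobian0 X : slab0 R X ->
  log_central_jacobian F X = ln `|derive1 (@timeone R) X.1.2|.
Proof.
case: X => [[x y] z] [/= _ hy hz]. rewrite /log_central_jacobian (@derive_central (@timeone R)) /=; first last.
- apply: nearW => h. rewrite /F /horseshoe /= !scaler0 !add0r.
  have -> : z <= 1 / 6 by case/andP: hz.
  by congr (_, _, _); rewrite /= ?subrr // [h *: 1]mulr1.
- exact: derivable_timeone.
by rewrite normr_central.
Qed.

Lemma log_central_jacobian1 X : slab1 R X -> 0 < sigma ->
  log_central_jacobian F X = ln sigma.
Proof.
case: X => [[x y] z] [/= _ hy hz] sigma_gt0. rewrite /log_central_jacobian (@derive_central (fun y => sigma * (1 - y))) /=; first last.
- apply: nearW => h. rewrite /F /horseshoe /= !scaler0 !add0r.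
  have -> : (z <= 1 / 6) = false by apply/negbTE; rewrite -ltNge; lra.
  by congr (_, _, _); rewrite /= ?subrr // [h *: 1]mulr1.
- by [].
rewrite derive1E deriveM// derive_cst scaler0 addr0 deriveB// derive_cst derive_id sub0r scalerN [sigma *: 1]mulr1.
by rewrite normr_central normrN gtr0_norm.
Qed.

End central_jacobian.

Definition central_exponent (R : realType) (F : R * R * R -> R * R * R)
    (mu : probability (R * R * R)%type R) : \bar R :=
  \int[mu]_(X in maximal_invariant F) (log_central_jacobian F X)%:E.

Definition pressure (R : realType) (F : R * R * R -> R * R * R)
    (phi : R * R * R -> R) (mu : probability (R * R * R)%type R) : \bar R :=
  (metric_entropy mu F + \int[mu]_(X in maximal_invariant F) (phi X)%:E)%E.

Definition equilibrium_state (R : realType) (F : R * R * R -> R * R * R)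
    (phi : R * R * R -> R) (mu : probability (R * R * R)%type R) : Prop :=
  invariant_probability F mu /\
  forall nu : probability (R * R * R)%type R,
    invariant_probability F nu -> (pressure F phi nu <= pressure F phi mu)%E.

Definition potential (R : realType) (F : R * R * R -> R * R * R) (t : R)
    (X : R * R * R) : R :=
  t * log_central_jacobian F X.

(* Main.v *)
Require Import Defs.
From HB Require Import structures.
From mathcomp Require Import all_boot all_order all_algebra.
From mathcomp Require Import all_classical all_reals all_analysis.
From mathcomp Require Import measurable_realfun lra ring zify.

Set Implicit Arguments.
Unset Strict Implicit.
Unset Printing Implicit Defensive.

Import Order.TTheory GRing.Theory Num.Theory.
Import numFieldNormedType.Exports.

Local Open Scope classical_set_scope.
Local Open Scope ring_scope.

(* Let [w] be the itinerary of a point of Lambda: [w n] tells whether its [n]-th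
   iterate lies in the upper slab.  No two consecutive symbols are 1, the [x]
   and [z] coordinates are determined by [w] through uniform contractions, and
   [y] lies in the intersection of the nested intervals cut out by the past of
   [w].  These intervals need not shrink to points, because the time-one map
   is an isometry for the Hilbert metric of [0, 1]; but the affine branch is a
   strict contraction for it, so Poincare recurrence to the upper slab makes
   them shrink almost surely for every invariant probability without atoms at
   [Q] and [P = (0, 1, 0)].  Such probabilities therefore correspond
   to the shift-invariant probabilities [m] of the golden mean shift that do not
   charge the zero sequence, with the same entropy.

   For [V y = ln (y (1 - y))] the central Jacobian is cohomologous, via [V], to
   [ln y - ln (1 - sigma (1 - y))] on the upper slab and to 0 on the lower one.
   Hence the central exponent [l m] is negative.  The critical parameter is
   [t0 = sup_m h m / (1 - l m)], which is positive by testing a Markov measure.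
   It is attained: in a weak limit of a maximizing sequence, a mass [c] on the
   zero sequence has no entropy and the exponent is an infimum of expectations
   of cylinder functions vanishing there, so removing that mass only increases
   the quotient.

   Splitting off the atoms at [Q] and [P], whose exponents are 1 and -1, gives
   [h mu <= t0 (1 - l mu)] for all invariant [mu], that is,
   [pressure_t mu <= t + (t0 - t) (1 - l mu)], and [l mu <= 1] with equality only
   at the Dirac measure; the three regimes can be read off from this. *)

(** * Entropy of finite-valued maps *)

Section finite_entropy.
Context {R : realType}.
Implicit Types (x y a : R).

(** The denominator [1 - l] measures the competition with [Q]: the Dirac measure there has entropy 0
    and exponent 1, hence pressure [t], and [h + t l <= t] says [h <= t (1 - l)]. So [t0] is the
    least [t] at which no invariant measure beats it. Two things obstruct a plain compactness
    argument: mass can escape to the zero sequence in a limit, and the exponent is not continuous,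
    since [y] may be arbitrarily close to 0 at a passage through the upper slab, which makes [psi]
    unbounded below. Only upper semicontinuity is therefore used. Entropy has it as an infimum over
    [k] of [H_k / k], and each term involves finitely many word probabilities. The limit is
    accordingly taken of these probabilities, along an ultrafilter, and a measure is rebuilt from
    them by subdividing [[0, 1)]. Entropy is a supremum over all finite partitions, so the coding
    gives it only through a generator theorem; this rests on Gibbs' inequality and on approximating
    partitions by partitions into cylinders. *)

Definition negxlnx x : R := - (x * ln x).

(** This is [ln (1 + u) <= u] at [u = y / x - 1], the source of concavity and of Gibbs' inequality
    below. The implication between zeros is absolute continuity; it excludes the conventional value
    [ln 0 = 0]. *)
Lemma mul_ln_sub_le x y : 0 <= x -> 0 <= y -> (y = 0 -> x = 0) ->
  x * (ln y - ln x) <= y - x.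
Proof.
move=> x0 y0 yx; have [->|xn0] := eqVneq x 0; first by rewrite mul0r subr0.
have {}x0 : 0 < x by rewrite lt0r xn0.
have {}y0 : 0 < y by rewrite lt0r y0 andbT; apply: contra_neq xn0; exact: yx.
have -> : ln y - ln x = ln (1 + (y / x - 1)).
  by rewrite [1 + _]addrC subrK ln_div ?posrE.
have h : -1 < y / x - 1 by rewrite ltrBDr addrC subrr divr_gt0.
have := le_ln1Dx h; rewrite -(ler_pM2l x0) mulrBr mulr1 mulrCA divff ?gt_eqF// mulr1.
done.
Qed.

Lemma negxlnx_ge0 x : 0 <= x <= 1 -> 0 <= negxlnx x.
Proof.
by move=> /andP[x0 x1]; rewrite /negxlnx oppr_ge0 mulr_ge0_le0// ln_le0.
Qed.

Lemma negxlnx_le x : 0 <= x -> negxlnx x <= 1.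
Proof.
move=> x0; have := @mul_ln_sub_le x 1 x0 ler01.
rewrite ln1 sub0r mulrN -/(negxlnx x) => h.
have := h (fun e => False_ind _ (elimF eqP (oner_eq0 R) e)); lra.
Qed.

Lemma negxlnx0 : negxlnx 0 = 0. Proof. by rewrite /negxlnx mul0r oppr0. Qed.
Lemma negxlnx1 : negxlnx 1 = 0. Proof. by rewrite /negxlnx ln1 mulr0 oppr0. Qed.

(** The tangent inequality at the mean [z] is applied to [x] and to [y]; the weighted corrections
    [z - x] and [z - y] cancel. *)
Lemma negxlnx_concave a x y : 0 <= a <= 1 -> 0 <= x -> 0 <= y ->
  a * negxlnx x + (1 - a) * negxlnx y <= negxlnx (a * x + (1 - a) * y).
Proof.
move=> /andP[a0 a1] x0 y0; set z := a * x + (1 - a) * y.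
have b0 : 0 <= 1 - a by rewrite subr_ge0.
have z0 : 0 <= z by rewrite addr_ge0// mulr_ge0.
have hx : a * (x * (ln z - ln x)) <= a * (z - x).
  have [->|an0] := eqVneq a 0; first by rewrite !mul0r.
  apply: ler_wpM2l => //; apply: mul_ln_sub_le => //.
  move/eqP; rewrite /z paddr_eq0 ?mulr_ge0// mulf_eq0 (negPf an0)/= => /andP[/eqP//].
have hy : (1 - a) * (y * (ln z - ln y)) <= (1 - a) * (z - y).
  have [->|an0] := eqVneq (1 - a) 0; first by rewrite !mul0r.
  apply: ler_wpM2l => //; apply: mul_ln_sub_le => //.
  move/eqP; rewrite /z paddr_eq0 ?mulr_ge0// [(1 - a) * y == 0]mulf_eq0 (negPf an0)/= => /andP[_ /eqP//].
have : a * (z - x) + (1 - a) * (z - y) = 0 by rewrite /z; ring.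
rewrite /negxlnx; have -> : z * ln z = a * x * ln z + (1 - a) * y * ln z by rewrite -mulrDl.
lra.
Qed.

Lemma negxlnx_addl x y : 0 <= x -> 0 <= y -> negxlnx (x + y) <= negxlnx x + negxlnx y.
Proof.
move=> x0 y0.
have h (u v : R) : 0 <= u -> 0 <= v -> u * ln u <= u * ln (u + v).
  move=> u0 v0; have [->|un0] := eqVneq u 0; first by rewrite !mul0r.
  have {}u0 : 0 < u by rewrite lt0r un0.
  apply: ler_wpM2l; first exact: ltW.
  by rewrite ler_ln ?posrE ?lerDl// ltr_wpDr.
rewrite /negxlnx mulrDl; have := h _ _ x0 y0; have := h _ _ y0 x0; rewrite (addrC y x); lra.
Qed.

Lemma negxlnxM x y : 0 <= x -> 0 <= y -> negxlnx (x * y) = x * negxlnx y + y * negxlnx x.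
Proof.
move=> x0 y0; have [->|xn0] := eqVneq x 0; first by rewrite mul0r negxlnx0 mulr0 mul0r addr0.
have [->|yn0] := eqVneq y 0; first by rewrite mul0r mulr0 negxlnx0 mulr0 addr0.
by rewrite /negxlnx lnM ?posrE ?lt0r ?xn0 ?yn0//; ring.
Qed.

(** With [x = s * s] the product rule gives [2 * s * negxlnx s], and [negxlnx s <= 1]. This is the
    modulus of continuity at 0. *)
Lemma negxlnx_le_sqrt x : 0 < x -> negxlnx x <= 2 * Num.sqrt x.
Proof.
move=> x0; set s := Num.sqrt x.
have s0 : 0 < s by rewrite sqrtr_gt0.
have xs : x = s * s by rewrite -expr2 sqr_sqrtr// ltW.
rewrite xs negxlnxM; [|exact: ltW|exact: ltW]; have : s * negxlnx s <= s * 1 by apply: ler_wpM2l; [exact: ltW|apply: negxlnx_le; exact: ltW].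
lra.
Qed.

Lemma continuous_negxlnx : continuous negxlnx.
Proof.
move=> x; have [x0|x0|->] := ltrgtP x 0.
- rewrite /continuous_at [X in _ --> X](_ : _ = 0 :> R); last first.
    by rewrite /negxlnx ln0 ?mulr0 ?oppr0// ltW.
  apply: cvg_near_cst; near=> z; rewrite /negxlnx ln0 ?mulr0 ?oppr0//.
  by apply/ltW; near: z; exact: lt_nbhsl.
- apply: cvgN; apply: cvgM; first exact: cvg_id.
  exact: continuous_ln.
- rewrite /continuous_at negxlnx0; apply/cvgrPdist_lt => e e0.
  near=> z; rewrite sub0r normrN.
  have [z0|z0] := leP z 0; first by rewrite /negxlnx ln0// mulr0 oppr0 normr0.
  have z1 : z <= 1.
    near: z; apply: lt_le_nbhsl; exact: ltr01.
  have ze : z < (e / 2) ^+ 2.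
    near: z; apply: lt_nbhsl; by rewrite exprn_gt0// divr_gt0.
  rewrite ger0_norm ?negxlnx_ge0 ?(ltW z0)//.
  apply: le_lt_trans (negxlnx_le_sqrt z0) _.
  have : Num.sqrt z < e / 2.
    by rewrite -(ltr_sqrt z) ?exprn_gt0 ?divr_gt0// in ze; rewrite sqrtr_sqr gtr0_norm ?divr_gt0 in ze.
  lra.
Unshelve. all: end_near.
Qed.

End finite_entropy.

Lemma cvg_sumr {R : realType} {K : Type} {F : set_system K} {FF : Filter F}
    (I : Type) (r : seq I) (f : I -> K -> R) (l : I -> R) :
  (forall i, f i x @[x --> F] --> l i) ->
  \sum_(i <- r) f i x @[x --> F] --> \sum_(i <- r) l i.
Proof.
move=> h; elim: r => [|i r IH].
  by rewrite big_nil; under eq_fun do rewrite big_nil; exact: cvg_cst.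
by rewrite big_cons; under eq_fun do rewrite big_cons; apply: cvgD.
Qed.

(** * Partitions as finite-valued maps, and Shannon's inequalities *)

Section simple_maps.
Context {d : measure_display} {T : measurableType d} {R : realType}.
Variable mu : probability T R.

(** A finite measurable partition is encoded as the map naming its cells: joins become pairs,
    coarsenings post-composition, and pulling back by the dynamics pre-composition. *)
Definition simple_map (I : Type) (xi : T -> I) :=
  forall i, measurable (xi @^-1` [set i]).

Definition pr (A : set T) : R := fine (mu A).

Definition dist (I : Type) (xi : T -> I) (i : I) : R := pr (xi @^-1` [set i]).

Definition entropy (I : finType) (xi : T -> I) : R := \sum_i negxlnx (dist xi i).

Lemma prE A : measurable A -> mu A = (pr A)%:E.
Proof. by move=> mA; rewrite fineK// fin_num_measure. Qed.

Lemma pr_ge0 A : 0 <= pr A.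
Proof. by rewrite fine_ge0// measure_ge0. Qed.

Lemma pr_le1 A : measurable A -> pr A <= 1.
Proof. by move=> mA; rewrite -lee_fin -prE// probability_le1. Qed.

Lemma prT : pr setT = 1. Proof. by rewrite /pr probability_setT. Qed.

Lemma pr_le A B : measurable A -> measurable B -> A `<=` B -> pr A <= pr B.
Proof. by move=> mA mB AB; rewrite -lee_fin -!prE// le_measure// inE. Qed.

Lemma prU_le A B : measurable A -> measurable B -> pr (A `|` B) <= pr A + pr B.
Proof.
move=> mA mB; rewrite -lee_fin EFinD -!prE//; last exact: measurableU.
exact: measureU2.
Qed.

Lemma prC A : measurable A -> pr (~` A) = 1 - pr A.
Proof.
move=> mA; apply: EFin_inj; rewrite EFinB -!prE//; last exact: measurableC.
by rewrite probability_setC.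
Qed.

Section finite_range.
Variables (I : finType) (xi : T -> I).
Hypothesis xiS : simple_map xi.

Lemma preimage_predE (P : pred I) :
  [set x | P (xi x)] = \bigcup_(i in [set` P]) xi @^-1` [set i].
Proof.
by apply/seteqP; split=> [x /= Px|x [i /= Pi ->]//]; exists (xi x).
Qed.

Lemma measurable_simple_pred (P : pred I) : measurable [set x | P (xi x)].
Proof.
rewrite preimage_predE; apply: fin_bigcup_measurable => //; exact: finite_finset.
Qed.

Lemma pr_simple_pred (P : pred I) :
  pr [set x | P (xi x)] = \sum_(i | P i) dist xi i.
Proof.
rewrite /pr preimage_predE measure_fin_bigcup//; last by move=> i j _ _ [x [/= <- <-]].
rewrite -(@bigfs _ _ _ _ (index_enum I))//; last 2 first.
- exact: index_enum_uniq.
- by move=> i _; rewrite mem_index_enum.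
rewrite (eq_bigr (fun i => (dist xi i)%:E)); last by move=> i _; exact: prE.
by rewrite sumEFin.
Qed.

Lemma simple_comp (J : Type) (g : I -> J) : simple_map (g \o xi).
Proof.
move=> j; have -> : (g \o xi) @^-1` [set j] = [set x | `[< g (xi x) = j >]].
  by apply/seteqP; split=> x /= /asboolP.
exact: measurable_simple_pred (fun i => `[< g i = j >]).
Qed.

Lemma dist_comp (J : eqType) (g : I -> J) j :
  dist (g \o xi) j = \sum_(i | g i == j) dist xi i.
Proof.
rewrite -pr_simple_pred; congr pr; apply/seteqP; split=> x /= /eqP//.
Qed.

Lemma dist_ge0 i : 0 <= dist xi i. Proof. exact: pr_ge0. Qed.

Lemma dist_le1 i : dist xi i <= 1. Proof. exact: pr_le1. Qed.

Lemma sum_dist : \sum_i dist xi i = 1.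
Proof.
rewrite -(pr_simple_pred xpredT) -prT; congr pr.
by apply/seteqP; split.
Qed.

Lemma entropy_ge0 : 0 <= entropy xi.
Proof. by apply: sumr_ge0 => i _; rewrite negxlnx_ge0// dist_ge0 dist_le1. Qed.

Lemma entropy_le_card : entropy xi <= #|I|%:R.
Proof.
rewrite -sum1_card natr_sum; apply: ler_sum => i _.
by apply: negxlnx_le; exact: dist_ge0.
Qed.

Lemma negxlnx_sum_le (K : finType) (P : pred K) (p : K -> R) :
  (forall k, 0 <= p k) -> negxlnx (\sum_(k | P k) p k) <= \sum_(k | P k) negxlnx (p k).
Proof.
move=> p0.
suff [] : negxlnx (\sum_(k | P k) p k) <= \sum_(k | P k) negxlnx (p k) /\
  0 <= \sum_(k | P k) p k by [].
apply: (big_ind2 (fun x y => negxlnx x <= y /\ 0 <= x)) => [|x y u v [h1 h2] [h3 h4]|k _].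
- by rewrite negxlnx0.
- split; last exact: addr_ge0.
  by apply: le_trans (negxlnx_addl h2 h4) _; rewrite lerD.
- by [].
Qed.

Lemma entropy_comp_le (J : finType) (g : I -> J) :
  entropy (g \o xi) <= entropy xi.
Proof.
rewrite [leRHS](partition_big g xpredT)//=; apply: ler_sum => j _.
by rewrite dist_comp; apply: negxlnx_sum_le => i; exact: dist_ge0.
Qed.

End finite_range.

Lemma entropy_comp_inj (I J : finType) (xi : T -> I) (g : I -> J) :
  simple_map xi -> injective g -> entropy (g \o xi) = entropy xi.
Proof.
move=> xiS gi; apply/eqP; rewrite eq_le entropy_comp_le//=.
have [i0|] := pickP (fun i : I => true).
  move=> _.
  pose h j := odflt i0 [pick i | g i == j].
  have hg : xi = h \o (g \o xi).
    apply/funext => x /=; rewrite /h; case: pickP => [i /eqP/gi//|/(_ (xi x))].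
    by rewrite eqxx.
  rewrite {1}hg; apply: entropy_comp_le; exact: simple_comp.
move=> I0; rewrite /entropy big1 ?sumr_ge0// => [j _|i _]; last by have := I0 i.
by apply: negxlnx_ge0; rewrite pr_ge0 pr_le1//; exact: simple_comp.
Qed.

Lemma simple_pair (I J : Type) (xi : T -> I) (ze : T -> J) :
  simple_map xi -> simple_map ze -> simple_map (fun x => (xi x, ze x)).
Proof.
move=> h k [i j]; have -> : (fun x => (xi x, ze x)) @^-1` [set (i, j)] =
    xi @^-1` [set i] `&` ze @^-1` [set j].
  by apply/seteqP; split=> x /= [-> ->].
exact: measurableI.
Qed.

(* Gibbs' inequality against q(a,b,c) = p(a,c) p(b,c) / p(c). *)
Lemma entropy_submodular (I J K : finType) (xi : T -> I) (ze : T -> J)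
    (th : T -> K) : simple_map xi -> simple_map ze -> simple_map th ->
  entropy (fun x => (xi x, (ze x, th x))) + entropy th <=
  entropy (fun x => (xi x, th x)) + entropy (fun x => (ze x, th x)).
Proof.
move=> hx hz ht; set w := fun x => (xi x, (ze x, th x)).
have hw : simple_map w by do 2 apply: simple_pair => //.
pose p := dist w.
have p0 t : 0 <= p t by exact: dist_ge0.
pose pxt (t : I * (J * K)) := dist (fun x => (xi x, th x)) (t.1, t.2.2).
pose pzt (t : I * (J * K)) := dist (fun x => (ze x, th x)) t.2.
pose pt (t : I * (J * K)) := dist th t.2.2.
(* Each marginal entropy becomes a sum over the joint values [t], so that the four entropies can be
   compared term by term. *)
have marg (L : finType) (g : I * (J * K) -> L) : entropy (g \o w) =
    - \sum_t p t * ln (dist (g \o w) (g t)).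
  rewrite /entropy -sumrN [RHS](partition_big g xpredT)//=; apply: eq_bigr => l _.
  under eq_bigr => t /eqP gt do rewrite gt.
  by rewrite sumrN /negxlnx -mulr_suml -dist_comp.
have E1 := marg _ (fun t => (t.1, t.2.2)).
have E2 := marg _ (fun t => t.2).
have E3 := marg _ (fun t => t.2.2).
have E4 := marg _ id.
rewrite [(_ \o w)]/comp /= in E1; rewrite [(_ \o w)]/comp /= in E2.
rewrite [(_ \o w)]/comp /= in E3; rewrite [(_ \o w)]/comp /= in E4.
rewrite -/(entropy w) E1 E2 E3 E4.
have le1 (L : finType) (g : I * (J * K) -> L) t : p t <= dist (g \o w) (g t).
  rewrite dist_comp// (bigD1 t)//= lerDl sumr_ge0// => s _; exact: p0.
have le2 (t : I * (J * K)) : pzt t <= pt t.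
  have hzt : simple_map (fun x => (ze x, th x)) by exact: simple_pair.
  rewrite /pt -[th]/(snd \o (fun x => (ze x, th x))) dist_comp//.
  by rewrite (bigD1 t.2)//= lerDl sumr_ge0// => s _; exact: dist_ge0.
pose q t := pxt t * pzt t / pt t.
have q0 t : 0 <= q t by rewrite /q divr_ge0// ?mulr_ge0//; exact: pr_ge0.
(* Summing out the first two coordinates leaves [p(c) * p(c) / p(c)], which equals [p(c)] even when
   [p(c) = 0]. *)
have sq : \sum_t q t <= 1.
  rewrite -(sum_dist ht) (eq_bigr (fun t => (fun i (jk : J * K) => q (i, jk)) t.1 t.2)); last by case.
  rewrite -(pair_big xpredT xpredT (fun i jk => q (i, jk)))/= exchange_big/=.
  rewrite (eq_bigr (fun jk => (fun j k => \sum_i q (i, (j, k))) jk.1 jk.2)); last by case.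
  rewrite -(pair_big xpredT xpredT (fun j k => \sum_i q (i, (j, k))))/= exchange_big/=.
  apply: ler_sum => k _.
  have s1 : \sum_i dist (fun x => (xi x, th x)) (i, k) = dist th k.
    have hxt : simple_map (fun x => (xi x, th x)) by exact: simple_pair.
    rewrite -[th in RHS]/(snd \o (fun x => (xi x, th x))) dist_comp//.
    rewrite (eq_bigl (fun t : I * K => xpredT t.1 && (t.2 == k)))//.
    rewrite [RHS](eq_bigr (fun t => (fun i l => dist (fun x => (xi x, th x)) (i, l)) t.1 t.2)); last by case.
    rewrite -(pair_big xpredT (fun l => l == k) (fun i l => dist (fun x => (xi x, th x)) (i, l)))/=.
    by apply: eq_bigr => i _; rewrite big_pred1_eq.
  have s2 : \sum_j dist (fun x => (ze x, th x)) (j, k) = dist th k.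
    have hzt : simple_map (fun x => (ze x, th x)) by exact: simple_pair.
    rewrite -[th in RHS]/(snd \o (fun x => (ze x, th x))) dist_comp//.
    rewrite (eq_bigl (fun t : J * K => xpredT t.1 && (t.2 == k)))//.
    rewrite [RHS](eq_bigr (fun t => (fun i l => dist (fun x => (ze x, th x)) (i, l)) t.1 t.2)); last by case.
    rewrite -(pair_big xpredT (fun l => l == k) (fun i l => dist (fun x => (ze x, th x)) (i, l)))/=.
    by apply: eq_bigr => i _; rewrite big_pred1_eq.
  rewrite /q /pxt /pzt /pt /=.
  under eq_bigr do (under eq_bigr do rewrite -mulrA; rewrite -mulr_suml s1).
  rewrite -mulr_sumr -mulr_suml s2.
  have [->|n0] := eqVneq (dist th k) 0; first by rewrite !mul0r.
  by rewrite divff// mulr1.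
have key t : p t * (ln (pxt t) + ln (pzt t) - ln (pt t) - ln (p t)) <= q t - p t.
  have [pt0|] := eqVneq (p t) 0; first by rewrite pt0 mul0r subr0.
  move=> pn0.
  have pp : 0 < p t by rewrite lt0r pn0 p0.
  have a1 : 0 < pxt t by apply: lt_le_trans pp (le1 _ (fun t => (t.1, t.2.2)) t).
  have a2 : 0 < pzt t by apply: lt_le_trans pp (le1 _ (fun t => t.2) t).
  have a3 : 0 < pt t by apply: lt_le_trans pp (le1 _ (fun t => t.2.2) t).
  rewrite -lnM ?posrE// -ln_div ?posrE ?mulr_gt0//.
  apply: mul_ln_sub_le; [exact: p0|exact: q0|]; rewrite -/(q t) => /eqP; rewrite gt_eqF//.
  by rewrite divr_gt0// mulr_gt0.
have : \sum_t p t * ln (pxt t) + \sum_t p t * ln (pzt t) -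
    \sum_t p t * ln (pt t) - \sum_t p t * ln (p t) <= 0.
  rewrite -big_split/= -!sumrB; apply: (@le_trans _ _ (\sum_t (q t - p t))).
    by apply: ler_sum => t _; rewrite -mulrDr -!mulrBr; exact: key.
  by rewrite sumrB (sum_dist hw) subr_le0.
rewrite /p /pxt /pzt /pt; lra.
Qed.

Lemma entropy_unit (xi : T -> unit) : entropy xi = 0.
Proof.
rewrite /entropy big1// => -[] _; rewrite /dist.
have -> : xi @^-1` [set tt] = setT by apply/seteqP; split=> x //= _; case: (xi x).
by rewrite prT negxlnx1.
Qed.

(** Submodularity with a constant third map, whose entropy is 0. *)
Lemma entropy_pair_le (I J : finType) (xi : T -> I) (ze : T -> J) :
  simple_map xi -> simple_map ze ->
  entropy (fun x => (xi x, ze x)) <= entropy xi + entropy ze.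
Proof.
move=> hx hz.
have hu : simple_map (fun _ : T => tt).
  by move=> i; rewrite preimage_cst; case: ifP.
have := entropy_submodular hx hz hu; rewrite entropy_unit addr0.
have hxz := simple_pair hx hz.
have -> : (fun x => (xi x, (ze x, tt))) = (fun t => (t.1, (t.2, tt))) \o (fun x => (xi x, ze x)) by [].
have -> : (fun x => (xi x, tt)) = (fun i => (i, tt)) \o xi by [].
have -> : (fun x => (ze x, tt)) = (fun i => (i, tt)) \o ze by [].
rewrite !entropy_comp_inj//; by [move=> i j []| move=> [i j] [k l] /= [-> ->]].
Qed.

End simple_maps.

(** * Entropy rates *)

Section fekete.
Context {R : realType}.
Variable a : nat -> R.
Hypothesis a_ge0 : forall n, 0 <= a n.
Hypothesis a_subadd : forall n m, a (n + m)%N <= a n + a m.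

Let slope n := a n / n%:R.
(** The index 0 is excluded because [a 0 / 0 = 0] would force the infimum of these nonnegative
    slopes to be 0. *)
Definition fekete_limit := inf [set slope n | n in [set n | (0 < n)%N]].

Let has_inf_slope : has_inf [set slope n | n in [set n | (0 < n)%N]].
Proof.
split; first by exists (slope 1), 1%N.
by exists 0 => _ [n /= n0 <-]; rewrite divr_ge0.
Qed.

Lemma fekete_le n : (0 < n)%N -> fekete_limit <= a n / n%:R.
Proof.
by move=> n0; apply: ge_inf; [case: has_inf_slope|exists n].
Qed.

Lemma fekete_limit_ge0 : 0 <= fekete_limit.
Proof.
by apply: lb_le_inf => [|_ [n /= n0 <-]]; [case: has_inf_slope|rewrite divr_ge0].
Qed.

(** Divide [n = q * N + r]: the [q] full blocks cost [q * a N], and the sum of all [a i] with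
    [i < N] dominates the remainder [a r]. *)
Lemma subadd_affine N : (0 < N)%N ->
  exists C, forall n, a n <= n%:R * (a N / N%:R) + C.
Proof.
move=> N0; exists (\sum_(i < N) a i) => n.
rewrite (divn_eq n N); set q := (n %/ N)%N; set r := (n %% N)%N.
have rN : (r < N)%N by rewrite ltn_mod.
have aq : a (q * N)%N <= q%:R * a N + a 0.
  elim: q => [|q IH]; first by rewrite mul0n mul0r add0r.
  rewrite mulSn; apply: le_trans (a_subadd _ _) _.
  by rewrite -[q.+1]add1n natrD mulrDl mul1r -addrA lerD2l.
have [->|q0] := eqVneq q 0%N.
  rewrite mul0n add0n (bigD1 (Ordinal rN))//= addrCA lerDl.
  by rewrite addr_ge0 ?sumr_ge0// mulr_ge0// divr_ge0.
have {}aq : a (q * N)%N <= q%:R * a N.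
  case: q q0 {aq} => // q _; elim: q => [|q IH]; first by rewrite mul1n mul1r.
  rewrite mulSn; apply: le_trans (a_subadd _ _) _.
  by rewrite -[in leRHS]add1n natrD mulrDl mul1r lerD2l.
apply: le_trans (a_subadd _ _) _; rewrite natrD natrM mulrDl.
rewrite -[X in _ <= X + _ + _]mulrA [N%:R * _]mulrC divfK ?pnatr_eq0 -?lt0n//.
have h : a r <= \sum_(i < N) a i.
  by rewrite (bigD1 (Ordinal rN))//= lerDl sumr_ge0.
have : 0 <= r%:R * (a N / N%:R) by rewrite mulr_ge0// divr_ge0.
lra.
Qed.

Lemma fekete_cvg : a n / n%:R @[n --> \oo] --> fekete_limit.
Proof.
apply/cvgrPdist_le => e e0.
have [_ [N /= N0 <-] hN] := inf_adherent (divr_gt0 e0 (ltr0n _ 2)) has_inf_slope.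
have [C hC] := subadd_affine N0.
near=> n.
have n0 : (0 < n)%N by near: n; exact: nbhs_infty_gt.
have h1 := fekete_le n0.
rewrite distrC ger0_norm ?subr_ge0// lerBlDl.
have nR : 0 < n%:R :> R by rewrite ltr0n.
have hCn : C / n%:R <= e / 2.
  rewrite ler_pdivrMr// -ler_pdivrMl ?divr_gt0//.
  apply: le_trans (ler_norm _) _.
  by near: n; exact: nbhs_infty_ger.
have : a n / n%:R <= a N / N%:R + C / n%:R.
  rewrite ler_pdivrMr// mulrDl divfK ?gt_eqF// mulrC; exact: hC.
move: hN; rewrite -/fekete_limit /slope => hN; lra.
Unshelve. all: end_near.
Qed.

End fekete.

Definition names (T I : Type) (F : T -> T) (xi : T -> I) (n : nat) (x : T) :
  {ffun 'I_n -> I} := [ffun i : 'I_n => xi (iter i F x)].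

Lemma preimage_names (T I : Type) (F : T -> T) (xi : T -> I) n v :
  names F xi n @^-1` [set v] = [set x | forall i : 'I_n, xi (iter i F x) = v i].
Proof.
apply/seteqP; split=> x /=; first by move=> <- i; rewrite ffunE.
by move=> h; apply/ffunP => i; rewrite ffunE.
Qed.

Definition preserves {d} {T : measurableType d} {R : realType}
  (mu : probability T R) (F : T -> T) :=
  forall A, measurable A -> mu (F @^-1` A) = mu A.

Section preserving.
Context {d : measure_display} {T : measurableType d} {R : realType}.
Variables (mu : probability T R) (F : T -> T).
Hypothesis mF : measurable_fun setT F.
Hypothesis muF : preserves mu F.

Lemma measurable_iter n : measurable_fun setT (iter n F).
Proof.
elim: n => [|n IH]; first exact: measurable_id.
exact: (measurableT_comp mF IH).
Qed.

Lemma measurable_preimage (A : set T) : measurable A -> measurable (F @^-1` A).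
Proof. by move=> mA; rewrite -[X in measurable X]setTI; exact: mF. Qed.

Lemma measurable_preimage_iter n (A : set T) :
  measurable A -> measurable (iter n F @^-1` A).
Proof. by move=> mA; rewrite -[X in measurable X]setTI; exact: measurable_iter. Qed.

Lemma preserves_iter n : preserves mu (iter n F).
Proof.
elim: n => [|n IH] A mA //.
exact: etrans (IH _ (measurable_preimage mA)) (muF mA).
Qed.

Lemma entropy_preserves (I : finType) (xi : T -> I) n : simple_map xi ->
  entropy mu (xi \o iter n F) = entropy mu xi.
Proof.
move=> hx; apply: eq_bigr => i _; congr negxlnx; rewrite /dist /pr.
by congr fine; exact: (preserves_iter n (hx i)).
Qed.

Variables (I : finType) (xi : T -> I).
Hypothesis hxi : simple_map xi.

Lemma simple_iter n : simple_map (xi \o iter n F).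
Proof. by move=> i; apply: (measurable_preimage_iter n (hxi i)). Qed.

Lemma simple_names n : simple_map (names F xi n).
Proof.
move=> v; rewrite preimage_names.
rewrite (_ : [set x | _] = \bigcap_(i in [set: 'I_n]) ((xi \o iter i F) @^-1` [set v i])).
  apply: fin_bigcap_measurable => // i _; exact: simple_iter.
by apply/seteqP; split=> [x h i _|x h i]; [exact: h|exact: h].
Qed.

Lemma names_add n m : exists g : {ffun 'I_n -> I} * {ffun 'I_m -> I} -> {ffun 'I_(n + m) -> I},
  names F xi (n + m) = g \o (fun x => (names F xi n x, names F xi m (iter n F x))).
Proof.
exists (fun p : {ffun 'I_n -> I} * {ffun 'I_m -> I} => [ffun i : 'I_(n + m) => match fintype.split i with inl j => p.1 j | inr j => p.2 j end]).
apply/funext => x; apply/ffunP => i; rewrite !ffunE /=.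
by case: split_ordP => j ->; rewrite ffunE//= -iterD addnC.
Qed.

Lemma entropy_names_subadd n m :
  entropy mu (names F xi (n + m)) <= entropy mu (names F xi n) + entropy mu (names F xi m).
Proof.
have [g ->] := names_add n m.
have h2 : simple_map (names F xi m \o iter n F).
  move=> v; apply: (measurable_preimage_iter n (A := names F xi m @^-1` [set v])).
  exact: simple_names.
apply: le_trans (entropy_comp_le _ (simple_pair (@simple_names n) h2) _) _.
apply: le_trans (entropy_pair_le _ (@simple_names n) h2) _.
by rewrite entropy_preserves//; exact: simple_names.
Qed.

Lemma entropy_names_ge0 n : 0 <= entropy mu (names F xi n).
Proof. by apply: entropy_ge0; exact: simple_names. Qed.

(** Taken as the infimum rather than the limit: the bound by every finite-time average is what later
    gives upper semicontinuity. *)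
Definition entropy_rate := fekete_limit (fun n => entropy mu (names F xi n)).

Lemma entropy_rate_cvg :
  entropy mu (names F xi n) / n%:R @[n --> \oo] --> entropy_rate.
Proof. exact: fekete_cvg entropy_names_ge0 entropy_names_subadd. Qed.

Lemma entropy_rate_le n : (0 < n)%N ->
  entropy_rate <= entropy mu (names F xi n) / n%:R.
Proof. exact: fekete_le entropy_names_ge0 _. Qed.

Lemma entropy_rate_ge0 : 0 <= entropy_rate.
Proof. exact: fekete_limit_ge0 entropy_names_ge0. Qed.

End preserving.

Section finite_partitions.
Context {d : measure_display} {T : measurableType d} {R : realType}.

Lemma finite_partitionP k (P : 'I_k -> set T) : finite_partition P ->
  exists2 xi : T -> 'I_k, simple_map xi & P = fun i => xi @^-1` [set i].
Proof.
move=> [mP tP cP].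
have ex x : exists i, P i x.
  have : [set: T] x by []. by rewrite -cP => -[i _ Pi]; exists i.
pose xi x := projT1 (cid (ex x)).
have xiP x : P (xi x) x by rewrite /xi; case: cid.
have PE : P = fun i => xi @^-1` [set i].
  apply/funext => i; apply/seteqP; split=> [x Px|x /= <-]; last exact: xiP.
  by apply: (tP _ _ I I); exists x.
by exists xi => // i; have := mP i; rewrite PE.
Qed.

Lemma simple_partition k (xi : T -> 'I_k) : simple_map xi ->
  finite_partition (fun i => xi @^-1` [set i]).
Proof.
move=> hx; split => //; first by move=> i j _ _ [x [/= <- <-]].
by apply/seteqP; split=> x // _; exists (xi x).
Qed.

Lemma join_entropyE (mu : probability T R) (F : T -> T) k (xi : T -> 'I_k) n :
  join_entropy mu F (fun i => xi @^-1` [set i]) n = entropy mu (names F xi n).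
Proof.
rewrite /join_entropy /entropy -sumrN; apply: eq_bigr => w _.
suff -> : join_cell F (fun i => xi @^-1` [set i]) w = names F xi n @^-1` [set w] by [].
by rewrite [RHS]preimage_names.
Qed.

Lemma partition_entropyE (mu : probability T R) (F : T -> T) k (xi : T -> 'I_k) :
  measurable_fun setT F -> preserves mu F -> simple_map xi ->
  partition_entropy mu F (fun i => xi @^-1` [set i]) = entropy_rate mu F xi.
Proof.
move=> mF muF hx; rewrite /partition_entropy.
under eq_fun do rewrite join_entropyE.
by apply/cvg_lim => //; exact: entropy_rate_cvg.
Qed.

Lemma metric_entropyE (mu : probability T R) (F : T -> T) :
  measurable_fun setT F -> preserves mu F ->
  metric_entropy mu F = ereal_sup [set h | exists (k : nat) (xi : T -> 'I_k),
    simple_map xi /\ h = (entropy_rate mu F xi)%:E].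
Proof.
move=> mF muF; congr ereal_sup; apply/seteqP; split=> h /= [k].
- move=> [P [/finite_partitionP[xi hx ->] ->]]; exists k, xi.
  by rewrite partition_entropyE.
- move=> [xi [hx ->]]; exists k, (fun i => xi @^-1` [set i]).
  by rewrite partition_entropyE//; split => //; exact: simple_partition.
Qed.

End finite_partitions.

(** * Approximation in measure by an algebra of sets *)

Section more_entropy.
Context {d : measure_display} {T : measurableType d} {R : realType}.
Variable mu : probability T R.

Lemma entropy_le_of (I J : finType) (xi : T -> I) (ze : T -> J) (g : I -> J) :
  simple_map xi -> (forall x, ze x = g (xi x)) -> entropy mu ze <= entropy mu xi.
Proof.
by move=> hx /funext ->; exact: entropy_comp_le.
Qed.

Lemma entropy_cst (I : finType) (xi : T -> I) i : (forall x, xi x = i) ->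
  entropy mu xi = 0.
Proof.
move=> h; apply/eqP; rewrite eq_le; apply/andP; split.
  rewrite -(entropy_unit mu (fun=> tt)).
  apply: (@entropy_le_of _ _ _ _ (fun=> i)) => //.
  by move=> j; rewrite preimage_cst; case: ifP.
apply: entropy_ge0 => j; rewrite (_ : xi = fun=> i) ?preimage_cst; first by case: ifP.
exact/funext.
Qed.

Definition symdiff (A B : set T) := (A `\` B) `|` (B `\` A).

Lemma measurable_symdiff A B : measurable A -> measurable B ->
  measurable (symdiff A B).
Proof. by move=> mA mB; apply: measurableU; apply: measurableD. Qed.

Lemma symdiff_refl A : symdiff A A = set0.
Proof. by rewrite /symdiff setDv setU0. Qed.

Lemma symdiffC A B : symdiff (~` A) (~` B) = symdiff A B.
Proof.
by rewrite /symdiff !setDE !setCK setUC [X in X `|` _]setIC [X in _ `|` X]setIC.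
Qed.

Lemma pr_approx A B : measurable A -> measurable B ->
  `|pr mu A - pr mu B| <= pr mu (symdiff A B).
Proof.
move=> mA mB.
have mD := measurable_symdiff mA mB.
have h1 : pr mu A <= pr mu B + pr mu (symdiff A B).
  apply: le_trans (prU_le _ _ _) => //; apply: pr_le => //; first exact: measurableU.
  by move=> x Ax; have [?|?] := pselect (B x); [left|right; left].
have h2 : pr mu B <= pr mu A + pr mu (symdiff A B).
  apply: le_trans (prU_le _ _ _) => //; apply: pr_le => //; first exact: measurableU.
  by move=> x Bx; have [?|?] := pselect (A x); [left|right; right].
by rewrite ler_norml; apply/andP; split; lra.
Qed.

Section approximation.
Variable G : set (set T).
Hypothesis mG : forall A, G A -> measurable A.
Hypothesis G0 : G set0.
Hypothesis GC : forall A, G A -> G (~` A).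
Hypothesis GU : forall A B, G A -> G B -> G (A `|` B).
Hypothesis gen : @measurable _ T `<=` <<s G >>.

Let approx A := measurable A /\
  forall e, 0 < e -> exists2 B, G B & pr mu (symdiff A B) < e.

Let approxU A B : approx A -> approx B -> approx (A `|` B).
Proof.
move=> [mA hA] [mB hB]; split; first exact: measurableU.
move=> e e0; have e20 : 0 < e / 2 by rewrite divr_gt0.
have [A' GA' hA'] := hA _ e20; have [B' GB' hB'] := hB _ e20.
exists (A' `|` B'); first exact: GU.
have mA' := mG GA'; have mB' := mG GB'.
rewrite [ltRHS](splitr e); apply: le_lt_trans (ltrD hA' hB').
apply: le_trans (prU_le mu (measurable_symdiff mA mA') (measurable_symdiff mB mB')).
apply: pr_le.
- by apply: measurable_symdiff; exact: measurableU.
- by apply: measurableU; exact: measurable_symdiff.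
- move=> x [[[?|?] /not_orP[? ?]]|[[?|?] /not_orP[? ?]]].
  + by left; left.
  + by right; left.
  + by left; right.
  + by right; right.
Qed.

(** The sets that can be approximated by members of the algebra [G] form a sigma-algebra containing
    [G]. *)
Lemma measurable_approx A e : measurable A -> 0 < e ->
  exists2 B, G B & pr mu (symdiff A B) < e.
Proof.
move=> mA; suff : approx A by case=> _; exact.
have : <<s G >> A by exact: gen.
apply: (@smallest_sub _ (sigma_algebra setT) G approx); last first.
  move=> B GB; split; first exact: mG.
  by move=> e' e0; exists B => //; rewrite symdiff_refl /pr measure0.
split.
- by split => // e' e0; exists set0 => //; rewrite symdiff_refl /pr measure0.
- move=> B [mB hB]; rewrite setTD; split; first exact: measurableC.
  move=> e' e0; have [B' GB' hB'] := hB _ e0; exists (~` B'); first exact: GC.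
  by rewrite symdiffC.
- move=> B aB; have mB n : measurable (B n) by case: (aB n).
  split; first exact: bigcupT_measurable.
  move=> e' e0; pose U n := \big[setU/set0]_(i < n.+1) B i.
  have aU n : approx (U n).
    elim: n => [|n IH]; first by rewrite /U big_ord_recl big_ord0 setU0.
    by rewrite /U big_ord_recr/=; exact: approxU.
  have mU n : measurable (U n) by case: (aU n).
  have UE : \bigcup_n U n = \bigcup_n B n by rewrite bigcup_bigsetU_bigcup.
  have mUU : measurable (\bigcup_n U n) by exact: bigcupT_measurable.
  (* For a countable union, continuity from below makes some finite union [U n] miss less than
     [e' / 2], and [U n] is itself approximable. *)
  have : pr mu (U n) @[n --> \oo] --> pr mu (\bigcup_n U n).
    apply: fine_cvg; rewrite -prE//.
    apply: nondecreasing_cvg_mu => //.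
    by move=> n m nm; apply/subsetPset; exact: subset_bigsetU.
  move=> /cvgrPdist_lt/(_ _ (divr_gt0 e0 (ltr0n _ 2)))[n _ /(_ n (leqnn n)) hn].
  have [V GV hV] := (aU n).2 _ (divr_gt0 e0 (ltr0n _ 2)).
  exists V => //; have mV := mG GV.
  have sub : U n `<=` \bigcup_n U n by move=> x Ux; exists n.
  have mD := measurableD mUU (mU n).
  have hD : pr mu (\bigcup_n U n `\` U n) < e' / 2.
    apply: le_lt_trans hn; apply: le_trans (ler_norm _).
    rewrite lerBrDr -lee_fin EFinD -!prE//.
    rewrite -measureU//; last by rewrite setDKI.
    by rewrite setUC setDUK.
  rewrite -UE [ltRHS](splitr e'); apply: le_lt_trans (ltrD hD hV).
  apply: le_trans (prU_le mu mD (measurable_symdiff (mU n) mV)).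
  apply: pr_le.
  + exact: measurable_symdiff.
  + by apply: measurableU => //; exact: measurable_symdiff.
  + move=> x [[Ax nV]|[Vx nA]]; last by right; right; split=> // /sub.
    by have [Ux|nU] := pselect (U n x); [right; left|left].
Qed.

End approximation.
End more_entropy.

(** * The generator theorem *)

Section generators.
Context {d : measure_display} {T : measurableType d} {R : realType}.
Variables (mu : probability T R) (F : T -> T).
Hypothesis mF : measurable_fun setT F.
Hypothesis muF : preserves mu F.

Lemma simple_namesP (I : finType) (xi : T -> I) (n : nat) : simple_map xi ->
  simple_map (names F xi n).
Proof. by move=> hx v; exact: simple_names. Qed.

Lemma simple_iterP (I : finType) (xi : T -> I) (n : nat) : simple_map xi ->
  simple_map (fun x => xi (iter n F x)).
Proof. by move=> hx v; exact: (simple_iter mF hx). Qed.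

Lemma names_succ (I : finType) (xi : T -> I) n : exists g h,
  (forall x, names F xi n.+1 x = g (names F xi n x, xi (iter n F x))) /\
  (forall x, (names F xi n x, xi (iter n F x)) = h (names F xi n.+1 x)).
Proof.
exists (fun p : {ffun 'I_n -> I} * I => [ffun i : 'I_n.+1 =>
  if unlift ord_max i is Some j then p.1 j else p.2]).
exists (fun w : {ffun 'I_n.+1 -> I} => ([ffun i => w (lift ord_max i)], w ord_max)).
split=> x.
  apply/ffunP => i; rewrite !ffunE; case: unliftP => [j|] -> //=.
  by rewrite ffunE /bump leqNgt ltn_ord add0n.
congr pair; last by rewrite ffunE.
by apply/ffunP => i; rewrite !ffunE lift_max.
Qed.

(* Chain rule: H(xi^n | ze^n) <= n H(xi | ze). *)
Lemma entropy_names_cond (I J : finType) (xi : T -> I) (ze : T -> J) n :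
  simple_map xi -> simple_map ze ->
  entropy mu (names F xi n) <= entropy mu (names F ze n) +
    n%:R * (entropy mu (fun x => (xi x, ze x)) - entropy mu ze).
Proof.
move=> hx hz.
suff h : entropy mu (fun x => (names F xi n x, names F ze n x)) <=
    entropy mu (names F ze n) +
    n%:R * (entropy mu (fun x => (xi x, ze x)) - entropy mu ze).
  apply: le_trans h; apply: (@entropy_le_of _ _ _ _ _ _ _ _ fst) => //.
  by apply: simple_pair; exact: simple_namesP.
elim: n => [|n IH].
  rewrite mul0r addr0 (@entropy_cst _ _ _ _ _ _ ([ffun=> xi point], [ffun=> ze point])).
    by apply: entropy_ge0; exact: simple_namesP.
  by move=> x; congr pair; apply/ffunP => -[].
set A := names F xi n in IH *; set C := names F ze n in IH *.
set p := fun x => xi (iter n F x); set q := fun x => ze (iter n F x).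
have hA : simple_map A by exact: simple_namesP.
have hC : simple_map C by exact: simple_namesP.
have hp : simple_map p by exact: simple_iterP.
have hq : simple_map q by exact: simple_iterP.
(* In conditional form: [A] and [p] are subadditive given [(C, q)]; adding [q] to the condition [C]
   lowers the entropy of [A]; adding [C] to the condition [q] lowers that of [p]. Together, H(A, p |
   C, q) is at most H(A | C) + H(p | q), the increment needed. *)
have ssa1 := entropy_submodular mu hA hp (simple_pair hC hq).
have ssa2 := entropy_submodular mu hA hq hC.
have ssa3 := entropy_submodular mu hp hC hq.
have [g1 [k1 [e1 e1']]] := names_succ xi n.
have [g2 [k2 [e2 e2']]] := names_succ ze n.
have f1 : entropy mu (fun x => (names F xi n.+1 x, names F ze n.+1 x)) <=
    entropy mu (fun x => (A x, (p x, (C x, q x)))).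
  apply: (@entropy_le_of _ _ _ _ _ _ _ _ (fun t => (g1 (t.1, t.2.1), g2 t.2.2))).
    by do !apply: simple_pair.
  by move=> x; rewrite e1 e2.
have f2 : entropy mu (fun x => (C x, q x)) <= entropy mu (names F ze n.+1).
  by apply: (@entropy_le_of _ _ _ _ _ _ _ _ k2) => //; exact: simple_namesP.
have f3 : entropy mu (fun x => (A x, (C x, q x))) <= entropy mu (fun x => (A x, (q x, C x))).
  apply: (@entropy_le_of _ _ _ _ _ _ _ _ (fun t => (t.1, (t.2.2, t.2.1)))) => //.
  by do !apply: simple_pair.
have f4 : entropy mu (fun x => (q x, C x)) <= entropy mu (fun x => (C x, q x)).
  apply: (@entropy_le_of _ _ _ _ _ _ _ _ (fun t => (t.2, t.1))) => //.
  exact: simple_pair.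
have f5 : entropy mu (fun x => (p x, q x)) = entropy mu (fun x => (xi x, ze x)).
  exact: (entropy_preserves mF muF n (simple_pair hx hz)).
have f6 : entropy mu q = entropy mu ze.
  exact: (entropy_preserves mF muF n hz).
rewrite -[n.+1]addn1 natrD mulrDl mul1r addn1.
lra.
Qed.

Lemma entropy_rate_cond (I J : finType) (xi : T -> I) (ze : T -> J) :
  simple_map xi -> simple_map ze ->
  entropy_rate mu F xi <= entropy_rate mu F ze +
    (entropy mu (fun x => (xi x, ze x)) - entropy mu ze).
Proof.
move=> hx hz; set D := (X in _ <= _ + X).
apply: (@ler_cvg_to _ \oo _ R
  (fun n => entropy mu (names F xi n) / n%:R)
  (fun n => entropy mu (names F ze n) / n%:R + D)).
- exact: entropy_rate_cvg.
- by apply: cvgD; [exact: entropy_rate_cvg|exact: cvg_cst].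
- near=> n; have n0 : 0 < n%:R :> R by rewrite ltr0n; near: n; exact: nbhs_infty_gt.
  rewrite ler_pdivrMr// mulrDl divfK ?gt_eqF// [D * _]mulrC.
  exact: entropy_names_cond.
Unshelve. all: end_near.
Qed.

(* A set whose [N]-th preimage is determined by the symbols seen at times
   [0, ..., 2N - 1]. *)
Definition window_set (J : finType) (s : T -> J) (N : nat) (B : set T) :=
  exists b : pred {ffun 'I_N.*2 -> J},
    forall x, B (iter N F x) <-> b (names F s N.*2 x).

Lemma window_set_le (J : finType) (s : T -> J) N M B : (N <= M)%N ->
  window_set s N B -> window_set s M B.
Proof.
move=> NM [b hb].
have hi (i : 'I_N.*2) : (i + (M - N) < M.*2)%N by have := ltn_ord i; lia.
exists (fun w => b [ffun i => w (Ordinal (hi i))]) => x.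
rewrite -[in iter M](subnKC NM) iterD hb.
have -> : names F s N.*2 (iter (M - N) F x) =
    [ffun i => names F s M.*2 x (Ordinal (hi i))] => //.
by apply/ffunP => i; rewrite !ffunE/= iterD.
Qed.

(** The [ze]-name of length [n] read from time [N] on is a function of the [s]-name of length
    [n + K]. The extra cost, the entropy of [K] symbols, disappears after division by [n]. Starting
    at time [N] costs nothing by invariance and expresses a two-sided window through forward
    iterates. *)
Lemma entropy_rate_le_window (I J : finType) (ze : T -> I) (s : T -> J) N K g :
  simple_map ze -> simple_map s ->
  (forall x, ze (iter N F x) = g (names F s K x)) ->
  entropy_rate mu F ze <= entropy_rate mu F s.
Proof.
move=> hz hs hg.
have H n : entropy mu (names F ze n) <= entropy mu (names F s n) + entropy mu (names F s K).
  apply: le_trans (entropy_names_subadd mF muF hs n K).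
  rewrite -(entropy_preserves mF muF N (simple_namesP (n := n) hz)).
  have hij (i : 'I_n) (j : 'I_K) : (i + j < n + K)%N.
    by rewrite -addSn leq_add// ltnW.
  apply: (@entropy_le_of _ _ _ _ _ _ _ _
    (fun w : {ffun 'I_(n + K) -> J} =>
      [ffun i : 'I_n => g [ffun j : 'I_K => w (Ordinal (hij i j))]])).
    exact: simple_namesP.
  move=> x; apply/ffunP => i; rewrite !ffunE/= -iterD addnC iterD hg; congr g.
  by apply/ffunP => j; rewrite !ffunE/= addnC iterD.
apply: (@ler_cvg_to _ \oo _ R
  (fun n => entropy mu (names F ze n) / n%:R)
  (fun n => entropy mu (names F s n) / n%:R + entropy mu (names F s K) * n%:R^-1)).
- exact: entropy_rate_cvg.
- rewrite -[entropy_rate mu F s]addr0; apply: cvgD; first exact: entropy_rate_cvg.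
  rewrite -[X in _ --> X](mulr0 (entropy mu (names F s K))).
  apply: cvgM; first exact: cvg_cst.
  apply/gtr0_cvgV0; last exact: cvgr_idn.
  by near=> n; rewrite ltr0n; near: n; exact: nbhs_infty_gt.
- near=> n; have n0 : 0 < n%:R :> R by rewrite ltr0n; near: n; exact: nbhs_infty_gt.
  by rewrite -mulrDl ler_pM2r ?invr_gt0//; exact: H.
Unshelve. all: end_near.
Qed.

Lemma simple_neq (I : finType) (xi ze : T -> I) : simple_map xi -> simple_map ze ->
  measurable [set x | xi x != ze x].
Proof.
move=> hx hz; exact: (measurable_simple_pred (simple_pair hx hz) (fun p => p.1 != p.2)).
Qed.

Lemma dist_approx (I : finType) (xi ze : T -> I) i : simple_map xi -> simple_map ze ->
  `|dist mu xi i - dist mu ze i| <= pr mu [set x | xi x != ze x].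
Proof.
move=> hx hz; apply: le_trans (pr_approx mu (hx i) (hz i)) _.
apply: pr_le; [exact: measurable_symdiff|exact: simple_neq|].
move=> x /= [[/= <-]|[/= <-]]; first by rewrite eq_sym => /eqP.
by move/eqP.
Qed.

Lemma entropy_cvg (I : finType) (xi : T -> I) (ze : nat -> T -> I) :
  simple_map xi -> (forall n, simple_map (ze n)) ->
  pr mu [set x | xi x != ze n x] @[n --> \oo] --> 0 ->
  entropy mu (ze n) @[n --> \oo] --> entropy mu xi.
Proof.
move=> hx hz h; apply: cvg_sumr => i.
apply: (@cvg_comp _ _ _ (fun n => dist mu (ze n) i) (@negxlnx R)); last exact: continuous_negxlnx.
apply/cvgrPdist_le => e e0; move/cvgrPdist_le/(_ _ e0) : h; apply: filterS => n.
by rewrite sub0r normrN ger0_norm ?pr_ge0//; apply: le_trans; exact: dist_approx.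
Qed.

Lemma pr_big_le (I : finType) (A : I -> set T) : (forall i, measurable (A i)) ->
  measurable (\big[setU/set0]_i A i) /\
  pr mu (\big[setU/set0]_i A i) <= \sum_i pr mu (A i).
Proof.
move=> mA; apply: (big_ind2 (fun X y => measurable X /\ pr mu X <= y)) => //.
- by rewrite /pr measure0.
- move=> X x Y y [mX hX] [mY hY]; split; first exact: measurableU.
  by apply: le_trans (prU_le _ mX mY) _; exact: lerD.
Qed.

Section window_generator.
Variables (J : finType) (s : T -> J).
Hypothesis hs : simple_map s.
Hypothesis window_approx : forall A e, measurable A -> 0 < e ->
  exists N B, [/\ measurable B, window_set s N B & pr mu (symdiff A B) < e].

(** Each cell of [xi] is approximated by a window set [B i] within [e / (#|I| + 1)], and [ze x] is
    an index [i] with [x] in [B i], or a fixed value if there is none. Outside the union of the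
    symmetric differences exactly one [B i] contains [x], namely that of [xi x]. *)
Lemma window_map_approx (I : finType) (xi : T -> I) e : simple_map xi -> 0 < e ->
  exists ze : T -> I, [/\ simple_map ze, pr mu [set x | xi x != ze x] <= e &
    entropy_rate mu F ze <= entropy_rate mu F s].
Proof.
move=> hx e0.
have e1 : 0 < e / #|I|.+1%:R by rewrite divr_gt0.
have /choice[N /choice[B hB]] i : exists N B, [/\ measurable B, window_set s N B &
    pr mu (symdiff (xi @^-1` [set i]) B) < e / #|I|.+1%:R].
  exact: window_approx.
have mB i : measurable (B i) by case: (hB i).
pose M := \max_i N i.
have /choice[b hb] i : window_set s M (B i).
  by apply: (@window_set_le _ _ (N i)); [exact: leq_bigmax|case: (hB i)].
pose ze x := odflt (xi point) [pick i | `[< B i x >]].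
have hz : simple_map ze.
  pose bm x := [ffun i => `[< B i x >]].
  have hbm : simple_map bm.
    move=> w; rewrite (_ : _ @^-1` _ = \bigcap_(i in [set: I])
        (if w i then B i else ~` B i)).
      apply: fin_bigcap_measurable => // i _.
      by case: ifP => _ //; exact: measurableC.
    apply/seteqP; split=> [x <- i _|x h]; first by rewrite ffunE; case: asboolP.
    apply/ffunP => i; rewrite ffunE; have := h i Logic.I.
    by case: (w i) => [/asboolT|/asboolF].
  have -> : ze = (fun w : {ffun I -> bool} => odflt (xi point) [pick i | w i]) \o bm.
    apply/funext => x; rewrite /ze /=; congr odflt; apply: eq_pick => i.
    by rewrite ffunE.
  exact: simple_comp.
exists ze; split => //; last first.
  apply: (@entropy_rate_le_window _ _ _ _ M _
    (fun w => odflt (xi point) [pick i | b i w])) => // x.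
  rewrite /ze; congr odflt; apply: eq_pick => i.
  by apply/asboolP/idP => /hb.
have mS i := measurable_symdiff (hx i) (mB i).
have [mU hU] := pr_big_le mS.
apply: le_trans (le_trans hU _); last first.
  apply: (@le_trans _ _ (\sum_(i : I) e / #|I|.+1%:R)).
    by apply: ler_sum => i _; apply/ltW; case: (hB i).
  rewrite sumr_const -[_ *+ #|_|]mulr_natr -mulrA ler_piMr ?(ltW e0)//.
  by rewrite mulrC ler_pdivrMr// mul1r ler_nat.
apply: pr_le => //; first exact: simple_neq.
move=> x /= xz; apply: contrapT => nU; move/negP: xz; apply.
have hBx i : B i x <-> xi x = i.
  have nA : ~ symdiff (xi @^-1` [set i]) (B i) x.
    by move=> h; apply: nU; rewrite (bigD1 i)//=; left.
  by split=> h; apply: contrapT => h'; apply: nA; [right|left].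
apply/eqP; rewrite /ze; case: pickP => [i /asboolP/hBx -> //|/(_ (xi x))].
by move/negbT/asboolPn; case; exact/hBx.
Qed.

(** Kolmogorov-Sinai: maps [ze n] determined by windows tend to [xi] in measure, so the conditional
    entropy of [xi] given [ze n] tends to 0, while their rates stay below that of [s]. *)
Lemma entropy_rate_generator (I : finType) (xi : T -> I) : simple_map xi ->
  entropy_rate mu F xi <= entropy_rate mu F s.
Proof.
move=> hx.
have /choice[ze hze] n := window_map_approx hx (harmonic_gt0 n).
have hz n : simple_map (ze n) by case: (hze n).
have h0 : pr mu [set x | xi x != ze n x] @[n --> \oo] --> 0.
  apply: (@squeeze_cvgr _ _ _ _ (fun=> 0) harmonic); [|exact: cvg_cst|exact: cvg_harmonic].
  by near=> n; rewrite pr_ge0/=; case: (hze n).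
have c1 : entropy mu (fun x => (xi x, ze n x)) @[n --> \oo] -->
    entropy mu (fun x => (xi x, xi x)).
  apply: entropy_cvg; [exact: simple_pair|by move=> n; exact: simple_pair|].
  rewrite (_ : (fun n => _) = fun n => pr mu [set x | xi x != ze n x])//.
  by apply/funext => n; congr pr; apply/seteqP; split=> x /=; rewrite xpair_eqE eqxx.
have c2 := entropy_cvg hx hz h0.
have c3 : entropy mu (fun x => (xi x, xi x)) = entropy mu xi.
  by apply: (@entropy_comp_inj _ _ _ mu _ _ xi (fun i => (i, i))) => // i j [].
rewrite c3 in c1.
apply: (@ler_cvg_to _ \oo _ R (fun=> entropy_rate mu F xi)
  (fun n => entropy_rate mu F s +
    (entropy mu (fun x => (xi x, ze n x)) - entropy mu (ze n)))).
- exact: cvg_cst.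
- rewrite -[X in _ --> X]addr0 -[X in _ + X](subrr (entropy mu xi)).
  by apply: cvgD; [exact: cvg_cst|exact: cvgB].
- near=> n; apply: le_trans (entropy_rate_cond hx (hz n)) _.
  by rewrite lerD2r; case: (hze n).
Unshelve. all: end_near.
Qed.

End window_generator.
End generators.

(** * Entropy of convex combinations *)

Section mixtures.
Context {d : measure_display} {T : measurableType d} {R : realType}.
Variables (mu mu1 mu2 : probability T R) (a : R).
Hypothesis a01 : 0 <= a <= 1.
Hypothesis muE : forall A, measurable A ->
  pr mu A = a * pr mu1 A + (1 - a) * pr mu2 A.

Lemma entropy_mix_ge (I : finType) (xi : T -> I) : simple_map xi ->
  a * entropy mu1 xi + (1 - a) * entropy mu2 xi <= entropy mu xi.
Proof.
move=> hx; rewrite !mulr_sumr -big_split/=; apply: ler_sum => i _.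
rewrite [in leRHS]/dist muE//; apply: negxlnx_concave => //; exact: pr_ge0.
Qed.

(** The constant 2 dominates the entropy of the choice of component, [negxlnx a + negxlnx (1 - a)];
    it does not depend on [xi]. *)
Lemma entropy_mix_le (I : finType) (xi : T -> I) : simple_map xi ->
  entropy mu xi <= a * entropy mu1 xi + (1 - a) * entropy mu2 xi + 2.
Proof.
move=> hx; have /andP[a0 a1] := a01; have b0 : 0 <= 1 - a by rewrite subr_ge0.
apply: (@le_trans _ _ (\sum_i (a * negxlnx (dist mu1 xi i) + (1 - a) * negxlnx (dist mu2 xi i)
  + (dist mu1 xi i * negxlnx a + dist mu2 xi i * negxlnx (1 - a))))).
  apply: ler_sum => i _; rewrite [in leLHS]/dist muE//.
  have p1 : 0 <= pr mu1 (xi @^-1` [set i]) by exact: pr_ge0.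
  have p2 : 0 <= pr mu2 (xi @^-1` [set i]) by exact: pr_ge0.
  apply: le_trans (negxlnx_addl _ _) _; [exact: mulr_ge0..|].
  rewrite !negxlnxM//; rewrite /dist; lra.
rewrite !big_split/= -!mulr_sumr -!mulr_suml !sum_dist// !mul1r lerD2l.
by have := negxlnx_le a0; have := negxlnx_le b0; lra.
Qed.

(** Static entropy is concave and fails to be affine by at most 2, a defect that disappears after
    division by [n]. *)
Lemma entropy_rate_mix (F : T -> T) (I : finType) (xi : T -> I) :
  measurable_fun setT F -> preserves mu F -> preserves mu1 F -> preserves mu2 F ->
  simple_map xi ->
  entropy_rate mu F xi = a * entropy_rate mu1 F xi + (1 - a) * entropy_rate mu2 F xi.
Proof.
move=> mF p p1 p2 hx.
have hn n : simple_map (names F xi n) by exact: simple_namesP.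
pose u n := a * (entropy mu1 (names F xi n) / n%:R) +
  (1 - a) * (entropy mu2 (names F xi n) / n%:R).
have cu : u n @[n --> \oo] --> a * entropy_rate mu1 F xi + (1 - a) * entropy_rate mu2 F xi.
  by apply: cvgD; apply: cvgM; try exact: cvg_cst; exact: entropy_rate_cvg.
apply: (cvg_unique _ (entropy_rate_cvg mF p hx)) => //.
apply: (@squeeze_cvgr _ _ _ _ u (fun n => u n + 2 * n%:R^-1)) => //.
  near=> n; have n0 : 0 < n%:R :> R by rewrite ltr0n; near: n; exact: nbhs_infty_gt.
  rewrite /u !mulrA -!mulrDl ler_pM2r ?invr_gt0// ler_pM2r ?invr_gt0//.
  by apply/andP; split; [exact: (entropy_mix_ge (hn n))|exact: (entropy_mix_le (hn n))].
rewrite -[X in _ --> X]addr0; apply: cvgD => //.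
rewrite -[X in _ --> X](mulr0 (2 : R)); apply: cvgM; first exact: cvg_cst.
apply/gtr0_cvgV0; last exact: cvgr_idn.
by near=> n; rewrite ltr0n; near: n; exact: nbhs_infty_gt.
Unshelve. all: end_near.
Qed.

End mixtures.

Lemma image_probability d d' (T : measurableType d) (T' : measurableType d')
    (R : realType) (P : probability T R) (f : T -> T') :
  measurable_fun setT f ->
  exists Q : probability T' R, forall A, Q A = P (f @^-1` A).
Proof.
move=> mf; pose X : {mfun T >-> T'} := HB.pack f (isMeasurableFun.Build _ _ _ _ f mf).
by exists (distribution P X).
Qed.

Lemma prU d (T : measurableType d) (R : realType) (P : probability T R) A B :
  measurable A -> measurable B -> A `&` B = set0 ->
  pr P (A `|` B) = pr P A + pr P B.
Proof.
move=> mA mB AB; apply: EFin_inj.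
rewrite EFinD -!prE//; last exact: measurableU.
exact: measureU.
Qed.

Lemma prD d (T : measurableType d) (R : realType) (P : probability T R) A B :
  measurable A -> measurable B -> pr P (A `\` B) = pr P A - pr P (A `&` B).
Proof.
move=> mA mB; have mI := measurableI _ _ mA mB; have mD := measurableD mA mB.
apply/eqP; rewrite -subr_eq opprK eq_sym -prU//; first by rewrite setUC setUIDK.
by apply/seteqP; split=> x // [[_ nB] [_ /nB]].
Qed.

(** * Bi-infinite binary sequences *)

Definition block (k : int) (n : nat) (w : int -> bool) : {ffun 'I_n -> bool} :=
  [ffun i : 'I_n => w (k + (i : nat)%:Z)].

(** Windows are symmetric about 0, so that any two cylinders can be read through a common window,
    which makes the family an algebra. *)
Definition cylinders : set (set (int -> bool)) :=
  [set A | exists N (b : pred {ffun 'I_N.*2 -> bool}),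
    A = [set w | b (block (- N%:Z) N.*2 w)]].

Lemma block_sub (k : int) n M : (`|k| + n <= M)%N ->
  exists g, forall w, block k n w = g (block (- M%:Z) M.*2 w).
Proof.
move=> kM.
have hi (i : 'I_n) : (`|(k + M%:Z)%R| + i < M.*2)%N by have := ltn_ord i; lia.
exists (fun v : {ffun 'I_M.*2 -> bool} => [ffun i : 'I_n => v (Ordinal (hi i))]) => w.
apply/ffunP => i; rewrite !ffunE/=; congr w.
by have := ltn_ord i; lia.
Qed.

Lemma cylinders_block k n (b : pred {ffun 'I_n -> bool}) :
  cylinders [set w | b (block k n w)].
Proof.
have [g hg] := block_sub (leqnn (`|k| + n)).
exists (`|k| + n)%N, (fun v => b (g v)); apply/seteqP; split=> w /=; by rewrite hg.
Qed.

Lemma cylinders0 : cylinders set0.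
Proof. by exists 0%N, xpred0; apply/seteqP; split. Qed.

Lemma cylindersC A : cylinders A -> cylinders (~` A).
Proof.
move=> [N [b ->]]; exists N, (fun v => ~~ b v).
by apply/seteqP; split=> w /= /negP.
Qed.

Lemma cylinders_common A B : cylinders A -> cylinders B -> exists N (a b : pred _),
  A = [set w | a (block (- N%:Z) N.*2 w)] /\ B = [set w | b (block (- N%:Z) N.*2 w)].
Proof.
move=> [N [a ->]] [M [b ->]].
(* [block_sub] asks for a radius of at least the offset plus the length, here [N + 2 N] and
   [M + 2 M]. *)
have [g hg] := @block_sub (- N%:Z) N.*2 (3 * (N + M)) ltac:(lia).
have [h hh] := @block_sub (- M%:Z) M.*2 (3 * (N + M)) ltac:(lia).
exists (3 * (N + M))%N, (fun v => a (g v)), (fun v => b (h v)).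
by split; apply/seteqP; split=> w /=; rewrite ?hg ?hh.
Qed.

Lemma cylindersU A B : cylinders A -> cylinders B -> cylinders (A `|` B).
Proof.
move=> hA hB; have [N [a [b [-> ->]]]] := cylinders_common hA hB.
exists N, (fun v => a v || b v).
by apply/seteqP; split=> w /= /orP.
Qed.

Lemma cylindersI : setI_closed cylinders.
Proof.
move=> A B hA hB; have [N [a [b [-> ->]]]] := cylinders_common hA hB.
exists N, (fun v => a v && b v).
by apply/seteqP; split=> w /= /andP.
Qed.

Definition Omega := g_sigma_algebraType cylinders.

Definition shiftz (k : int) (w : Omega) : Omega := fun i => w (i + k).

Lemma block_shiftz k n j w : block k n (shiftz j w) = block (k + j) n w.
Proof. by apply/ffunP => i; rewrite !ffunE /shiftz addrAC. Qed.

Lemma measurable_block k n (b : pred {ffun 'I_n -> bool}) :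
  measurable ([set w | b (block k n w)] : set Omega).
Proof. by apply: sub_sigma_algebra; exact: cylinders_block. Qed.

Lemma simple_block k n : simple_map (block k n : Omega -> _).
Proof.
move=> v; rewrite (_ : _ @^-1` _ = [set w | block k n w == v]).
  exact: (measurable_block k (pred1 v)).
by apply/seteqP; split=> w /= /eqP.
Qed.

Lemma measurable_of_block d (U : measurableType d) k n (g : {ffun 'I_n -> bool} -> U)
  (f : Omega -> U) : (forall w, f w = g (block k n w)) -> measurable_fun setT f.
Proof.
move=> hf _ A _; rewrite setTI.
rewrite (_ : _ @^-1` _ = [set w | `[< A (g (block k n w)) >]]).
  exact: (measurable_block k (fun v => `[< A (g v) >])).
apply/seteqP; split=> w /=; first by rewrite hf => ?; exact/asboolP.
by rewrite hf => /asboolP.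
Qed.

Lemma measurable_shiftz k : measurable_fun setT (shiftz k).
Proof.
apply: (@measurability _ _ Omega Omega setT _ cylinders) => //.
move=> _ [A [N [b ->]] <-]; rewrite setTI.
rewrite (_ : _ @^-1` _ = [set w | b (block (- N%:Z + k) N.*2 w)]).
  exact: measurable_block.
by apply/seteqP; split=> w /=; rewrite block_shiftz.
Qed.

Lemma shiftzD j k w : shiftz j (shiftz k w) = shiftz (j + k) w.
Proof. by apply/funext => i; rewrite /shiftz addrA. Qed.

Lemma shiftz0 w : shiftz 0 w = w.
Proof. by apply/funext => i; rewrite /shiftz addr0. Qed.

Lemma iter_shiftz n w : iter n (shiftz 1) w = shiftz n%:Z w.
Proof.
elim: n => [|n IH]; first by rewrite shiftz0.
by rewrite iterS IH shiftzD; congr shiftz; lia.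
Qed.

Definition symbol (w : Omega) : bool := w 0.

Lemma simple_symbol : simple_map symbol.
Proof.
move=> v; rewrite (_ : _ @^-1` _ = [set w : Omega | block 0 1 w ord0 == v]).
  exact: (measurable_block 0 (fun u => u ord0 == v)).
by apply/seteqP; split=> w /=; rewrite ffunE => /eqP.
Qed.

Lemma names_symbol n w : names (shiftz 1) symbol n w = block 0 n w.
Proof.
by apply/ffunP => i; rewrite !ffunE iter_shiftz /symbol /shiftz.
Qed.

Section shift_invariant.
Context {R : realType}.
Implicit Types m : probability Omega R.

Lemma probability_ext m1 m2 :
  (forall N (v : {ffun 'I_N.*2 -> bool}),
    dist m1 (block (- N%:Z) N.*2) v = dist m2 (block (- N%:Z) N.*2) v) ->
  forall A, measurable A -> m1 A = m2 A.
Proof.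
move=> h A mA.
apply: (@measure_unique _ R Omega cylinders (fun=> setT)) => //.
- exact: cylindersI.
- by move=> _; exists 0%N, xpredT; apply/seteqP; split.
- by rewrite bigcup_const//; exists 0%N.
- move=> B [N [b ->]]; have mB := measurable_block (- N%:Z) b.
  suff e : pr m1 [set w | b (block (- N%:Z) N.*2 w)] = pr m2 [set w | b (block (- N%:Z) N.*2 w)].
    exact: (etrans (prE m1 mB) (etrans (congr1 EFin e) (esym (prE m2 mB)))).
  rewrite !(pr_simple_pred _ (@simple_block (- N%:Z) N.*2)).
  by apply: eq_bigr => v _; exact: h.
- by move=> _; apply: le_lt_trans (probability_le1 m1 measurableT) (ltry _).
Qed.

Lemma preserves_shiftz m k : preserves m (shiftz 1) -> preserves m (shiftz k).
Proof.
move=> h; have mpre j (A : set Omega) : measurable A -> measurable (shiftz j @^-1` A : set Omega).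
  by move=> mA; rewrite -[X in measurable X]setTI; exact: measurable_shiftz.
have hn (n : nat) : preserves m (shiftz n%:Z).
  have := preserves_iter (measurable_shiftz 1) h n.
  by rewrite (_ : iter n (shiftz 1) = shiftz n%:Z)//; apply/funext => w; exact: iter_shiftz.
have hN (n : nat) : preserves m (shiftz (- n%:Z)).
  move=> A mA; rewrite -[LHS](hn n); last exact: mpre.
  congr (m _); apply/seteqP; split=> w /=; rewrite shiftzD.
    by rewrite addNr shiftz0.
  by rewrite addNr shiftz0.
by case: (intP k) => [|n|n]; [exact: hn|exact: hn|exact: hN].
Qed.

Section generator.
Variable m : probability Omega R.
Hypothesis mS : preserves m (shiftz 1).

Lemma Omega_window_approx (A : set Omega) (e : R) : measurable A -> 0 < e ->
  exists N (B : set Omega),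
    [/\ measurable B, window_set (shiftz 1) symbol N B &
    pr m (symdiff A B) < e].
Proof.
move=> mA e0.
have [||||B GB hB] := @measurable_approx _ Omega _ m cylinders _ cylinders0 _ _ _ A e mA e0.
- by move=> B GB; exact: sub_sigma_algebra.
- exact: cylindersC.
- exact: cylindersU.
- by [].
have mB : measurable (B : set Omega) by exact: sub_sigma_algebra.
case: GB => N [b BE]; exists N, B; split => //; exists b => w.
by rewrite iter_shiftz names_symbol BE /= block_shiftz addNr.
Qed.

Definition symbol_rate : R := entropy_rate m (shiftz 1) symbol.

Lemma entropy_rate_le_symbol (I : finType) (xi : Omega -> I) : simple_map xi ->
  entropy_rate m (shiftz 1) xi <= symbol_rate.
Proof.
apply: entropy_rate_generator => //; first exact: measurable_shiftz.
- exact: simple_symbol.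
- exact: Omega_window_approx.
Qed.

End generator.

End shift_invariant.

Definition block_word n (v : {ffun 'I_n -> bool}) : seq bool :=
  [seq v i | i <- enum 'I_n].

Lemma size_block_word n (v : {ffun 'I_n -> bool}) : size (block_word v) = n.
Proof. by rewrite size_map size_enum_ord. Qed.

Lemma nth_block_word n (v : {ffun 'I_n -> bool}) (i : 'I_n) :
  nth false (block_word v) i = v i.
Proof. by rewrite (nth_map i) ?size_enum_ord// nth_ord_enum. Qed.

Lemma block_word_inj n : injective (@block_word n).
Proof. by move=> u v uv; apply/ffunP => i; rewrite -!nth_block_word uv. Qed.

(** * Shift-invariant measures from word weights *)

Section weights.
Context {R : realType}.

(** [weight_rcons] is Kolmogorov consistency, [weight_cons] is invariance under the shift. *)
Record weight (p : seq bool -> R) : Prop := Weight {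
  weight_ge0 : forall v, 0 <= p v;
  weight_nil : p [::] = 1;
  weight_rcons : forall v, p v = p (rcons v false) + p (rcons v true);
  weight_cons : forall v, p v = p (false :: v) + p (true :: v) }.

Variable p : seq bool -> R.
Hypothesis hp : weight p.

(** The state is a word with the left end of its interval. The interval is cut in proportion to the
    weights of the two extensions, the [false] one on the left, and the child containing [s] is
    kept; [e] says on which side the word grows. *)
Definition split_step (e : bool -> seq bool -> seq bool) (s : R)
    (u : seq bool * R) : seq bool * R :=
  if s < u.2 + p (e false u.1) then (e false u.1, u.2)
  else (e true u.1, u.2 + p (e false u.1)).

(** The words of length [k] cut [[0, 1)] into half-open intervals of length [p v], and the second
    component is the left end of the interval found. *)
Let tiled k (X : R -> seq bool * R) :=
  (forall s, size (X s).1 = k) /\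
  forall v, size v = k -> exists L, [/\ 0 <= L, L + p v <= 1 &
    forall s, 0 <= s < 1 -> ((X s).1 = v <-> L <= s < L + p v) /\
      ((X s).1 = v -> (X s).2 = L)].

Lemma split_step_tiled e k X :
  (forall v, p v = p (e false v) + p (e true v)) ->
  (forall c c' v v', e c v = e c' v' -> c = c' /\ v = v') ->
  (forall c v, size (e c v) = (size v).+1) ->
  (forall v, size v = k.+1 -> exists c v', v = e c v') ->
  tiled k X -> tiled k.+1 (fun s => split_step e s (X s)).
Proof.
move=> pe ei es eS [sX hX]; split.
  by move=> s; rewrite /split_step; case: ifP => _ /=; rewrite es sX.
move=> v sv; have [c [v' vE]] := eS _ sv; subst v.
have sv' : size v' = k by move: sv; rewrite es => -[].
have [L [L0 L1 hL]] := hX _ sv'.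
have := weight_ge0 hp (e false v'); have := weight_ge0 hp (e true v').
have := pe v' => pv p1 p0.
case: c sv => sv.
- exists (L + p (e false v')); split; [lra|lra|].
  move=> s s01; have [h1 h2] := hL s s01; rewrite /split_step; split; last first.
    by case: ifP => _ /= /ei[// _ vE]; rewrite (h2 vE) vE.
  split.
    case: ifPn => /= [_ /ei[]//|]; rewrite -leNgt => h /ei[_ vE].
    move: h; rewrite (h2 vE) vE => -> /=.
    by case/h1/andP: vE => _; rewrite pv addrA.
  move=> /andP[a b]; have vE : (X s).1 = v' by apply/h1/andP; split; lra.
  by rewrite (h2 vE) vE ltNge a.
- exists L; split; [lra|lra|].
  move=> s s01; have [h1 h2] := hL s s01; rewrite /split_step; split; last first.
    by case: ifP => _ /= /ei[// _ vE]; rewrite (h2 vE).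
  split.
    case: ifPn => /= [h /ei[_ vE]|_ /ei[]//]; move: h; rewrite (h2 vE) vE => ->.
    by rewrite andbT; case/h1/andP: vE.
  move=> /andP[a b]; have vE : (X s).1 = v' by apply/h1/andP; split; lra.
  by rewrite (h2 vE) vE b.
Qed.

(** Each stage appends one symbol on the right and then one on the left, so the word of stage [n] is
    the centre of that of stage [n + 1] and fills the window from [-n] to [n - 1]. *)
Fixpoint subdivision (s : R) (n : nat) : seq bool * R :=
  if n is n'.+1 then
    split_step cons s (split_step (fun c v => rcons v c) s (subdivision s n'))
  else ([::], 0).

Lemma subdivision_tiled n : tiled n.*2 (subdivision ^~ n).
Proof.
elim: n => [|n IH].
  split=> // v /size0nil ->; exists 0; rewrite add0r (weight_nil hp); split => //.
rewrite doubleS.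
apply: (split_step_tiled (X := fun s => split_step (fun c v => rcons v c) s (subdivision s n))).
- exact: weight_cons.
- by move=> c c' v v' [].
- by [].
- by move=> [|c v]// _; exists c, v.
- apply: split_step_tiled IH.
  + exact: weight_rcons.
  + by move=> c c' v v' /rcons_inj[].
  + by move=> c v; rewrite size_rcons.
  + by move=> v; case/lastP: v => // v c _; exists c, v.
Qed.

Lemma size_subdivision s n : size (subdivision s n).1 = n.*2.
Proof. by case: (subdivision_tiled n). Qed.

Lemma subdivision_succ s n : exists c c',
  (subdivision s n.+1).1 = c :: rcons (subdivision s n).1 c'.
Proof.
rewrite /= /split_step; do 2 case: ifP => _ /=; by do 2 eexists.
Qed.

Lemma nth_subdivision s n k i : (i < n.*2)%N ->
  nth false (subdivision s (k + n)).1 (k + i) = nth false (subdivision s n).1 i.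
Proof.
move=> hi; elim: k => [//|k IH]; rewrite addSn.
have [c [c' ->]] := subdivision_succ s (k + n).
rewrite addSn /= nth_rcons size_subdivision.
by rewrite (_ : (k + i < (k + n).*2)%N) //; lia.
Qed.

(** The points outside [[0, 1)], a null set for the uniform law, are sent to 0 to make the coding
    total. *)
Definition clamp (s : R) : R := if 0 <= s < 1 then s else 0.

(** Coordinate [i] is read at stage [|i| + 1], whose window contains it; later stages give the same
    value. *)
Definition sequence_of (s : R) : Omega := fun i =>
  nth false (subdivision (clamp s) `|i|.+1).1 `|i + `|i|.+1%:Z|.

Lemma sequence_ofE s N i : (i < N.*2)%N ->
  sequence_of s (- N%:Z + i%:Z) = nth false (subdivision (clamp s) N).1 i.
Proof.
move=> hi; rewrite /sequence_of; set j := (- _ + _); set M := `|j|.+1.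
have [h|h] := leqP M N.
  have := @nth_subdivision (clamp s) M (N - M) `|j + M%:Z|.
  have -> : (N - M + M = N)%N by lia.
  have -> : (N - M + `|(j + M%:Z)%R| = i)%N by lia.
  by move=> <- //; lia.
have := @nth_subdivision (clamp s) N (M - N) i hi.
have -> : (M - N + N = M)%N by lia.
by have -> : (M - N + i = `|(j + M%:Z)%R|)%N by lia.
Qed.

Lemma block_sequence_of s N (v : {ffun 'I_N.*2 -> bool}) :
  (block (- N%:Z) N.*2 (sequence_of s) = v) <->
  (subdivision (clamp s) N).1 = block_word v.
Proof.
split=> [<-|h].
  apply: (@eq_from_nth _ false); rewrite size_subdivision ?size_block_word// => i hi.
  by rewrite (nth_block_word _ (Ordinal hi)) ffunE/= sequence_ofE.
by apply/ffunP => i; rewrite ffunE sequence_ofE// h nth_block_word.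
Qed.

Let U := uniform_prob (@ltr01 R).

Lemma uniform_itv (L l : R) : 0 <= L -> 0 <= l -> L + l <= 1 ->
  pr U `[L, L + l[%classic = l.
Proof.
move=> L0 l0 L1; rewrite /pr /= /uniform_prob integral_uniform_pdf.
rewrite (eq_integral (fun=> 1%:E)); last first.
  move=> x; rewrite inE/= => -[_]; rewrite in_itv/= /uniform_pdf => ->.
  by rewrite subr0 invr1.
rewrite (_ : _ `&` _ = `[L, L + l[%classic); last first.
  apply/seteqP; split=> x /=; rewrite !in_itv/=; first by case.
  by move=> /andP[h1 h2]; split; apply/andP; split=> //; lra.
rewrite integral_cst//= mul1e lebesgue_measure_itv/= lte_fin.
case: ifPn => [_|]; first by rewrite -EFinD/= addrC addKr.
by rewrite -leNgt gerDl => h; apply/eqP; rewrite eq_le; apply/andP; split.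
Qed.

Lemma measurable_sequence_of_block N (v : {ffun 'I_N.*2 -> bool}) :
  measurable [set s | block (- N%:Z) N.*2 (sequence_of s) = v] /\
  pr U [set s | block (- N%:Z) N.*2 (sequence_of s) = v] = p (block_word v).
Proof.
have [L [L0 L1 hL]] := (subdivision_tiled N).2 _ (size_block_word v).
have p0 := weight_ge0 hp (block_word v).
set A := [set s | _]; pose I := `[L, L + p (block_word v)[%classic : set R.
pose Z := ~` `[(0 : R), 1[%classic.
have mI : measurable I by exact: measurable_itv.
have mZ : measurable Z by apply: measurableC; exact: measurable_itv.
have Z0 : pr U Z = 0.
  rewrite prC; last exact: measurable_itv.
  have := @uniform_itv 0 1 (lexx 0) ler01; rewrite add0r => ->; by rewrite ?subrr.
have IZ s : I s -> 0 <= s < 1.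
  by rewrite /I/= in_itv/= => /andP[a b]; apply/andP; split; lra.
have AZ s : 0 <= s < 1 -> (A s <-> I s).
  move=> s01; rewrite /A/= block_sequence_of /clamp s01.
  by rewrite (hL s s01).1 /I/= in_itv/=.
(* All of [Z] is clamped to 0, so it belongs to [A] entirely or not at all, according to the word of
   the point 0. *)
have [hA|hA] : A = I \/ A = I `|` Z.
  have [h0|h0] := pselect ((subdivision 0 N).1 = block_word v); [right|left].
    apply/seteqP; split=> s.
      move=> As; have [s01|s01] := boolP (0 <= s < 1); [by left; exact/AZ|right].
      by rewrite /Z/= in_itv/=; exact/negP.
    move=> [Is|]; first by apply/AZ => //; exact: IZ.
    rewrite /Z/= in_itv/= => /negP s01.
    by rewrite /A/= block_sequence_of /clamp (negPf s01).
  apply/seteqP; split=> s; last by move=> Is; apply/AZ => //; exact: IZ.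
  move=> As; have [s01|s01] := boolP (0 <= s < 1); first exact/AZ.
  by move: As; rewrite /A/= block_sequence_of /clamp (negPf s01).
- by rewrite hA; split => //; exact: uniform_itv.
- rewrite hA; split; first exact: measurableU.
  rewrite prU//; first by rewrite Z0 addr0; exact: uniform_itv.
  by apply/seteqP; split=> s // [/IZ h]; rewrite /Z/= in_itv/= h.
Qed.

Lemma measurable_sequence_of : measurable_fun setT sequence_of.
Proof.
apply: (@measurability _ _ R Omega setT _ cylinders) => //.
move=> _ [A [N [b ->]] <-]; rewrite setTI.
apply: (@measurable_simple_pred _ _ _ (block (- N%:Z) N.*2 \o sequence_of)) => v.
by case: (measurable_sequence_of_block v).
Qed.

Lemma mem_block_word (v : seq bool) n (hv : size v = n) :
  exists b : {ffun 'I_n -> bool}, block_word b = v.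
Proof.
subst n; exists [ffun i : 'I_(size v) => nth false v i].
apply: (@eq_from_nth _ false); rewrite size_block_word// => i hi.
by rewrite (nth_block_word _ (Ordinal hi)) ffunE.
Qed.

(** Summing over the last symbol uses [weight_rcons], over the first one [weight_cons]. Trimming at
    both ends reaches every window from a large symmetric one. *)
Lemma dist_block_sub (m : probability Omega R) k n :
  (forall v : {ffun 'I_n.+1 -> bool}, dist m (block k n.+1) v = p (block_word v)) ->
  (forall v : {ffun 'I_n -> bool}, dist m (block k n) v = p (block_word v)) /\
  (forall v : {ffun 'I_n -> bool}, dist m (block (k + 1) n) v = p (block_word v)).
Proof.
move=> h; have mB j l (b : {ffun 'I_l -> bool}) :
    measurable ((block j l : Omega -> _) @^-1` [set b]) by exact: simple_block.
split=> v.
- have ex c : exists u : {ffun 'I_n.+1 -> bool}, block_word u = rcons (block_word v) c.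
    by apply: mem_block_word; rewrite size_rcons size_block_word.
  have [u0 e0] := ex false; have [u1 e1] := ex true.
  rewrite (weight_rcons hp) -e0 -e1 -!h /dist -prU//.
    congr pr.
    have hu c (u : {ffun 'I_n.+1 -> bool}) w : block_word u = rcons (block_word v) c ->
        (block k n.+1 w = u <-> block k n w = v /\ w (k + n%:Z) = c).
      move=> e; have un (i : 'I_n.+1) : u i = nth false (rcons (block_word v) c) i.
        by rewrite -e nth_block_word.
      split=> [E|[E1 E2]].
        split; last by have := congr1 (fun f : {ffun _} => f ord_max) E; rewrite ffunE un nth_rcons size_block_word ltnn eqxx.
        apply/ffunP => i; rewrite ffunE.
        have := congr1 (fun f : {ffun _} => f (widen_ord (leqnSn n) i)) E.
        by rewrite ffunE un nth_rcons size_block_word/= ltn_ord nth_block_word.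
      apply/ffunP => i; rewrite ffunE un nth_rcons size_block_word.
      case: ltnP => hi.
        by rewrite (nth_block_word _ (Ordinal hi)) -E1 ffunE.
      have -> : (i : nat) = n by have := ltn_ord i; lia.
      by rewrite eqxx.
    apply/seteqP; split=> w /=.
      move=> E; case E' : (w (k + n%:Z)); first by right; apply/(hu _ _ _ e1).
      by left; apply/(hu _ _ _ e0).
    by case; [move/(hu _ _ _ e0)|move/(hu _ _ _ e1)] => -[].
  apply/seteqP; split=> w //= [-> E]; move: e0; rewrite E e1.
  by move=> /rcons_inj[].
- have ex c : exists u : {ffun 'I_n.+1 -> bool}, block_word u = c :: block_word v.
    by apply: mem_block_word; rewrite /= size_block_word.
  have [u0 e0] := ex false; have [u1 e1] := ex true.
  rewrite (weight_cons hp) -e0 -e1 -!h /dist -prU//.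
    congr pr.
    have hu c (u : {ffun 'I_n.+1 -> bool}) w : block_word u = c :: block_word v ->
        (block k n.+1 w = u <-> block (k + 1) n w = v /\ w k = c).
      move=> e; have un (i : 'I_n.+1) : u i = nth false (c :: block_word v) i.
        by rewrite -e nth_block_word.
      split=> [E|[E1 E2]].
        split; last by have := congr1 (fun f : {ffun _} => f ord0) E; rewrite ffunE un/= addr0.
        apply/ffunP => i; rewrite ffunE.
        have := congr1 (fun f : {ffun _} => f (lift ord0 i)) E.
        rewrite ffunE un/= nth_block_word => <-; congr w; rewrite /bump; lia.
      apply/ffunP => i; rewrite ffunE un.
      case: (unliftP ord0 i) => [j ->|->] /=; last by rewrite addr0.
      rewrite nth_block_word -E1 ffunE; congr w; rewrite /bump; lia.
    apply/seteqP; split=> w /=.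
      move=> E; case E' : (w k); first by right; apply/(hu _ _ _ e1).
      by left; apply/(hu _ _ _ e0).
    by case; [move/(hu _ _ _ e0)|move/(hu _ _ _ e1)] => -[].
  by apply/seteqP; split=> w //= [-> E]; move: e0; rewrite E e1.
Qed.

(** The image of the uniform law under [sequence_of] has the prescribed law on symmetric windows,
    hence on all windows by trimming. As that law does not depend on the position [k], the measure
    is invariant. *)
Lemma weight_measure : exists m : probability Omega R, preserves m (shiftz 1) /\
  forall k n (v : {ffun 'I_n -> bool}), dist m (block k n) v = p (block_word v).
Proof.
have [m hm] := image_probability U measurable_sequence_of.
have h0 N (v : {ffun 'I_N.*2 -> bool}) : dist m (block (- N%:Z) N.*2) v = p (block_word v).
  by rewrite -(measurable_sequence_of_block v).2 /dist /pr hm.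
have h1 N j : (j <= N.*2)%N -> forall v : {ffun 'I_(N.*2 - j) -> bool},
    dist m (block (- N%:Z + j%:Z) (N.*2 - j)) v = p (block_word v).
  elim: j => [|j IH] hj; first by rewrite subn0 addr0; exact: h0.
  have := IH (ltnW hj); have -> : (N.*2 - j = (N.*2 - j.+1).+1)%N by lia.
  move=> /dist_block_sub[_] h; move: h.
  by have -> : - N%:Z + j%:Z + 1 = - N%:Z + j.+1%:Z by lia.
have h2 n k l : (forall v : {ffun 'I_(n + l) -> bool},
      dist m (block k (n + l)) v = p (block_word v)) ->
    forall v : {ffun 'I_n -> bool}, dist m (block k n) v = p (block_word v).
  elim: l => [|l IH]; first by rewrite addn0.
  by rewrite addnS => /dist_block_sub[/IH].
have h3 k n (v : {ffun 'I_n -> bool}) : dist m (block k n) v = p (block_word v).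
  pose N := (`|k| + n)%N; pose j := `|(k + N%:Z)%R|%N.
  have jN : (j <= N.*2)%N by rewrite /j /N; lia.
  apply: (h2 n k (N.*2 - j - n)%N); have := h1 N j jN.
  have -> : (n + (N.*2 - j - n) = N.*2 - j)%N by rewrite /j /N; lia.
  by have -> : - N%:Z + j%:Z = k by rewrite /j /N; lia.
exists m; split => //.
have [m' hm'] := image_probability m (measurable_shiftz 1).
move=> A mA; rewrite -hm'; apply: probability_ext => // N v.
rewrite h3 -(h3 (- N%:Z + 1)) /dist /pr hm'; congr (fine (m _)).
by apply/seteqP; split=> w /=; rewrite block_shiftz.
Qed.

End weights.

(** * Coding by nested intervals *)

Section nested_intervals.
Context {R : realType}.
Variables (g : bool -> R -> R) (dec : bool -> bool) (A B : R).

Definition stail (s : nat -> bool) : nat -> bool := fun k => s k.+1.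

(** The image of [[A, B]] under [n] branches, [s 0] labelling the outermost, so that deeper levels
    give nested intervals. A decreasing branch, marked by [dec], exchanges the two ends. *)
Fixpoint ends (n : nat) (s : nat -> bool) : R * R :=
  if n is n'.+1 then
    let u := ends n' (stail s) in
    if dec (s 0%N) then (g (s 0%N) u.2, g (s 0%N) u.1)
    else (g (s 0%N) u.1, g (s 0%N) u.2)
  else (A, B).

Definition low s : R := limn (fun n => (ends n s).1).
Definition high s : R := limn (fun n => (ends n s).2).

Lemma ends_ext n s s' : (forall i, (i < n)%N -> s i = s' i) -> ends n s = ends n s'.
Proof.
elim: n s s' => [//|n IH] s s' h /=; rewrite (IH (stail s) (stail s')) ?h//.
by move=> i hi; exact: h.
Qed.

Hypothesis AB : A <= B.
Hypothesis g_itv : forall c x, A <= x <= B -> A <= g c x <= B.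
Hypothesis g_mono : forall c x y, A <= x -> x <= y -> y <= B ->
  if dec c then g c y <= g c x else g c x <= g c y.
Hypothesis g_cont : forall c x, A <= x <= B -> {for x, continuous (g c)}.

Lemma ends_itv n s : A <= (ends n s).1 /\ (ends n s).1 <= (ends n s).2 /\ (ends n s).2 <= B.
Proof.
elim: n s => [|n IH] s /=; first by rewrite lexx.
have [h1 [h2 h3]] := IH (stail s).
set l := (ends n _).1 in h1 h2 *; set h := (ends n _).2 in h2 h3 *.
have /andP[a1 a2] : A <= g (s 0%N) l <= B by apply: g_itv; rewrite h1 (le_trans h2).
have /andP[b1 b2] : A <= g (s 0%N) h <= B by apply: g_itv; rewrite h3 (le_trans h1).
by have := g_mono (s 0%N) h1 h2 h3; case: ifP.
Qed.

Lemma ends_mono n s :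
  (ends n s).1 <= (ends n.+1 s).1 /\ (ends n.+1 s).2 <= (ends n s).2.
Proof.
elim: n s => [|n IH] s.
  by have [h1 [h2 h3]] := ends_itv 1 s.
have [i1 i2] := IH (stail s).
have [h1 [h2 h3]] := ends_itv n (stail s).
have [k1 [k2 k3]] := ends_itv n.+1 (stail s).
rewrite [ends n.+2 s]/= [ends n.+1 s]/=.
rewrite -/(ends n.+1 (stail s)).
set l := (ends n (stail s)).1 in i1 h1 h2 *; set h := (ends n (stail s)).2 in i2 h2 h3 *.
set l' := (ends n.+1 (stail s)).1 in i1 k1 k2 *.
set h' := (ends n.+1 (stail s)).2 in i2 k2 k3 *.
have m1 := g_mono (s 0%N) h1 i1 (le_trans k2 k3).
have m2 := g_mono (s 0%N) (le_trans k1 k2) i2 h3.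
by case: ifP m1 m2.
Qed.

Lemma low_cvg s : (ends n s).1 @[n --> \oo] --> low s.
Proof.
apply: nondecreasing_is_cvgn.
  by apply/nondecreasing_seqP => n; case: (ends_mono n s).
by exists B => _ [n _ <-]; have [_ [h1 h2]] := ends_itv n s; exact: le_trans h2.
Qed.

Lemma high_cvg s : (ends n s).2 @[n --> \oo] --> high s.
Proof.
apply: nonincreasing_is_cvgn.
  by apply/nonincreasing_seqP => n; case: (ends_mono n s).
by exists A => _ [n _ <-]; have [h1 [h2 _]] := ends_itv n s; exact: le_trans h2.
Qed.

Lemma low_le_high s : low s <= high s.
Proof.
apply: ler_cvg_to (low_cvg (s := s)) (high_cvg (s := s)) _.
by near=> n; have [_ []] := ends_itv n s.
Unshelve. all: end_near.
Qed.

Lemma low_ge s : A <= low s.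
Proof.
apply: (ler_cvg_to (cvg_cst A) (low_cvg (s := s))).
by near=> n; have [] := ends_itv n s.
Unshelve. all: end_near.
Qed.

Lemma high_le_ends n s : high s <= (ends n s).2.
Proof.
apply: (ler_cvg_to (high_cvg (s := s)) (cvg_cst (ends n s).2)).
exists n => // m /= nm; rewrite -(subnK nm); elim: (m - n)%N => [//|k IH].
by rewrite addSn; apply: le_trans (ends_mono _ s).2 IH.
Qed.

Lemma high_le s : high s <= B. Proof. exact: high_le_ends 0%N s. Qed.

Lemma low_itv s : A <= low s <= B.
Proof. by rewrite low_ge (le_trans (low_le_high s))// high_le. Qed.

Lemma high_itv s : A <= high s <= B.
Proof. by rewrite high_le (le_trans (low_ge s))// low_le_high. Qed.

Let g_cvg (u : nat -> R) c l : A <= l <= B -> u n @[n --> \oo] --> l ->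
  g c (u n) @[n --> \oo] --> g c l.
Proof. by move=> hl ul; apply: continuous_cvg => //; exact: g_cont. Qed.

Lemma low_rec s : low s =
  g (s 0%N) (if dec (s 0%N) then high (stail s) else low (stail s)).
Proof.
apply: (cvg_unique _ (_ : (ends n.+1 s).1 @[n --> \oo] --> _)) => //.
  by have := @low_cvg s; rewrite -(cvg_shiftS (fun n => (ends n s).1)).
rewrite /=; case: ifP => _ /=; apply: g_cvg; [exact: high_itv|exact: high_cvg|exact: low_itv|exact: low_cvg].
Qed.

Lemma high_rec s : high s =
  g (s 0%N) (if dec (s 0%N) then low (stail s) else high (stail s)).
Proof.
apply: (cvg_unique _ (_ : (ends n.+1 s).2 @[n --> \oo] --> _)) => //.
  by have := @high_cvg s; rewrite -(cvg_shiftS (fun n => (ends n s).2)).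
rewrite /=; case: ifP => _ /=; apply: g_cvg; [exact: low_itv|exact: low_cvg|exact: high_itv|exact: high_cvg].
Qed.

(** A nested intersection that is a point stays a point under the further branches applied outside
    it. *)
Lemma low_eq_high_iter n s : low (fun k => s (n + k)%N) = high (fun k => s (n + k)%N) ->
  low s = high s.
Proof.
elim: n s => [//|n IH] s h; rewrite (low_rec s) (high_rec s).
have -> : low (stail s) = high (stail s) by apply: IH.
by case: ifP.
Qed.

(** The index of [y] runs against the branches: it counts backward in time for [x] and [y], and
    forward for [z], which is coded by inverse branches. *)
Lemma orbit_ends (s : nat -> bool) (y : nat -> R) :
  (forall n, A <= y n <= B) -> (forall n, y n = g (s n) (y n.+1)) ->
  low s <= y 0%N <= high s.
Proof.
move=> hy yE.
suff h n : (ends n s).1 <= y 0%N <= (ends n s).2.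
  apply/andP; split.
    by apply: (ler_cvg_to (low_cvg (s := s)) (cvg_cst (y 0%N))); near=> n; case/andP: (h n).
  by apply: (ler_cvg_to (cvg_cst (y 0%N)) (high_cvg (s := s))); near=> n; case/andP: (h n).
elim: n s y hy yE => [|n IH] s y hy yE /=; first exact: hy.
have /andP[h1 h2] := IH (stail s) (fun k => y k.+1) (fun k => hy k.+1) (fun k => yE k.+1).
have [k1 [_ k3]] := ends_itv n (stail s).
have /andP[y1 y2] := hy 1%N.
rewrite yE; have := g_mono (s 0%N) k1 h1 y2; have := g_mono (s 0%N) y1 h2 k3.
by case: ifP => _ /= -> ->.
Unshelve. all: end_near.
Qed.

Lemma contraction_low_high s :
  (forall c x y, A <= x <= B -> A <= y <= B -> `|g c x - g c y| <= 2^-1 * `|x - y|) ->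
  low s = high s.
Proof.
move=> hg.
have h n t : `|(ends n t).2 - (ends n t).1| <= (B - A) * 2^-1 ^+ n.
  elim: n t => [|n IH] t /=; first by rewrite expr0 mulr1 ger0_norm// subr_ge0.
  have [k1 [k2 k3]] := ends_itv n (stail t).
  rewrite exprS mulrCA; case: ifP => _ /=; [rewrite distrC|];
    apply: le_trans (hg _ _ _ _ _) _; rewrite ?k1 ?k3 ?(le_trans k1 k2) ?(le_trans k2 k3)//;
    by rewrite ler_pM2l ?invr_gt0//; exact: IH.
apply/eqP; rewrite -subr_eq0 -normr_eq0 eq_le normr_ge0 andbT.
have c0 : (B - A) * 2^-1 ^+ n @[n --> \oo] --> (0 : R).
  rewrite -[X in _ --> X](mulr0 (B - A)); apply: cvgM; first exact: cvg_cst.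
  by apply: cvg_expr; rewrite ger0_norm// invf_lt1// ltr1n.
have c1 : `|(ends n s).1 - (ends n s).2| @[n --> \oo] --> `|low s - high s|.
  by apply: cvg_norm; apply: cvgB; [exact: low_cvg|exact: high_cvg].
by apply: (ler_cvg_to c1 c0); near=> n; rewrite distrC; exact: h.
Unshelve. all: end_near.
Qed.

End nested_intervals.

(** * The time-one map, its inverse and its derivative *)

Section timeone_map.
Context {R : realType}.
Implicit Types x y : R.

Let c : R := expR (-1).

Let c_gt0 : 0 < c. Proof. exact: expR_gt0. Qed.

Let c_lt1 : c < 1. Proof. by rewrite expR_lt1; lra. Qed.

Let den y := y + (1 - y) * c.
Let den_gt0 y : 0 <= y <= 1 -> 0 < den y.
Proof. exact: timeone_den_gt0. Qed.

Lemma timeoneE y : timeone y = y / den y. Proof. by []. Qed.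

Lemma timeone_onem y : 0 <= y <= 1 -> 1 - timeone y = (1 - y) * c / den y.
Proof.
move=> hy; have d0 := den_gt0 hy; rewrite timeoneE.
have {1}-> : 1 = den y / den y by rewrite divff// gt_eqF.
by rewrite -mulrBl; congr (_ / _); rewrite /den addrC addKr.
Qed.

Lemma timeone_itv y : 0 <= y <= 1 -> 0 <= timeone y <= 1.
Proof.
move=> hy; have d0 := den_gt0 hy; have /andP[y0 y1] := hy.
apply/andP; split; first by rewrite timeoneE divr_ge0// ltW.
rewrite -subr_ge0 timeone_onem// divr_ge0 ?(ltW d0)//.
by rewrite mulr_ge0 ?(ltW c_gt0)// subr_ge0.
Qed.

Lemma timeone_gt0 y : 0 <= y <= 1 -> 0 < y -> 0 < timeone y.
Proof. by move=> hy y0; rewrite timeoneE divr_gt0// den_gt0. Qed.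

Lemma timeone_lt1 y : 0 <= y <= 1 -> y < 1 -> timeone y < 1.
Proof.
move=> hy y1; rewrite -subr_gt0 timeone_onem// divr_gt0 ?den_gt0//.
by rewrite mulr_gt0// subr_gt0.
Qed.

Lemma timeone0 : timeone 0 = 0 :> R.
Proof. by rewrite timeoneE mul0r. Qed.

Lemma timeone1 : timeone 1 = 1 :> R.
Proof. by rewrite timeoneE /den subrr mul0r addr0 divr1. Qed.

Lemma timeone_le x y : 0 <= x -> x <= y -> y <= 1 -> timeone x <= timeone y.
Proof.
move=> x0 xy y1.
have dx : 0 < den x by apply: den_gt0; rewrite x0 (le_trans xy).
have dy : 0 < den y by apply: den_gt0; rewrite (le_trans x0 xy).
rewrite !timeoneE ler_pdivrMr// mulrAC ler_pdivlMr// /den.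
rewrite -subr_ge0 (_ : _ - _ = c * (y - x)); last by ring.
by rewrite mulr_ge0 ?(ltW c_gt0)// subr_ge0.
Qed.

Lemma continuous_timeone y : 0 <= y <= 1 -> {for y, continuous (@timeone R)}.
Proof.
move=> hy; apply: cvgM; first exact: cvg_id.
apply: cvgV; first by rewrite gt_eqF// den_gt0.
apply: cvgD; first exact: cvg_id.
apply: cvgM; last exact: cvg_cst.
by apply: cvgB; [exact: cvg_cst|exact: cvg_id].
Qed.

(** The time minus one map of the flow, with numerator and denominator multiplied by [expR (-1)]. *)
Definition timeone_inv y : R := y * c / (y * c + (1 - y)).

Let iden_gt0 y : 0 <= y <= 1 -> 0 < y * c + (1 - y).
Proof.
move=> /andP[y0 y1]; rewrite (_ : y * c + (1 - y) = 1 - y * (1 - c)); last by ring.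
rewrite subr_gt0; apply: (@le_lt_trans _ _ (1 * (1 - c))).
  by rewrite ler_wpM2r// subr_ge0 ltW.
by rewrite mul1r gtrBl.
Qed.

Lemma timeone_inv_itv y : 0 <= y <= 1 -> 0 <= timeone_inv y <= 1.
Proof.
move=> hy; have d0 := iden_gt0 hy; have /andP[y0 y1] := hy.
have yc : 0 <= y * c by rewrite mulr_ge0// ltW.
rewrite /timeone_inv divr_ge0 ?(ltW d0)//= ler_pdivrMr// mul1r lerDl subr_ge0//.
Qed.

Lemma timeoneK y : 0 <= y <= 1 -> timeone_inv (timeone y) = y.
Proof.
move=> hy; have d0 := den_gt0 hy; have := timeone_itv hy => /iden_gt0.
rewrite /timeone_inv timeone_onem// timeoneE mulrAC -mulrDl => h.
have e : y * c + (1 - y) * c = c by ring.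
rewrite e invf_div mulrA divfK ?gt_eqF// mulfK// gt_eqF//.
Qed.

Lemma timeone_invK y : 0 <= y <= 1 -> timeone (timeone_inv y) = y.
Proof.
move=> hy; have d0 := iden_gt0 hy; have := den_gt0 (timeone_inv_itv hy).
have e : 1 - timeone_inv y = (1 - y) / (y * c + (1 - y)).
  rewrite /timeone_inv; field; by rewrite gt_eqF.
have Dn : y * c + (1 - y) != 0 by rewrite gt_eqF.
have cn : c != 0 by rewrite gt_eqF.
have E : den (timeone_inv y) = c / (y * c + (1 - y)).
  by rewrite /den e /timeone_inv; field.
by rewrite timeoneE E /timeone_inv => _; field; apply/andP.
Qed.

Lemma derive1_timeone y : 0 <= y <= 1 -> derive1 (@timeone R) y = c / den y ^+ 2.
Proof.
move=> hy; have d0 := den_gt0 hy.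
have dn : den y != 0 by rewrite gt_eqF.
have d0' : derivable (fun z : R => (1 - z) * c) y 1 by apply: derivableM.
have d1 : derivable den y 1 by apply: derivableD.
have e1 : 'D_1 den y = 1 - c.
  have -> : den = (id : R -> R) + (fun z : R => (1 - z) * c) by [].
  rewrite (deriveD (@derivable_id R R y 1) d0') derive_id.
  have hb : derivable (fun z : R => 1 - z) y 1 by apply: derivableB.
  have -> : (fun z : R => (1 - z) * c) = (fun z : R => 1 - z) * (cst c : R -> R) by [].
  rewrite (deriveM hb (@derivable_cst R R R c y 1)) derive_cst scaler0 add0r.
  by rewrite -derive1E derive1_onem /cst [c *: _]mulrN1.
have d2 : derivable (fun z => (den z)^-1) y 1 by exact: (derivableV dn d1).
rewrite derive1E (@deriveM R R id (fun z => (den z)^-1) y 1 (@derivable_id _ _ _ _) d2).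
rewrite derive_id (deriveV dn d1) e1.
have -> : id y *: (- den y ^- 2 *: (1 - c)) + (den y)^-1 *: 1 =
  y * (- den y ^- 2 * (1 - c)) + (den y)^-1 :> R by rewrite [(den y)^-1 *: 1]mulr1.
have e3 : c = den y - y * (1 - c) by rewrite /den; ring.
by rewrite [in RHS]e3; field.
Qed.

End timeone_map.

(** The present symbol belongs to the future: it tells which branch is applied next, while [x] and
    [y] are the result of the branches already applied. *)
Definition past (w : Omega) (n : nat) : bool := w (- n.+1%:Z).
Definition future (w : Omega) (n : nat) : bool := w n%:Z.

Lemma past_shift0 w : past (shiftz 1 w) 0 = w 0.
Proof. by rewrite /past /shiftz addNr. Qed.

Lemma stail_past w : stail (past (shiftz 1 w)) = past w.
Proof. by apply/funext => n; rewrite /stail /past /shiftz; congr w; lia. Qed.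

Lemma stail_future w : stail (future w) = future (shiftz 1 w).
Proof. by apply/funext => n; rewrite /stail /future /shiftz; congr w; lia. Qed.

Lemma measurable_of_window d (U : measurableType d) k n (f : Omega -> U) :
  (forall w w', block k n w = block k n w' -> f w = f w') -> measurable_fun setT f.
Proof.
move=> hf; pose h (v : {ffun 'I_n -> bool}) : U :=
  if pselect (exists w, block k n w = v) is left e then f (projT1 (cid e)) else point.
apply: (measurable_of_block (k := k) (g := h)) => w; rewrite /h.
case: pselect => [e|[]]; last by exists w.
by case: cid => w' /= e'; exact: hf.
Qed.

Section coding_limits.
Context {R : realType}.
Variables (g : bool -> R -> R) (dec : bool -> bool) (A B : R).
Hypothesis AB : A <= B.
Hypothesis g_itv : forall c x, A <= x <= B -> A <= g c x <= B.
Hypothesis g_mono : forall c x y, A <= x -> x <= y -> y <= B ->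
  if dec c then g c y <= g c x else g c x <= g c y.

Lemma measurable_ends_past n :
  measurable_fun setT (fun w : Omega => (ends g dec A B n (past w)).1) /\
  measurable_fun setT (fun w : Omega => (ends g dec A B n (past w)).2).
Proof.
have h w w' : block (- n%:Z) n w = block (- n%:Z) n w' ->
    ends g dec A B n (past w) = ends g dec A B n (past w').
  move=> e; apply: ends_ext => i hi.
  have hj : (n - i.+1 < n)%N by lia.
  have := congr1 (fun f : {ffun _} => f (Ordinal hj)) e; rewrite !ffunE /past /=.
  by have -> : - n%:Z + (n - i.+1)%N%:Z = - i.+1%:Z by lia.
by split; apply: (measurable_of_window (k := - n%:Z) (n := n)) => w w' /h ->.
Qed.

Lemma measurable_ends_future n :
  measurable_fun setT (fun w : Omega => (ends g dec A B n (future w)).2).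
Proof.
apply: (measurable_of_window (k := 0) (n := n)) => w w' e.
congr (_.2); apply: ends_ext => i hi.
by have := congr1 (fun f : {ffun _} => f (Ordinal hi)) e; rewrite !ffunE /past /= !add0r.
Qed.

Lemma measurable_low_past : measurable_fun setT (fun w : Omega => low g dec A B (past w)).
Proof.
apply: (measurable_fun_cvg (h := fun n (w : Omega) => (ends g dec A B n (past w)).1)).
  by move=> n; case: (measurable_ends_past n).
by move=> w _; exact: low_cvg.
Qed.

Lemma measurable_high_past : measurable_fun setT (fun w : Omega => high g dec A B (past w)).
Proof.
apply: (measurable_fun_cvg (h := fun n (w : Omega) => (ends g dec A B n (past w)).2)).
  by move=> n; case: (measurable_ends_past n).
by move=> w _; exact: high_cvg.
Qed.

Lemma measurable_high_future : measurable_fun setT (fun w : Omega => high g dec A B (future w)).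
Proof.
apply: (measurable_fun_cvg (h := fun n (w : Omega) => (ends g dec A B n (future w)).2)).
  exact: measurable_ends_future.
by move=> w _; exact: high_cvg.
Qed.

End coding_limits.

Lemma mul_itv (R : realDomainType) (a x b : R) : 0 <= a -> 0 <= x <= b -> 0 <= a * x <= a * b.
Proof. by move=> a0 /andP[x0 xb]; rewrite mulr_ge0//= ler_wpM2l. Qed.

(** * Coordinates of a point from its itinerary *)

Section horseshoe_coding.
Context {R : realType}.
Variables (lambda0 beta0 lambda1 sigma beta1 : R).
Hypotheses (hlambda0 : 0 < lambda0 < 1 / 3) (hbeta0 : 6 < beta0)
  (hlambda1 : 0 < lambda1 < 1 / 3) (hsigma : 0 < sigma < 1 / 3)
  (hbeta1 : 3 < beta1 < 4).

Definition branch_x (c : bool) (x : R) : R :=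
  if c then 3 / 4 - lambda1 * x else lambda0 * x.
Definition branch_y (c : bool) (y : R) : R :=
  if c then sigma * (1 - y) else timeone y.
(** These are inverse branches: [z] is expanded by the map, so it is recovered from the future by
    contractions. *)
Definition branch_z (c : bool) (z : R) : R :=
  if c then z / beta1 + 5 / 6 else z / beta0.

Definition coord_x (w : Omega) : R := high branch_x id 0 1 (past w).
Definition ylow (w : Omega) : R := low branch_y id 0 1 (past w).
Definition yhigh (w : Omega) : R := high branch_y id 0 1 (past w).
(* [5/4] is the fixed point of [z / 3 + 5 / 6]. *)
Definition coord_z (w : Omega) : R := high branch_z xpred0 0 (5 / 4) (future w).

Lemma branch_x_itv c x : 0 <= x <= 1 -> 0 <= branch_x c x <= 1.
Proof.
move=> hx; have h0 : 0 <= lambda0 by move: hlambda0; lra.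
have h1 : 0 <= lambda1 by move: hlambda1; lra.
have := mul_itv h0 hx; have := mul_itv h1 hx.
rewrite /branch_x; case: c => ? ?; apply/andP; split; move: hlambda0 hlambda1; lra.
Qed.

Lemma branch_x_mono c x y : 0 <= x -> x <= y -> y <= 1 ->
  if id c then branch_x c y <= branch_x c x else branch_x c x <= branch_x c y.
Proof.
move=> x0 xy y1; have h0 : 0 <= lambda0 by move: hlambda0; lra.
have h1 : 0 <= lambda1 by move: hlambda1; lra.
by case: c => /=; rewrite ?lerD2l ?lerN2 ler_wpM2l.
Qed.

Lemma branch_x_cont c x : 0 <= x <= 1 -> {for x, continuous (branch_x c)}.
Proof.
move=> _; case: c.
  apply: cvgB; first exact: cvg_cst.
  by apply: cvgM; [exact: cvg_cst|exact: cvg_id].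
by apply: cvgM; [exact: cvg_cst|exact: cvg_id].
Qed.

Lemma branch_x_contr c x y : 0 <= x <= 1 -> 0 <= y <= 1 ->
  `|branch_x c x - branch_x c y| <= 2^-1 * `|x - y|.
Proof.
move=> _ _; rewrite /branch_x; case: c.
  rewrite (_ : _ - _ = lambda1 * (y - x)); last by ring.
  by rewrite normrM distrC ler_wpM2r// gtr0_norm; move: hlambda1; lra.
by rewrite -mulrBr normrM ler_wpM2r// gtr0_norm; move: hlambda0; lra.
Qed.

Lemma branch_y_itv c y : 0 <= y <= 1 -> 0 <= branch_y c y <= 1.
Proof.
move=> hy; case: c => /=; last exact: timeone_itv.
have hy' : 0 <= 1 - y <= 1 by lra.
have h : 0 <= sigma by move: hsigma; lra.
by have := mul_itv h hy'; move: hsigma; lra.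
Qed.

Lemma branch_y_mono c x y : 0 <= x -> x <= y -> y <= 1 ->
  if id c then branch_y c y <= branch_y c x else branch_y c x <= branch_y c y.
Proof.
case: c => /= x0 xy y1; last exact: timeone_le.
by rewrite ler_wpM2l//; move: hsigma; lra.
Qed.

Lemma branch_y_cont c y : 0 <= y <= 1 -> {for y, continuous (branch_y c)}.
Proof.
case: c; last exact: continuous_timeone.
move=> _; apply: cvgM; first exact: cvg_cst.
by apply: cvgB; [exact: cvg_cst|exact: cvg_id].
Qed.

Let ib1 : 0 < beta1^-1 < 1 / 3.
Proof.
have b0 : 0 < beta1 by move: hbeta1; lra.
by rewrite invr_gt0 b0/= -[1 / 3]invrK ltf_pV2 ?posrE ?invr_gt0//; move: hbeta1; lra.
Qed.

Let ib0 : 0 < beta0^-1 < 1 / 6.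
Proof.
have b0 : 0 < beta0 by move: hbeta0; lra.
by rewrite invr_gt0 b0/= -[1 / 6]invrK ltf_pV2 ?posrE ?invr_gt0//; move: hbeta0; lra.
Qed.

Lemma branch_z_itv c z : 0 <= z <= 5 / 4 -> 0 <= branch_z c z <= 5 / 4.
Proof.
move=> hz; have h0 : 0 <= beta0^-1 by move: ib0; lra.
have h1 : 0 <= beta1^-1 by move: ib1; lra.
have := mul_itv h0 hz; have := mul_itv h1 hz.
by rewrite /branch_z !(mulrC z); case: c => ? ?; apply/andP; split; move: ib0 ib1; lra.
Qed.

Lemma branch_z_mono c x y : 0 <= x -> x <= y -> y <= 5 / 4 ->
  if xpred0 c then branch_z c y <= branch_z c x else branch_z c x <= branch_z c y.
Proof.
move=> x0 xy y1; have h0 : 0 <= beta0^-1 by move: ib0; lra.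
have h1 : 0 <= beta1^-1 by move: ib1; lra.
by rewrite /branch_z; case: c => /=; rewrite ?lerD2r ler_wpM2r.
Qed.

Lemma branch_z_cont c z : 0 <= z <= 5 / 4 -> {for z, continuous (branch_z c)}.
Proof.
move=> _; case: c.
  apply: cvgD; last exact: cvg_cst.
  by apply: cvgM; [exact: cvg_id|exact: cvg_cst].
by apply: cvgM; [exact: cvg_id|exact: cvg_cst].
Qed.

Lemma branch_z_contr c x y : 0 <= x <= 5 / 4 -> 0 <= y <= 5 / 4 ->
  `|branch_z c x - branch_z c y| <= 2^-1 * `|x - y|.
Proof.
move=> _ _; rewrite /branch_z; case: c.
  rewrite (_ : _ - _ = (x - y) * beta1^-1); last by ring.
  by rewrite normrM mulrC ler_wpM2r// gtr0_norm; move: ib1; lra.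
by rewrite -mulrBl normrM mulrC ler_wpM2r// gtr0_norm; move: ib0; lra.
Qed.

Let le54 : (0 : R) <= 5 / 4. Proof. by rewrite divr_ge0. Qed.

Lemma coord_x_itv w : 0 <= coord_x w <= 1.
Proof. exact: (high_itv ler01 branch_x_itv branch_x_mono). Qed.

Lemma ylow_itv w : 0 <= ylow w <= 1.
Proof. exact: (low_itv ler01 branch_y_itv branch_y_mono). Qed.

Lemma yhigh_itv w : 0 <= yhigh w <= 1.
Proof. exact: (high_itv ler01 branch_y_itv branch_y_mono). Qed.

Lemma ylow_le_yhigh w : ylow w <= yhigh w.
Proof. exact: (low_le_high ler01 branch_y_itv branch_y_mono). Qed.

Lemma coord_z_itv w : 0 <= coord_z w <= 5 / 4.
Proof. exact: (@high_itv R branch_z xpred0 0 (5 / 4) le54 branch_z_itv branch_z_mono). Qed.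

Lemma coord_x_shift w : coord_x (shiftz 1 w) = branch_x (w 0) (coord_x w).
Proof.
rewrite /coord_x (high_rec ler01 branch_x_itv branch_x_mono branch_x_cont).
rewrite past_shift0 stail_past; congr branch_x; case: ifP => // _.
exact: (contraction_low_high ler01 branch_x_itv branch_x_mono (past w) branch_x_contr).
Qed.

Lemma coord_z_shift w : coord_z w = branch_z (w 0) (coord_z (shiftz 1 w)).
Proof.
rewrite {1}/coord_z (@high_rec R branch_z xpred0 0 (5 / 4) le54 branch_z_itv branch_z_mono branch_z_cont).
by rewrite stail_future.
Qed.

Lemma ylow_shift w : ylow (shiftz 1 w) = branch_y (w 0) (if w 0 then yhigh w else ylow w).
Proof.
rewrite {1}/ylow (low_rec ler01 branch_y_itv branch_y_mono branch_y_cont).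
by rewrite past_shift0 stail_past.
Qed.

Lemma yhigh_shift w : yhigh (shiftz 1 w) = branch_y (w 0) (if w 0 then ylow w else yhigh w).
Proof.
rewrite {1}/yhigh (high_rec ler01 branch_y_itv branch_y_mono branch_y_cont).
by rewrite past_shift0 stail_past.
Qed.

Lemma measurable_coord_x : measurable_fun setT coord_x.
Proof. exact: (measurable_high_past ler01 branch_x_itv branch_x_mono). Qed.

Lemma measurable_ylow : measurable_fun setT ylow.
Proof. exact: (measurable_low_past ler01 branch_y_itv branch_y_mono). Qed.

Lemma measurable_yhigh : measurable_fun setT yhigh.
Proof. exact: (measurable_high_past ler01 branch_y_itv branch_y_mono). Qed.

Lemma measurable_coord_z : measurable_fun setT coord_z.
Proof. exact: (@measurable_high_future R branch_z xpred0 0 (5 / 4) le54 branch_z_itv branch_z_mono). Qed.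

End horseshoe_coding.

(** * Almost sure properties of itineraries *)

Section almost_everywhere.
Context {d : measure_display} {T : measurableType d} {R : realType}.
Variable mu : probability T R.

Lemma ae_notin A : measurable A -> mu A = 0%E -> \forall x \ae mu, ~ A x.
Proof.
move=> mA A0; exists A; split => // x /=; exact: contrapT.
Qed.

Lemma ae_pr1 A : measurable A -> pr mu A = 1 -> \forall x \ae mu, A x.
Proof.
move=> mA A1; have mC := measurableC mA.
have : \forall x \ae mu, ~ (~` A) x.
  by apply: ae_notin => //; rewrite prE// prC// A1 subrr.
by apply: filterS => x; exact: contrapT.
Qed.

Lemma pr1_ae (A : set T) : measurable A -> (\forall x \ae mu, A x) -> pr mu A = 1.
Proof.
move=> mA [N [mN N0 sub]]; have mC := measurableC mA.
have : mu (~` A) = 0%E by apply: (subset_measure0 mC mN) => // x Ax; apply: sub.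
by rewrite prE// prC// => -[] /eqP; rewrite subr_eq0 => /eqP.
Qed.

Lemma pr0_ae (A : set T) : measurable A -> (\forall x \ae mu, ~ A x) -> pr mu A = 0.
Proof.
move=> mA h; have mC := measurableC mA.
by have := pr1_ae mC h; rewrite prC//; lra.
Qed.

Lemma pr_ae_eq (A B : set T) : measurable A -> measurable B ->
  (\forall x \ae mu, A x <-> B x) -> pr mu A = pr mu B.
Proof.
move=> mA mB h.
have h1 : pr mu (A `\` B) = 0.
  apply: pr0_ae; first exact: measurableD.
  by apply: filterS h => x hx [/hx].
have h2 : pr mu (B `\` A) = 0.
  apply: pr0_ae; first exact: measurableD.
  by apply: filterS h => x hx [/hx].
by move: h1 h2; rewrite !prD// setIC; lra.
Qed.

Variable F : T -> T.
Hypothesis mF : measurable_fun setT F.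
Hypothesis muF : preserves mu F.

Lemma ae_preserves (P : T -> Prop) :
  (\forall x \ae mu, P x) -> \forall x \ae mu, P (F x).
Proof.
move=> [N [mN N0 sub]]; exists (F @^-1` N); split.
- exact: measurable_preimage.
- by rewrite muF.
- by move=> x Px; apply: sub.
Qed.

(** The set [u <= c] is contained, up to a null set, in its preimage, and both have the same
    measure, so they agree almost surely; then [c] runs over the rationals. Comparing sublevel sets
    avoids integrating [u]. *)
Lemma ae_invariant_of_le (u : T -> R) : measurable_fun setT u ->
  (\forall x \ae mu, u (F x) <= u x) -> \forall x \ae mu, u (F x) = u x.
Proof.
move=> mu' hu.
have mle c : measurable [set x | u x <= c].
  rewrite -[X in measurable X]setTI; apply: measurable_fun_le => //.
have step c : \forall x \ae mu, u (F x) <= c -> u x <= c.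
  have mFl := measurable_preimage mF (mle c).
  have mD := measurableD mFl (mle c).
  have D0 : mu (F @^-1` [set x | u x <= c] `\` [set x | u x <= c]) = 0%E.
    have mI := measurableI _ _ (mle c) mFl.
    have mD' := measurableD (mle c) mFl.
    have e0 : pr mu ([set x | u x <= c] `\` F @^-1` [set x | u x <= c]) = 0.
      apply: pr0_ae => //; apply: filterS hu => x hx [/= h]; apply.
      exact: le_trans h.
    rewrite prE//; congr EFin; move: e0; rewrite !prD// setIC => e0.
    by rewrite -e0; congr (_ - _); rewrite /pr muF.
  by apply: filterS (ae_notin mD D0) => x hx h; apply: contrapT => h'; apply: hx.
(* The rationals are enumerated through [unpickle], since null sets can only be united along a
   sequence; 0 stands in at indices coding no rational. *)
have all : \forall x \ae mu, forall n, u (F x) <= ratr (odflt 0 (unpickle n : option rat)) ->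
    u x <= ratr (odflt 0 (unpickle n : option rat)).
  by apply: ae_foralln => n; exact: step.
apply: filterS2 hu all => x h1 h2; apply/eqP; rewrite eq_le h1/= leNgt.
apply/negP => /rat_in_itvoo[q]; rewrite in_itv/= => /andP[q1 q2].
by have := h2 (pickle q); rewrite pickleK/= => /(_ (ltW q1)); rewrite leNgt q2.
Qed.

End almost_everywhere.

Definition sparse (w : Omega) := forall i, ~~ (w i && w (i + 1)).

Definition recurrent (w : Omega) := forall n, exists2 i, (n <= i)%N & past w i.

Lemma past_shiftz w k n i : k = - n%:Z -> past (shiftz k w) i = past w (n + i)%N.
Proof. by move=> ->; rewrite /past /shiftz; congr w; lia. Qed.

Lemma recurrent_shiftz w k : recurrent w -> recurrent (shiftz k w).
Proof.
move=> h n; have [i ni wi] := h (n + `|k|)%N.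
exists `|(i%:Z + k)%R|%N; first by lia.
move: wi; rewrite /past /shiftz.
by have -> : - i.+1%:Z = - (`|(i%:Z + k)%R|.+1)%:Z + k by lia.
Qed.

Section golden_measures.
Context {R : realType}.

Definition golden (m : probability Omega R) : Prop :=
  [/\ preserves m (shiftz 1), m [set w : Omega | w 0 && w 1] = 0%E &
      m [set w : Omega | forall i, w i = false] = 0%E].

Lemma measurable_coord k : measurable [set w : Omega | w k].
Proof.
rewrite (_ : [set w | _] = [set w : Omega | block k 1 w ord0]).
  exact: (measurable_block k (fun u => u ord0)).
by apply/seteqP; split=> w /=; rewrite ffunE addr0.
Qed.

Lemma measurable_zero : measurable [set w : Omega | forall i, w i = false].
Proof.
rewrite (_ : [set w | _] = \bigcap_n [set w : Omega | block (- n%:Z) n.*2 w == [ffun=> false]]).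
  by apply: bigcapT_measurable => n; exact: (measurable_block (- n%:Z) (pred1 [ffun=> false])).
apply/seteqP; split=> w /=.
  by move=> h n _ /=; apply/eqP/ffunP => i; rewrite !ffunE.
move=> h i; have /= /eqP := h `|i|.+1 Logic.I.
have hj : (`|(i + `|i|.+1%:Z)%R| < `|i|.+1.*2)%N by lia.
move/ffunP/(_ (Ordinal hj)); rewrite !ffunE/=.
by have -> : - `|i|.+1%:Z + `|(i + `|i|.+1%:Z)%R|%N%:Z = i by lia.
Qed.

Section almost_sure.
Variable m : probability Omega R.
Hypothesis hm : golden m.

Let mS : preserves m (shiftz 1). Proof. by case: hm. Qed.

Lemma ae_shiftz (P : Omega -> Prop) k :
  (\forall w \ae m, P w) -> \forall w \ae m, P (shiftz k w).
Proof.
exact: (@ae_preserves _ _ _ m (shiftz k) (measurable_shiftz k) (preserves_shiftz k mS) P).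
Qed.

Lemma ae_all_shifts (P : Omega -> Prop) :
  (\forall w \ae m, P w) -> \forall w \ae m, forall k, P (shiftz k w).
Proof.
move=> h; have h1 : \forall w \ae m, forall n : nat, P (shiftz n%:Z w).
  by apply: ae_foralln => n; exact: ae_shiftz.
have h2 : \forall w \ae m, forall n : nat, P (shiftz (- n%:Z) w).
  by apply: ae_foralln => n; exact: ae_shiftz.
by apply: filterS2 h1 h2 => w k1 k2 [n|n]; [exact: k1|rewrite NegzE; exact: k2].
Qed.

Lemma ae_sparse : \forall w \ae m, sparse w.
Proof.
have mE : measurable [set w : Omega | w 0 && w 1].
  rewrite (_ : [set w | _] = [set w : Omega | w 0] `&` [set w : Omega | w 1]).
    by apply: measurableI; exact: measurable_coord.
  by apply/seteqP; split=> w /= /andP.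
have [_ h _] := hm; have := ae_all_shifts (ae_notin mE h).
by apply: filterS => w hw i; apply/negP; have := hw i; rewrite /shiftz/= add0r addrC.
Qed.

(** The sets [E k], a 1 strictly before time [k], increase with [k], have equal measure by
    invariance, and unite to the complement of the zero sequence. Hence all have measure 1, in
    particular for [k = -n]. *)
Lemma ae_recurrent : \forall w \ae m, recurrent w.
Proof.
pose E (k : int) := [set w : Omega | exists n, w (k - n.+1%:Z)].
have mE k : measurable (E k).
  rewrite (_ : E k = \bigcup_n [set w : Omega | w (k - n.+1%:Z)]).
    by apply: bigcupT_measurable => n; exact: measurable_coord.
  by apply/seteqP; split=> w /= [n]; [exists n|move=> _; exists n].
have Ek k : pr m (E k) = pr m (E 0).
  rewrite /pr -[in RHS](preserves_shiftz k mS)//; congr (fine (m _)).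
  apply/seteqP; split=> w /= [n]; rewrite /shiftz /= => h; exists n; move: h.
    by rewrite sub0r addrC.
  by rewrite sub0r addrC.
have U1 : pr m (\bigcup_n E n%:Z) = 1.
  have -> : \bigcup_n E n%:Z = ~` [set w : Omega | forall i, w i = false].
    apply/seteqP; split=> w /=; first by move=> [n _ [j hj]] /(_ (n%:Z - j.+1%:Z)); rewrite hj.
    move/existsNP => [i]; case wi: (w i) => // _; exists `|i|.+1 => //.
    exists `|(`|i|%N%:Z - i)%R|%N; move: wi.
    by have -> : `|i|.+1%:Z - (`|(`|i|%N%:Z - i)%R|.+1)%:Z = i by lia.
  by rewrite prC ?/pr; [case: hm => _ _ ->; rewrite subr0|exact: measurable_zero].
have E1 : pr m (E 0) = 1.
  have mU : measurable (\bigcup_n E n%:Z) by exact: bigcupT_measurable.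
  have c1 : pr m (E n%:Z) @[n --> \oo] --> pr m (\bigcup_n E n%:Z).
    apply: fine_cvg; rewrite -prE//; apply: nondecreasing_cvg_mu => //.
    move=> i j ij; apply/subsetPset => w [n hn]; exists (n + (j - i))%N.
    by have -> : j%:Z - (n + (j - i)).+1%:Z = i%:Z - n.+1%:Z by lia.
  have c0 : pr m (E n%:Z) @[n --> \oo] --> pr m (E 0).
    rewrite (_ : (fun n : nat => pr m (E n%:Z)) = fun=> pr m (E 0)); first exact: cvg_cst.
    by apply/funext => n; exact: Ek.
  by rewrite -U1; apply: (cvg_unique _ c0 c1).
have ae k : \forall w \ae m, E k w by apply: ae_pr1 => //; rewrite Ek.
have : \forall w \ae m, forall n : nat, E (- n%:Z) w by apply: ae_foralln.
apply: filterS => w h n; have [j hj] := h n; exists (n + j)%N; first by lia.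
by rewrite /past; have <- : - n%:Z - j.+1%:Z = - (n + j).+1%:Z by lia.
Qed.

End almost_sure.
End golden_measures.

(** * Shrinking of the [y]-intervals *)

Section regular_sequences.
Context {R : realType}.
Variables (sigma : R).
Hypothesis hsigma : 0 < sigma < 1 / 3.

Local Notation ylow := (ylow sigma).
Local Notation yhigh := (yhigh sigma).

(** Just after a symbol 1 the value is at most [sigma], and both branches keep it below 1
    afterwards. *)
Let yhigh_lt1_of n w : past w n -> yhigh w < 1.
Proof.
elim: n w => [|n IH] w; rewrite -[w in yhigh w](shiftz0) -(addrN (1 : int)) -shiftzD yhigh_shift//;
  set w' := shiftz (-1) w.
  rewrite /past (_ : - 1%:Z = 0 + -1) ?add0r// => e.
  have -> : w' 0 = true by rewrite /w' /shiftz add0r.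
  have := ylow_itv hsigma w' => hy; have hy' : 0 <= 1 - ylow w' <= 1 by lra.
  have s0 : 0 <= sigma by move: hsigma; lra.
  by have := mul_itv s0 hy' => /=; move: hsigma; lra.
move=> e; have /IH h : past w' n by rewrite (@past_shiftz _ _ 1) ?add1n.
have hy := ylow_itv hsigma w'.
case: (w' 0) => /=; last by apply: timeone_lt1 => //; exact: yhigh_itv.
have hy' : 0 <= 1 - ylow w' <= 1 by lra.
have s0 : 0 <= sigma by move: hsigma; lra.
by have := mul_itv s0 hy'; move: hsigma; lra.
Qed.

Lemma yhigh_lt1 w : recurrent w -> yhigh w < 1.
Proof. by move=> /(_ 0%N)[i _]; exact: yhigh_lt1_of. Qed.

(** After a symbol 1 the lower end is [sigma * (1 - y)] with [y] the preceding upper end; positivity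
    requires [y < 1], which needs a still earlier 1. Hence recurrence rather than a single 1. *)
Let ylow_gt0_of n w : recurrent w -> past w n -> 0 < ylow w.
Proof.
elim: n w => [|n IH] w rw; rewrite -[w in ylow w](shiftz0) -(addrN (1 : int)) -shiftzD ylow_shift//;
  set w' := shiftz (-1) w.
  rewrite /past (_ : - 1%:Z = 0 + -1) ?add0r// => e.
  have -> : w' 0 = true by rewrite /w' /shiftz add0r.
  rewrite /= mulr_gt0//; first by move: hsigma; lra.
  by rewrite subr_gt0; apply: yhigh_lt1; exact: recurrent_shiftz.
move=> e; have rw' : recurrent w' by exact: recurrent_shiftz.
have h : 0 < ylow w' by apply: (IH w' rw'); rewrite (@past_shiftz _ _ 1) ?add1n.
case: (w' 0) => /=; last by apply: timeone_gt0 => //; exact: ylow_itv.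
by rewrite mulr_gt0 ?subr_gt0 ?yhigh_lt1//; move: hsigma; lra.
Qed.

Lemma ylow_gt0 w : recurrent w -> 0 < ylow w.
Proof. by move=> rw; have [i _] := rw 0%N; exact: ylow_gt0_of. Qed.

(* The logarithm of the cross ratio of [0, ylow w, yhigh w, 1]. *)
Definition hilbert_length (w : Omega) : R :=
  (ln (yhigh w) - ln (1 - yhigh w)) - (ln (ylow w) - ln (1 - ylow w)).

Lemma measurable_hilbert_length : measurable_fun setT hilbert_length.
Proof.
have mL := measurable_ylow hsigma; have mH := measurable_yhigh hsigma.
have m1 (u : Omega -> R) : measurable_fun setT u -> measurable_fun setT (fun w => ln (u w)).
  by move=> mu; apply: measurableT_comp mu; exact: measurable_ln.
have m2 (u : Omega -> R) : measurable_fun setT u -> measurable_fun setT (fun w => 1 - u w).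
  by move=> mu; apply: measurable_funB mu; exact: measurable_cst.
by apply: measurable_funB; apply: measurable_funB; apply: m1 => //; exact: m2.
Qed.

(** In the coordinate [ln y - ln (1 - y)] the time-one map is the translation by 1, so it preserves
    the length. The affine branch maps [[0, 1]] strictly inside itself and decreases it unless the
    interval is a point. *)
Lemma hilbert_length_shift w : recurrent w ->
  (w 0 = false -> hilbert_length (shiftz 1 w) = hilbert_length w) /\
  (w 0 = true -> hilbert_length (shiftz 1 w) <= hilbert_length w /\
     (hilbert_length (shiftz 1 w) = hilbert_length w -> ylow w = yhigh w)).
Proof.
move=> rw; have l0 := ylow_gt0 rw; have h1 := yhigh_lt1 rw.
have lh := ylow_le_yhigh hsigma w.
have h0 : 0 < yhigh w by exact: lt_le_trans lh.
have l1 : ylow w < 1 by exact: le_lt_trans h1.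
rewrite /hilbert_length ylow_shift// yhigh_shift//; split=> ->/=.
  have E y : 0 < y -> y < 1 -> ln (timeone y) - ln (1 - timeone y) = ln y - ln (1 - y) + 1.
    move=> y0 y1; have hy : 0 <= y <= 1 by rewrite !ltW.
    have d0 := timeone_den_gt0 hy.
    rewrite timeone_onem// timeoneE !ln_div ?posrE ?mulr_gt0 ?subr_gt0 ?expR_gt0//.
    by rewrite lnM ?posrE ?subr_gt0 ?expR_gt0// expRK; ring.
  by rewrite !E//; ring.
have s0 : 0 < sigma by move: hsigma; lra.
have s1 : sigma < 1 by move: hsigma; lra.
have E y : 0 < y -> y < 1 -> ln (sigma * (1 - y)) - ln (1 - sigma * (1 - y)) =
    ln sigma + ln (1 - y) - ln (1 - sigma * (1 - y)).
  by move=> y0 y1; rewrite lnM ?posrE ?subr_gt0.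
rewrite !E//.
set l := ylow w in l0 l1 lh *; set h := yhigh w in h0 h1 lh *.
have dl : 0 < 1 - sigma * (1 - l) by nra.
have dh : 0 < 1 - sigma * (1 - h) by nra.
(* After exponentiation, the change of length on the upper slab is governed by the sign of this
   difference. *)
have key : (1 - sigma * (1 - l)) * h - (1 - sigma * (1 - h)) * l = (1 - sigma) * (h - l) by ring.
have -> : ln sigma + ln (1 - l) - ln (1 - sigma * (1 - l)) -
  (ln sigma + ln (1 - h) - ln (1 - sigma * (1 - h))) =
  (ln (1 - l) - ln (1 - h)) - (ln (1 - sigma * (1 - l)) - ln (1 - sigma * (1 - h))) by ring.
have -> : ln h - ln (1 - h) - (ln l - ln (1 - l)) =
  (ln (1 - l) - ln (1 - h)) - (ln l - ln h) by ring.
rewrite lerD2l lerN2; split.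
  rewrite -subr_ge0 (_ : _ - _ = ln ((1 - sigma * (1 - l)) * h) - ln ((1 - sigma * (1 - h)) * l)).
    rewrite subr_ge0 ler_ln ?posrE ?mulr_gt0// -subr_ge0 key mulr_ge0 ?subr_ge0//; exact: ltW.
  by rewrite !lnM//; ring.
move=> /addrI/oppr_inj e.
have : ln ((1 - sigma * (1 - l)) * h) = ln ((1 - sigma * (1 - h)) * l).
  by rewrite !lnM//; lra.
move/(ln_inj (mulr_gt0 dl h0) (mulr_gt0 dh l0))/eqP; rewrite -subr_eq0 key mulf_eq0.
by rewrite gt_eqF ?subr_gt0//= subr_eq0 => /eqP.
Qed.

Definition regular (w : Omega) := [/\ sparse w,
  recurrent w & forall k, ylow (shiftz k w) = yhigh (shiftz k w)].

Lemma regular_shiftz w k : regular w -> regular (shiftz k w).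
Proof.
move=> [h1 h2 h3]; split.
- by move=> i; rewrite /shiftz addrAC; exact: h1.
- exact: recurrent_shiftz.
- by move=> j; rewrite shiftzD; exact: h3.
Qed.

Section golden_regular.
Variable m : probability Omega R.
Hypothesis hm : golden m.

(** The length never increases along orbits, so it is almost surely constant; at a symbol 1 this
    forces a point. By recurrence there is such a time in the past, and a point remains a point up
    to the present. *)
Lemma ae_fibre : \forall w \ae m, forall k, ylow (shiftz k w) = yhigh (shiftz k w).
Proof.
have inv : \forall w \ae m, hilbert_length (shiftz 1 w) = hilbert_length w.
  have [mS _ _] := hm.
  apply: ae_invariant_of_le => //; [exact: measurable_shiftz|exact: measurable_hilbert_length|].
  apply: filterS (ae_recurrent hm) => w rw; have [h1 h2] := hilbert_length_shift rw.
  by case w0 : (w 0); [case: (h2 w0)|rewrite h1].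
have h1 : \forall w \ae m, symbol w -> ylow w = yhigh w.
  apply: filterS2 (ae_recurrent hm) inv => w rw e w0.
  by have [_ /(_ w0)[_]] := hilbert_length_shift rw; apply.
apply: (@ae_all_shifts _ m hm (fun w => ylow w = yhigh w)); apply: filterS2 (ae_recurrent hm) (ae_all_shifts hm h1) => w rw h.
have [n _ wn] := rw 0%N.
have := h (- n.+1%:Z); rewrite /symbol {1}/shiftz add0r => /(_ wn).
rewrite -[X in X = _]/(low (branch_y sigma) id 0 1 (past (shiftz (- n.+1%:Z) w))).
rewrite -[X in _ = X]/(high (branch_y sigma) id 0 1 (past (shiftz (- n.+1%:Z) w))).
have -> : past (shiftz (- n.+1%:Z) w) = fun k => past w (n.+1 + k)%N.
  by apply/funext => k; exact: past_shiftz.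
apply: (@low_eq_high_iter R (branch_y sigma) id 0 1 ler01 (branch_y_itv hsigma) (branch_y_mono hsigma) (@branch_y_cont R sigma) n.+1).
Qed.

Lemma ae_regular : \forall w \ae m, regular w.
Proof.
apply: filterS3 (ae_sparse hm) (ae_recurrent hm) ae_fibre => w h1 h2 h3.
by split.
Qed.

End golden_regular.

Lemma regular_y w : regular w -> 0 < yhigh w < 1 /\
  yhigh (shiftz 1 w) = branch_y sigma (w 0) (yhigh w).
Proof.
move=> [_ rw /(_ 0)]; rewrite shiftz0 => e; rewrite yhigh_lt1// -e ylow_gt0//.
by rewrite yhigh_shift// e if_same.
Qed.

End regular_sequences.

(** * The central exponent *)

Lemma max_lip (R : realDomainType) (a b c : R) : `|Num.max a c - Num.max b c| <= `|a - b|.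
Proof.
have h1 := ler_norm (a - b); have h2 : b - a <= `|a - b| by rewrite distrC ler_norm.
have h3 := normr_ge0 (a - b).
by rewrite ler_norml /Num.max; case: ltP => ?; case: ltP => ?; apply/andP; split; lra.
Qed.

(** * Expectations and coboundaries *)

Section expectation.
Context {d : measure_display} {T : measurableType d} {R : realType}.
Variable mu : probability T R.
Implicit Types f g : T -> R.

Definition expect f : R := \int[mu]_x f x.
Definition intg f := mu.-integrable setT (EFin \o f).

Lemma expectE f : intg f -> (\int[mu]_x (f x)%:E)%E = (expect f)%:E.
Proof. by move=> hf; rewrite fineK//; apply: integrable_fin_num. Qed.

Lemma bounded_intg f K : measurable_fun setT f -> (forall x, `|f x| <= K) -> intg f.
Proof.
move=> mf hf; apply: measurable_bounded_integrable => //.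
  by apply: le_lt_trans (probability_le1 mu measurableT) (ltry _).
by exists K; split; [exact: num_real|move=> M KM x _; exact: le_trans (ltW KM)].
Qed.

Lemma intg_measurable f : intg f -> measurable_fun setT f.
Proof. by move=> /measurable_int/measurable_EFinP. Qed.

Lemma intg_cst c : intg (fun=> c).
Proof. by apply: (@bounded_intg _ `|c|) => //; exact: measurable_cst. Qed.

Lemma expect_cst c : expect (fun=> c) = c.
Proof. by rewrite /expect Rintegral_cst// -/(pr mu setT) prT mulr1. Qed.

Lemma expectD f g : intg f -> intg g -> expect (fun x => f x + g x) = expect f + expect g.
Proof. exact: RintegralD. Qed.

Lemma intgD f g : intg f -> intg g -> intg (fun x => f x + g x).
Proof. by move=> hf hg; exact: (integrableD measurableT hf hg). Qed.

Lemma expectB f g : intg f -> intg g -> expect (fun x => f x - g x) = expect f - expect g.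
Proof. exact: RintegralB. Qed.

Lemma intgB f g : intg f -> intg g -> intg (fun x => f x - g x).
Proof. by move=> hf hg; exact: (integrableB measurableT hf hg). Qed.

Lemma expect_ae_eq f g : measurable_fun setT f -> measurable_fun setT g ->
  (\forall x \ae mu, f x = g x) -> expect f = expect g.
Proof.
move=> mf mg fg; congr fine; apply: ae_eq_integral => //.
- exact/measurable_EFinP.
- exact/measurable_EFinP.
- by apply: filterS fg => x -> _.
Qed.

Lemma intg_ae_le f g : measurable_fun setT f -> intg g ->
  (\forall x \ae mu, `|f x| <= `|g x|) -> intg f.
Proof.
move=> mf ig fg; apply/integrableP; split; first exact/measurable_EFinP.
have mg := intg_measurable ig; have [_ hg] := integrableP _ _ _ ig.
apply: le_lt_trans hg; apply: ae_ge0_le_integral => //.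
- by do 2 apply: measurableT_comp => //.
- by do 2 apply: measurableT_comp => //.
- by apply: filterS fg => x h _; rewrite lee_fin.
Qed.

Lemma expect_ge0 f : (\forall x \ae mu, 0 <= f x) -> measurable_fun setT f -> 0 <= expect f.
Proof.
move=> hf mf; rewrite (@expect_ae_eq _ (fun x => `|f x|))//.
- by apply: Rintegral_ge0.
- exact: measurableT_comp.
- by apply: filterS hf => x /ger0_norm.
Qed.

Lemma expect_le f g : intg f -> intg g -> (\forall x \ae mu, f x <= g x) ->
  expect f <= expect g.
Proof.
move=> hf hg fg; rewrite -subr_ge0 -expectB//; apply: expect_ge0.
  by apply: filterS fg => x; rewrite subr_ge0.
by apply: intg_measurable; exact: intgB.
Qed.

Lemma expect_eq0 f : intg f -> (forall x, 0 <= f x) -> expect f = 0 ->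
  \forall x \ae mu, f x = 0.
Proof.
move=> hf f0 e; have /(ae_eq_integral_abs mu measurableT) : measurable_fun setT (EFin \o f).
  exact: measurable_int hf.
case=> + _; rewrite (eq_integral (EFin \o f)); last first.
  by move=> x _ /=; rewrite ger0_norm.
rewrite expectE// e => /(_ erefl); apply: filterS => x /(_ Logic.I).
by move=> [].
Qed.

Lemma expect_dominated (f_ : nat -> T -> R) f g : (forall n, measurable_fun setT (f_ n)) ->
  measurable_fun setT f -> (\forall x \ae mu, f_ n x @[n --> \oo] --> f x) -> intg g ->
  (\forall x \ae mu, forall n, `|f_ n x| <= g x) ->
  intg f /\ expect (f_ n) @[n --> \oo] --> expect f.
Proof.
move=> mf_ mf cf ig fg.
have [||||h1 _ h3] := @dominated_convergence _ _ _ mu setT measurableT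
  (fun n => EFin \o f_ n) (EFin \o f) (EFin \o g) _ _ _ ig.
- by move=> n; exact/measurable_EFinP.
- exact/measurable_EFinP.
- by apply: filterS cf => x h _; apply: cvg_EFin => //; near=> n.
- by apply: filterS fg => x h n _; rewrite /= lee_fin.
split => //; have h1' : (\int[mu]_x (EFin \o f) x)%E = (expect f)%:E by exact: expectE.
by rewrite h1' in h3; exact: (fine_cvg h3).
Unshelve. all: by end_near.
Qed.

Lemma expect_simple (I : finType) (xi : T -> I) (G : I -> R) : simple_map xi ->
  intg (G \o xi) /\ expect (G \o xi) = \sum_i G i * dist mu xi i.
Proof.
move=> hx.
have mi i : measurable_fun setT (\1_(xi @^-1` [set i]) : T -> R).
  by apply: measurable_indic.
have ii i : intg (\1_(xi @^-1` [set i]) : T -> R).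
  apply: (@bounded_intg _ 1) => // x; rewrite indicE; case: (_ \in _) => /=; by rewrite ?normr1 ?normr0.
have E : G \o xi = fun x => \sum_i G i * \1_(xi @^-1` [set i]) x.
  apply/funext => x /=; rewrite (bigD1 (xi x))//= big1 => [|i ix].
    by rewrite addr0 indicE mem_set// mulr1.
  by rewrite indicE memNset ?mulr0//= => /esym/eqP; rewrite (negPf ix).
have iGi i : intg (fun x => G i * \1_(xi @^-1` [set i]) x).
  exact: (integrableZl measurableT (G i) (ii i)).
have [h1 h2] : intg (fun x => \sum_i G i * \1_(xi @^-1` [set i]) x) /\
    expect (fun x => \sum_i G i * \1_(xi @^-1` [set i]) x) =
    \sum_i expect (fun x => G i * \1_(xi @^-1` [set i]) x).
  elim: (index_enum I) => [|i r [IH1 IH2]].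
    rewrite big_nil (_ : (fun x => _) = fun=> 0); last by apply/funext => x; rewrite big_nil.
    by rewrite expect_cst; split => //; exact: intg_cst.
  rewrite big_cons (_ : (fun x => _) = fun x => G i * \1_(xi @^-1` [set i]) x +
    \sum_(i <- r) G i * \1_(xi @^-1` [set i]) x); last by apply/funext => x; rewrite big_cons.
  by split; [exact: intgD|rewrite expectD// IH2].
rewrite E; split => //; rewrite h2; apply: eq_bigr => i _.
rewrite /expect (RintegralZl _ measurableT (ii i)).
  congr (_ * _).
by rewrite /Rintegral integral_indic// setIT.
Qed.

Section preserving_map.
Variable F : T -> T.
Hypothesis mF : measurable_fun setT F.
Hypothesis muF : preserves mu F.

Lemma expect_preserves f K : measurable_fun setT f -> (forall x, `|f x| <= K) ->
  expect (f \o F) = expect f.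
Proof.
move=> mf hf; have mfF : measurable_fun setT (f \o F) by exact: measurableT_comp.
rewrite /expect /Rintegral; congr fine.
have := @integral_pushforward _ _ T T R F mF mu setT (EFin \o f).
rewrite preimage_setT => <-//.
- apply: eq_measure_integral => A mA _.
  exact: (muF mA).
- exact/measurable_EFinP.
- exact: (bounded_intg mfF (fun x => hf (F x))).
Qed.

(* If V <= 0 is only finite, V o F - V still has zero mean as soon as it is
   bounded below: truncate V from below, then use Fatou and domination. *)
Lemma expect_coboundary (V g : T -> R) K : measurable_fun setT V ->
  (forall x, V x <= 0) -> measurable_fun setT g ->
  (\forall x \ae mu, g x = V (F x) - V x) -> 0 <= K -> (forall x, - K <= g x) ->
  intg g /\ expect g = 0.
Proof.
move=> mV V0 mg gE K0 gK.
pose VN (n : nat) x := Num.max (V x) (- n%:R).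
have mVN n : measurable_fun setT (VN n).
  by apply: measurable_maxr => //; exact: measurable_cst.
have bVN n x : `|VN n x| <= n%:R.
  rewrite ler_norml /VN le_max lexx orbT/= ge_max (le_trans (V0 x))//=.
  by rewrite (@le_trans _ _ 0)// oppr_le0.
pose gN n x := VN n (F x) - VN n x.
have iVN n : intg (VN n) by exact: bounded_intg (bVN n).
have mVNF n : measurable_fun setT (VN n \o F) by exact: measurableT_comp.
have iVNF n : intg (VN n \o F) by apply: (@bounded_intg _ n%:R) => // x; exact: bVN.
have igN n : intg (gN n) by exact: intgB (iVNF n) (iVN n).
have gN0 n : expect (gN n) = 0.
  by rewrite (expectB (iVNF n) (iVN n)) (expect_preserves (mVN n) (bVN n)) subrr.
have lip n x : `|gN n x| <= `|V (F x) - V x|.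
  exact: max_lip.
have lipg : \forall x \ae mu, forall n, `|gN n x| <= `|g x|.
  by apply: filterS gE => x -> n.
(* Truncating [V] from below does not lower a negative increment, so the bound [- K] survives. *)
have gNge n : \forall x \ae mu, - K <= gN n x.
  apply: filterS gE => x gx; have := gK x; rewrite gx /gN /VN /Num.max.
  by case: ltP => h1; case: ltP => h2; lra.
have gNcvg : \forall x \ae mu, gN n x @[n --> \oo] --> g x.
  apply: filterS gE => x ->.
  have VNcvg z : VN n z @[n --> \oo] --> V z.
    apply: cvg_near_cst; exists `|Num.ceil (- V z)|%N => // n /= hn.
    apply/max_idPl; rewrite lerNl; apply: le_trans (ceil_ge _) _.
    have : ((Num.ceil (- V z))%:~R : R) <= `|Num.ceil (- V z)|%N%:R.
      by rewrite natr_absz ler_int ler_norm.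
    by move/le_trans; apply; rewrite ler_nat.
  by apply: cvgB.
have ig : intg g.
  pose h n x := Num.max (gN n x + K) 0.
  have mh n : measurable_fun setT (h n).
    apply: measurable_maxr; last exact: measurable_cst.
    by apply: measurable_funD; [exact: intg_measurable|exact: measurable_cst].
  have mgK : measurable_fun setT (fun x => g x + K).
    by apply: measurable_funD => //; exact: measurable_cst.
  have hE n : \forall x \ae mu, h n x = gN n x + K.
    by apply: filterS (gNge n) => x hx; apply/max_idPl; lra.
  have hcvg : \forall x \ae mu, h n x @[n --> \oo] --> g x + K.
    have : \forall x \ae mu, forall n, h n x = gN n x + K by apply: ae_foralln.
    apply: filterS2 gNcvg => x cx /funext hx.
    rewrite hx.
    by apply: cvgD => //; exact: cvg_cst.
  (* The truncated increments have mean 0, so every [h n] has integral exactly [K]; Fatou then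
     bounds the integral of [g + K] by [K]. *)
  have ih n : (\int[mu]_x (h n x)%:E)%E = K%:E.
    have iK : intg (fun x => gN n x + K) by apply: intgD => //; exact: intg_cst.
    rewrite (@ae_eq_integral _ _ _ mu setT (fun x => (gN n x + K)%:E))//.
    - by rewrite expectE// (expectD (igN n) (intg_cst K)) gN0 expect_cst add0r.
    - exact/measurable_EFinP.
    - by apply/measurable_EFinP; exact: intg_measurable.
    - by apply: filterS (hE n) => x -> _.
  have igK : intg (fun x => g x + K).
    apply/integrableP; split; first exact/measurable_EFinP.
    rewrite (@ae_eq_integral _ _ _ mu setT (fun x => limn_einf (fun n => (h n x)%:E)))//; first last.
    - apply: filterS hcvg => x hx _.
      have cE : (h n x)%:E @[n --> \oo] --> (g x + K)%:E.
        by apply: cvg_EFin => //; near=> n.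
      have [-> _] := cvg_limn_einf_sup cE.
      by rewrite gee0_abs// lee_fin; have := gK x; lra.
    - apply: measurableT_comp => //.
      apply: (measurable_fun_limn_esup (f := fun n x => (- (h n x)%:E)%E)) => n.
      by apply: measurableT_comp => //; exact/measurable_EFinP.
    - by do 2 apply: measurableT_comp => //.
    apply: le_lt_trans (fatou mu measurableT _ _) _.
    - by move=> n; exact/measurable_EFinP.
    - by move=> n x _; rewrite lee_fin /h le_max lexx orbT.
    rewrite (_ : (fun n => _) = fun=> K%:E); last by apply/funext => n; exact: ih.
    have [-> _] := cvg_limn_einf_sup (cvg_cst (K%:E : \bar R) (F := \oo)).
    by rewrite ltry.
  rewrite (_ : g = fun x => (g x + K) - K); last by apply/funext => x; rewrite addrK.
  by apply: intgB => //; exact: intg_cst.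
split => //.
have iabs : intg (fun x => `|g x|) by exact: integrable_abse ig.
have [_ c1] := expect_dominated (fun n => intg_measurable (igN n)) mg gNcvg iabs lipg.
have c2 : expect (gN n) @[n --> \oo] --> (0 : R).
  by under eq_fun do rewrite gN0; exact: cvg_cst.
exact: (cvg_unique _ c1 c2).
Unshelve. all: by end_near.
Qed.

End preserving_map.
End expectation.

(** * The exponent as a limit of cylinder averages *)

Section central_jacobian_symbolic.
Context {R : realType}.
Variables (sigma : R).
Hypothesis hsigma : 0 < sigma < 1 / 3.

Local Notation yhigh := (yhigh sigma).

Let s0 : 0 < sigma. Proof. by move: hsigma; lra. Qed.
Let s1 : sigma < 1. Proof. by move: hsigma; lra. Qed.

Let ends_y n s := @ends_itv R (branch_y sigma) id 0 1 ler01
  (branch_y_itv hsigma) (branch_y_mono hsigma) n s.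

Definition jac (w : Omega) : R :=
  if w 0 then ln sigma else ln (derive1 (@timeone R) (yhigh w)).

(** What remains of [ln sigma] once the increment of [ln y + ln (1 - y)] from [y] to
    [sigma * (1 - y)] is subtracted; the terms [ln sigma] and [ln (1 - y)] cancel. *)
Definition defect (y : R) : R := ln y - ln (1 - sigma * (1 - y)).

Definition psi (w : Omega) : R := if w 0 then defect (yhigh w) else 0.

(** The upper end at depth [n] replaces its limit [yhigh]. As [defect] is increasing, this
    overestimates [psi] by a function of finitely many symbols. *)
Definition psi_ n (w : Omega) : R :=
  if w 0 then defect (ends (branch_y sigma) id 0 1 n (past w)).2 else 0.

Let den1 y : 0 <= y <= 1 -> 0 < 1 - sigma * (1 - y).
Proof.
move=> hy; have hy' : 0 <= 1 - y <= 1 by lra.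
by have := mul_itv (ltW s0) hy'; move: s1; lra.
Qed.

Lemma defect_le x y : 0 < x -> x <= y -> y <= 1 -> defect x <= defect y.
Proof.
move=> x0 xy y1; have y0 := lt_le_trans x0 xy.
have dx : 0 < 1 - sigma * (1 - x) by apply: den1; apply/andP; split; lra.
have dy : 0 < 1 - sigma * (1 - y) by apply: den1; apply/andP; split; lra.
rewrite /defect -!ln_div ?posrE// ler_ln ?posrE ?divr_gt0//.
rewrite ler_pdivrMr// mulrAC ler_pdivlMr// -subr_ge0.
rewrite (_ : _ - _ = (1 - sigma) * (y - x)); last by ring.
by rewrite mulr_ge0// subr_ge0// ltW.
Qed.

Lemma defect1 : defect 1 = 0.
Proof. by rewrite /defect subrr mulr0 subr0 !ln1 subrr. Qed.

Lemma defect_le0 y : 0 < y <= 1 -> defect y <= 0.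
Proof. by move=> /andP[y0 y1]; rewrite -defect1; apply: defect_le. Qed.

Lemma defect_lt0 y : 0 < y < 1 -> defect y < 0.
Proof.
move=> /andP[y0 y1]; have dy : 0 < 1 - sigma * (1 - y) by apply: den1; apply/andP; split; lra.
rewrite subr_lt0 ltr_ln ?posrE// -subr_gt0.
rewrite (_ : _ - _ = (1 - sigma) * (1 - y)); last by ring.
by rewrite mulr_gt0 ?subr_gt0.
Qed.

Lemma defect_cont y : 0 < y <= 1 -> {for y, continuous defect}.
Proof.
move=> /andP[y0 y1]; apply: cvgB; first exact: continuous_ln.
apply: (@cvg_comp _ _ _ (fun y : R => 1 - sigma * (1 - y)) (@ln R)); last first.
  by apply: continuous_ln; apply: den1; rewrite ltW.
apply: cvgB; first exact: cvg_cst.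
apply: cvgM; first exact: cvg_cst.
by apply: cvgB; [exact: cvg_cst|exact: cvg_id].
Qed.

Let measurable_if0 (u v : Omega -> R) : measurable_fun setT u -> measurable_fun setT v ->
  measurable_fun setT (fun w : Omega => if w 0 then u w else v w).
Proof.
move=> mu mv; apply: measurable_fun_ifT => //.
apply: (measurable_of_window (k := 0) (n := 1)) => w w' /ffunP/(_ ord0).
by rewrite !ffunE addr0.
Qed.

Let measurable_lnc (u : Omega -> R) : measurable_fun setT u -> measurable_fun setT (fun w => ln (u w)).
Proof. by move=> mu; apply: measurableT_comp mu; exact: measurable_ln. Qed.

Let m1 (u : Omega -> R) : measurable_fun setT u -> measurable_fun setT (fun w => 1 - u w).
Proof. by move=> mu; apply: measurable_funB mu; exact: measurable_cst. Qed.

Let mH := measurable_yhigh hsigma.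

Lemma ln_derive_timeone y : 0 <= y <= 1 ->
  ln (derive1 (@timeone R) y) = -1 - (ln (y + (1 - y) * expR (-1))) *+ 2.
Proof.
move=> hy; have d0 := timeone_den_gt0 hy.
by rewrite derive1_timeone// ln_div ?posrE ?exprn_gt0 ?expR_gt0// expRK lnXn.
Qed.

Lemma ln_derive_timeone_bound y : 0 <= y <= 1 ->
  `|ln (derive1 (@timeone R) y)| <= 1.
Proof.
move=> hy; have d0 := timeone_den_gt0 hy; rewrite ln_derive_timeone//.
have c0 : 0 < expR (-1) :> R by exact: expR_gt0.
have c1 : expR (-1) < 1 :> R by rewrite expR_lt1; lra.
have h1 : ln (y + (1 - y) * expR (-1)) <= 0.
  have hy' : 0 <= 1 - y <= 1 by lra.
  by apply: ln_le0; have := mul_itv (ltW c0) hy'; nra.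
have h2 : -1 <= ln (y + (1 - y) * expR (-1)).
  rewrite -[X in X <= _]expRK ler_ln ?posrE//; nra.
by rewrite ler_norml; apply/andP; split; rewrite mulr2n; lra.
Qed.

Lemma measurable_jac : measurable_fun setT jac.
Proof.
apply: measurable_if0; first exact: measurable_cst.
rewrite (_ : (fun w => _) = fun w => -1 - (ln (yhigh w + (1 - yhigh w) * expR (-1)) + ln (yhigh w + (1 - yhigh w) * expR (-1)))); last first.
  by apply/funext => w; rewrite ln_derive_timeone ?mulr2n//; exact: yhigh_itv.
have h : measurable_fun setT (fun w => ln (yhigh w + (1 - yhigh w) * expR (-1))).
  apply: measurable_lnc; apply: measurable_funD => //.
  by apply: measurable_funM; [exact: m1|exact: measurable_cst].
by apply: measurable_funB; [exact: measurable_cst|exact: measurable_funD].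
Qed.

Definition jac_bound : R := 1 - ln sigma.

Lemma jac_bound_ge1 : 1 <= jac_bound.
Proof. by rewrite /jac_bound lerDl oppr_ge0 ln_le0// ltW. Qed.

Lemma jac_le_bound w : `|jac w| <= jac_bound.
Proof.
rewrite /jac; case: ifP => _; last first.
  by apply: le_trans jac_bound_ge1; apply: ln_derive_timeone_bound; exact: yhigh_itv.
by rewrite ler0_norm ?ln_le0 ?ltW// /jac_bound; lra.
Qed.

Lemma measurable_defect_comp (u : Omega -> R) : measurable_fun setT u ->
  measurable_fun setT (fun w => defect (u w)).
Proof.
move=> mu; apply: measurable_funB; apply: measurable_lnc => //.
apply: m1; apply: measurable_funM; first exact: measurable_cst.
exact: m1.
Qed.

Lemma measurable_psi : measurable_fun setT psi.
Proof.
by apply: measurable_if0; [exact: measurable_defect_comp|exact: measurable_cst].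
Qed.

Lemma measurable_psi_ n : measurable_fun setT (psi_ n).
Proof.
apply: measurable_if0; last exact: measurable_cst.
apply: measurable_defect_comp.
by case: (measurable_ends_past (branch_y sigma) id ler01 n).
Qed.

Lemma psi_block n : exists G : {ffun 'I_n.+1 -> bool} -> R,
  forall w, psi_ n w = G (block (- n%:Z) n.+1 w).
Proof.
(* Position [j] of the window is time [j - n]: the last one is the present, and past entry [i], at
   time [-(i + 1)], sits at [n - (i + 1)]. *)
exists (fun v => if v ord_max then defect (ends (branch_y sigma) id 0 1 n
  (fun i => v (inord (n - i.+1)))).2 else 0) => w.
rewrite /psi_ ffunE /= addNr; case: ifP => // _; congr (defect _.2).
apply: ends_ext => i hi; rewrite ffunE inordK; last by lia.
by rewrite /past; congr w; lia.
Qed.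

(** At finite depth no recurrence is available, but the upper end is still positive, so its
    logarithm is meaningful. The two bounds go together because the decreasing branch exchanges the
    ends. *)
Lemma ends_y_pos n s : 0 < (ends (branch_y sigma) id 0 1 n s).2 /\
  (ends (branch_y sigma) id 0 1 n s).1 < 1.
Proof.
elim: n s => [|n IH] s /=; first by split; [exact: ltr01|exact: ltr01].
have [h1 h2] := IH (stail s).
have [k1 [k2 k3]] := ends_y n (stail s).
set l := (ends _ _ _ _ n _).1 in h2 k1 k2 *; set h := (ends _ _ _ _ n _).2 in h1 k2 k3 *.
case: (s 0%N) => /=.
  have hy : 0 <= 1 - h <= 1 by apply/andP; split; lra.
  have := mul_itv (ltW s0) hy => /andP[_ a].
  by rewrite mulr_gt0 ?subr_gt0//; split => //; move: s1 a; lra.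
split; first by apply: timeone_gt0 => //; rewrite ltW.
by apply: timeone_lt1 => //; rewrite k1 ltW.
Qed.

Lemma psi__le0 n w : psi_ n w <= 0.
Proof.
rewrite /psi_; case: ifP => // _; apply: defect_le0.
have [-> _] /= := ends_y_pos n (past w).
by have [_ [_ ->]] := ends_y n (past w).
Qed.

Lemma psi_le_psi_ n w : recurrent w -> psi w <= psi_ n w.
Proof.
move=> rw; rewrite /psi /psi_; case: ifP => // _; apply: defect_le.
- by apply: lt_le_trans (ylow_le_yhigh hsigma w); exact: ylow_gt0.
- exact: (@high_le_ends R (branch_y sigma) id 0 1 ler01 (branch_y_itv hsigma) (branch_y_mono hsigma)).
- by have [_ [_ ->]] := ends_y n (past w).
Qed.

Lemma psi__cvg w : recurrent w -> psi_ n w @[n --> \oo] --> psi w.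
Proof.
move=> rw; rewrite /psi /psi_; case: ifP => // _; last exact: cvg_cst.
apply: continuous_cvg.
  apply: defect_cont; rewrite (lt_le_trans _ (ylow_le_yhigh hsigma w)) ?ylow_gt0//.
  by case/andP: (yhigh_itv hsigma w).
exact: (@high_cvg R (branch_y sigma) id 0 1 ler01 (branch_y_itv hsigma) (branch_y_mono hsigma)).
Qed.

(** The time-one map [f] of a field [v] satisfies [f' = (v o f) / v]; with [v = y (1 - y)] the
    logarithm of [f'] is the increment of [ln v], so nothing is left on the lower slab. *)
Lemma coboundary_y w : regular sigma w ->
  jac w - psi w = (ln (yhigh (shiftz 1 w)) + ln (1 - yhigh (shiftz 1 w))) -
    (ln (yhigh w) + ln (1 - yhigh w)).
Proof.
move=> /(regular_y hsigma)[/andP[y0 y1] ->]; rewrite /jac /psi /branch_y /defect.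
set y := yhigh w in y0 y1 *; have hy : 0 <= y <= 1 by rewrite !ltW.
have dy := den1 hy.
case: (w 0); first by rewrite lnM ?posrE ?subr_gt0//; ring.
have d0 := timeone_den_gt0 hy.
rewrite ln_derive_timeone// timeone_onem// timeoneE !ln_div ?posrE ?mulr_gt0 ?subr_gt0 ?expR_gt0//.
by rewrite lnM ?posrE ?subr_gt0 ?expR_gt0// expRK mulr2n; ring.
Qed.

Section golden_exponent.
Variable m : probability Omega R.
Hypothesis hm : golden m.

Lemma intg_jac : intg m jac.
Proof. exact: (bounded_intg m measurable_jac jac_le_bound). Qed.

(** [jac] is bounded and the coboundary turns out integrable with mean 0, so integrability of the
    unbounded [psi] comes as a consequence. *)
Lemma expect_jac_psi : intg m psi /\ expect m jac = expect m psi.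
Proof.
have [mS _ _] := hm.
pose V w := ln (yhigh w) + ln (1 - yhigh w).
(* The coboundary identity holds only on regular sequences, while a lower bound is wanted
   everywhere. On regular sequences [psi <= 0], so [jac - psi >= jac] and the maximum changes
   nothing. *)
pose g w := Num.max (jac w - psi w) (- jac_bound).
have mV : measurable_fun setT V.
  by apply: measurable_funD; apply: measurable_lnc => //; exact: m1.
have V0 w : V w <= 0.
  have /andP[y0 y1] := yhigh_itv hsigma w.
  by rewrite /V -[0]addr0; apply: lerD; apply: ln_le0 => //; lra.
have mg : measurable_fun setT g.
  apply: measurable_maxr; last exact: measurable_cst.
  exact: measurable_funB measurable_jac measurable_psi.
have reg := ae_regular hsigma hm.
have gE' w : regular sigma w -> g w = jac w - psi w.
  move=> rw; apply/max_idPl; rewrite lerNl opprB.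
  have hp : psi w <= 0.
    have [_ rec _] := rw; exact: le_trans (psi_le_psi_ 0 rec) (psi__le0 0 w).
  have := jac_le_bound w; rewrite ler_norml => /andP[h _]; lra.
have gE : \forall w \ae m, g w = V (shiftz 1 w) - V w.
  by apply: filterS reg => w rw; rewrite gE'// coboundary_y.
have K0 : 0 <= jac_bound by apply: le_trans jac_bound_ge1.
have gK w : - jac_bound <= g w by rewrite /g le_max lexx orbT.
have [ig eg] := expect_coboundary (measurable_shiftz 1) mS mV V0 mg gE K0 gK.
have pE : \forall w \ae m, psi w = jac w - g w.
  by apply: filterS reg => w rw; rewrite gE'//; ring.
have ijg := intgB intg_jac ig.
split.
  apply: (intg_ae_le measurable_psi ijg).
  by apply: filterS pE => w ->.
rewrite (expect_ae_eq measurable_psi (intg_measurable ijg) pE).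
by rewrite (expectB intg_jac ig) eg subr0.
Qed.

Definition exponent : R := expect m jac.

(** The exponent is the mean of [psi <= 0]. If it vanished, [psi] would be 0 almost surely; but
    [psi < 0] at every symbol 1, so no 1 would occur, against recurrence. *)
Lemma exponent_lt0 : exponent < 0.
Proof.
have [ipsi e] := expect_jac_psi; rewrite /exponent e.
have reg := ae_regular hsigma hm.
have p0 : \forall w \ae m, psi w <= 0.
  apply: filterS reg => w [_ rec _]; exact: le_trans (psi_le_psi_ 0 rec) (psi__le0 0 w).
have le0 : expect m psi <= 0.
  rewrite -(expect_cst m 0); apply: expect_le => //; exact: intg_cst.
rewrite lt_neqAle le0 andbT; apply/eqP => e0.
pose u w := Num.max (- psi w) 0.
have uE : \forall w \ae m, u w = 0 - psi w.
  by apply: filterS p0 => w hw; rewrite sub0r; apply/max_idPl; lra.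
have mu : measurable_fun setT u.
  apply: measurable_maxr; last exact: measurable_cst.
  by apply: measurableT_comp => //; exact: measurable_psi.
have i0 := intgB (intg_cst m 0) ipsi.
have iu : intg m u by apply: (intg_ae_le mu i0); apply: filterS uE => w ->.
have eu : expect m u = 0.
  rewrite (expect_ae_eq mu (intg_measurable i0) uE).
  by rewrite (expectB (intg_cst m 0) ipsi) e0 expect_cst subrr.
have u0 := expect_eq0 iu (fun w => _ : 0 <= u w) eu.
have {u0} : \forall w \ae m, u w = 0 by apply: u0 => w; rewrite /u le_max lexx orbT.
move=> u0; have h : \forall w \ae m, ~~ symbol w.
  apply: filterS3 reg u0 uE => w rw -> e1; apply/negP => w0.
  have [hy _] := regular_y hsigma rw; have := defect_lt0 hy.
  by move: e1; rewrite /psi; rewrite /symbol in w0; rewrite w0; lra.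
have hall : \forall w \ae m, forall k, ~~ symbol (shiftz k w).
  exact: (ae_all_shifts hm (P := fun w => ~~ symbol w)).
have mT : (0%R < m setT)%E by rewrite probability_setT lte01.
have PF := @ae_properfilter_algebraOfSetsType _ Omega R m mT.
have [w [rec h0]] := @filter_ex _ _ PF _ (filterI (ae_recurrent hm) hall).
have [n _] := rec 0%N; have := h0 (- n.+1%:Z).
by rewrite /symbol /shiftz add0r /past => /negP.
Qed.

Lemma psi__expect n : exists G : {ffun 'I_n.+1 -> bool} -> R,
  (forall v, G v <= 0) /\ (forall w, psi_ n w = G (block (- n%:Z) n.+1 w)).
Proof.
have [G hG] := psi_block n.
(* Capping at 0 makes the sign hold for all words and leaves the value at the block of [w]
   unchanged. *)
exists (fun v => Num.min (G v) 0); split; first by move=> v; rewrite ge_min lexx orbT.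
by move=> w; rewrite -hG; apply/esym/min_idPl; exact: psi__le0.
Qed.

Lemma psi__expect_cvg : expect m (psi_ n) @[n --> \oo] --> exponent.
Proof.
have [ipsi e] := expect_jac_psi; rewrite /exponent e.
have iabs : intg m (fun w => `|psi w|) by exact: integrable_abse ipsi.
have rec := ae_recurrent hm.
have c : \forall w \ae m, psi_ n w @[n --> \oo] --> psi w.
  by apply: filterS rec => w rw; apply: (psi__cvg rw).
have b : \forall w \ae m, forall n, `|psi_ n w| <= `|psi w|.
  apply: filterS rec => w rw n.
  by rewrite !ler0_norm ?lerN2 ?psi_le_psi_// ?psi__le0// (le_trans (psi_le_psi_ 0 rw))// psi__le0.
by have [_] := expect_dominated measurable_psi_ measurable_psi c iabs b.
Qed.

(** An upper bound by finitely many word probabilities, hence one that passes to weak limits. *)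
Lemma exponent_le_psi_ n : exponent <= expect m (psi_ n).
Proof.
have [ipsi e] := expect_jac_psi; rewrite /exponent e.
have rec := ae_recurrent hm.
apply: expect_le => //.
  apply: (intg_ae_le (measurable_psi_ n) ipsi); apply: filterS rec => w rw.
  by rewrite !ler0_norm ?lerN2 ?psi_le_psi_// ?psi__le0// (le_trans (psi_le_psi_ 0 rw))// psi__le0.
by apply: filterS rec => w; exact: psi_le_psi_.
Qed.

End golden_exponent.
End central_jacobian_symbolic.

(** * The critical parameter *)

Definition zero_word (n : nat) : {ffun 'I_n -> bool} := [ffun=> false].

Lemma block_word0 n : block_word (zero_word n) = nseq n false.
Proof.
apply: (@eq_from_nth _ false); rewrite size_block_word ?size_nseq// => i hi.
by rewrite (nth_block_word _ (Ordinal hi)) ffunE nth_nseq hi.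
Qed.

(** * Measures described by word probabilities *)

Section word_weights.
Context {R : realType}.

Implicit Types (m : probability Omega R) (p : seq bool -> R).

Definition word_weight m (v : seq bool) : R :=
  pr m [set w : Omega | forall i, (i < size v)%N -> w i%:Z = nth false v i].

Lemma word_weight_block m n (v : {ffun 'I_n -> bool}) :
  dist m (block 0 n) v = word_weight m (block_word v).
Proof.
congr pr; apply/seteqP; split=> w /=.
  move=> <- i; rewrite size_block_word => hi.
  by rewrite (nth_block_word _ (Ordinal hi)) ffunE add0r.
move=> h; apply/ffunP => i; rewrite ffunE add0r h ?size_block_word//.
by rewrite nth_block_word.
Qed.

Lemma word_weight_block_shift m k n (v : {ffun 'I_n -> bool}) :
  preserves m (shiftz 1) -> dist m (block k n) v = word_weight m (block_word v).
Proof.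
move=> mS; rewrite -word_weight_block /dist /pr.
rewrite -[in RHS](preserves_shiftz k mS); last exact: simple_block.
congr (fine (m _)); apply/seteqP; split=> w /=; by rewrite block_shiftz add0r.
Qed.

Lemma measurable_word (v : seq bool) :
  measurable [set w : Omega | forall i, (i < size v)%N -> w i%:Z = nth false v i].
Proof.
rewrite (_ : [set w | _] = (block 0 (size v) : Omega -> _) @^-1` [set [ffun i : 'I_(size v) => nth false v i]]).
  exact: simple_block.
apply/seteqP; split=> w /=.
  by move=> h; apply/ffunP => i; rewrite !ffunE add0r h.
by move=> /ffunP h i hi; have := h (Ordinal hi); rewrite !ffunE add0r.
Qed.

Lemma weight_word_weight m : preserves m (shiftz 1) -> weight (word_weight m).
Proof.
move=> mS; split.
- by move=> v; exact: pr_ge0.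
- by rewrite /word_weight -(prT m); congr pr; apply/seteqP; split.
- move=> v; rewrite /word_weight -prU; [|exact: measurable_word..|].
    congr pr; apply/seteqP; split=> w /=.
      move=> h; case e : (w (size v)%:Z); [right|left] => i; rewrite size_rcons ltnS => hi;
        rewrite nth_rcons; case: ltngtP hi => // hi _; [exact: h|by rewrite hi|exact: h|by rewrite hi].
    by case=> h i hi; rewrite h ?size_rcons ?nth_rcons ?hi// ltnS ltnW.
  apply/seteqP; split=> w //= [h1 h2].
  have := h1 (size v); have := h2 (size v); rewrite !size_rcons !nth_rcons ltnn eqxx.
  by move=> -> // /(_ (ltnSn _)).
- move=> v; rewrite /word_weight -prU; [|exact: measurable_word..|].
    rewrite /pr -mS; last exact: measurable_word.
    congr (fine (m _)); apply/seteqP; split=> w /=.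
      move=> h; case e : (w 0); [right|left] => -[|i] //= hi;
        by have := h i hi; rewrite /shiftz -PoszD addn1.
    by case=> h i hi; have := h i.+1 hi; rewrite /shiftz -PoszD addn1.
  apply/seteqP; split=> w //= [h1 h2].
  by have := h1 0%N isT; have := h2 0%N isT => /= ->.
Qed.

Definition word_entropy (p : seq bool -> R) (n : nat) : R :=
  \sum_(v : {ffun 'I_n -> bool}) negxlnx (p (block_word v)).

Lemma entropy_symbol m n :
  entropy m (names (shiftz 1) symbol n) = word_entropy (word_weight m) n.
Proof.
rewrite (_ : names _ _ _ = block 0 n); last by apply/funext => w; exact: names_symbol.
by apply: eq_bigr => v _; congr negxlnx; exact: word_weight_block.
Qed.

Lemma sum_weight p n : weight p -> \sum_(v : {ffun 'I_n -> bool}) p (block_word v) = 1.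
Proof.
move=> hp; have [m [_ h]] := weight_measure hp.
rewrite -[RHS](sum_dist m (@simple_block 0 n)).
by apply: eq_bigr => v _; rewrite h.
Qed.

Lemma symbol_rate_le m n : preserves m (shiftz 1) -> (0 < n)%N ->
  symbol_rate m <= word_entropy (word_weight m) n / n%:R.
Proof.
move=> mS n0; rewrite -entropy_symbol.
exact: (entropy_rate_le m (measurable_shiftz 1) (@simple_symbol) n0).
Qed.

Lemma symbol_rate_cvg m : preserves m (shiftz 1) ->
  word_entropy (word_weight m) n / n%:R @[n --> \oo] --> symbol_rate m.
Proof.
move=> mS; rewrite (_ : (fun n => _) = fun n => entropy m (names (shiftz 1) symbol n) / n%:R).
  exact: (entropy_rate_cvg (measurable_shiftz 1) mS (@simple_symbol)).
by apply/funext => n; rewrite entropy_symbol.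
Qed.

Lemma symbol_rate_le2 m : preserves m (shiftz 1) -> symbol_rate m <= 2.
Proof.
move=> mS; apply: le_trans (symbol_rate_le mS (ltn0Sn 0)) _.
rewrite divr1 -entropy_symbol.
by have := entropy_le_card m (names (shiftz 1) symbol 1); rewrite card_ffun card_bool card_ord.
Qed.

Lemma golden_of_weight p : weight p -> p [:: true; true] = 0 ->
  p (nseq n false) @[n --> \oo] --> 0 ->
  exists m : probability Omega R, golden m /\ word_weight m = p.
Proof.
move=> hp p11 p0; have [m [mS hm]] := weight_measure hp.
exists m; split; last first.
  apply/funext => v; have [u <-] := mem_block_word (erefl (size v)).
  by rewrite -word_weight_block hm.
split => //.
- have -> : [set w : Omega | w 0 && w 1] = (block 0 2 : Omega -> _) @^-1` [set [ffun=> true]].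
    apply/seteqP; split=> w /=.
      move=> /andP[w0 w1]; apply/ffunP => -[[|[|//]] hi]; by rewrite !ffunE.
    move=> /ffunP h; have := h ord0; have := h (lift ord0 ord0); rewrite !ffunE.
    by rewrite !add0r => -> ->.
  rewrite prE; last exact: simple_block.
  have -> : pr m ((block 0 2 : Omega -> _) @^-1` [set [ffun=> true]]) = p [:: true; true].
    have := hm 0 2%N [ffun=> true]; rewrite /dist => ->; congr p.
    apply: (@eq_from_nth _ false); rewrite size_block_word// => i hi.
    rewrite (nth_block_word _ (Ordinal hi)) ffunE.
    by case: i hi => [|[|]].
  by rewrite p11.
- rewrite prE; last exact: measurable_zero.
  congr EFin; apply/eqP; rewrite eq_le pr_ge0 andbT.
  apply: (ler_cvg_to (cvg_cst _) p0); near=> n.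
  rewrite -block_word0 -(hm 0 n); apply: pr_le; [exact: measurable_zero|exact: simple_block|].
  by move=> w /= h; apply/ffunP => i; rewrite !ffunE h.
Unshelve. all: by end_near.
Qed.

Lemma golden_weight11 m : golden m -> word_weight m [:: true; true] = 0.
Proof.
move=> [mS h _]; rewrite /word_weight /pr.
have -> : [set w : Omega | forall i, (i < size [:: true; true])%N -> w i%:Z = nth false [:: true; true] i] =
   [set w : Omega | w 0 && w 1].
  apply/seteqP; split=> w /=.
    by move=> h'; rewrite (h' 0%N)// (h' 1%N).
  by move=> /andP[w0 w1] [|[|]].
by rewrite h.
Qed.

(* The Markov chain with 0 -> 0, 0 -> 1 equally likely and 1 -> 0. *)
Fixpoint markov_tail (a : bool) (v : seq bool) : R :=
  if v is b :: v' then
    (if a then (if b then 0 else 1) else 2^-1) * markov_tail b v'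
  else 1.

(** The initial law 2/3, 1/3 is the stationary one, which makes [weight_cons] hold. *)
Definition markov (v : seq bool) : R :=
  if v is a :: v' then (if a then 3^-1 else 2 / 3) * markov_tail a v' else 1.

Lemma markov_tail_ge0 a v : 0 <= markov_tail a v.
Proof. by elim: v a => [|b v IH] a //=; rewrite mulr_ge0//; case: a; case: b => //=; lra. Qed.

(** A factor 1/2 is paid on leaving each 0, and a 1 is always followed by a 0, so at least every
    other step pays. The term [~~ a] records whether the first step pays already. *)
Lemma markov_tail_le a v : markov_tail a v <= 2^-1 ^+ ((size v + ~~ a)./2).
Proof.
elim: v a => [|b v IH] a /=; first by case: a => //=; rewrite expr0.
have := IH b; have := markov_tail_ge0 b v; case: a; case: b => /=; rewrite ?addn0 ?addn1 ?mul0r ?mul1r.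
- by move=> *; rewrite exprn_ge0.
- by [].
- by move=> h1 h2; rewrite /= exprS ler_pM2l.
- move=> h1 h2; rewrite exprS ler_pM2l//; apply: le_trans h2 _.
  by apply: ler_wiXn2l; [lra|lra|exact: half_leq].
Qed.

Lemma weight_markov : weight markov.
Proof.
have tr a v : markov_tail a v = markov_tail a (rcons v false) + markov_tail a (rcons v true).
  elim: v a => [|b v IH] a /=; first by case: a => /=; lra.
  by rewrite {1}IH mulrDr.
split.
- by case=> [|a v] //=; rewrite mulr_ge0 ?markov_tail_ge0//; case: a; lra.
- by [].
- by case=> [|a v] /=; [lra|rewrite {1}tr mulrDr].
- case=> [|a v] /=; first lra.
  by case: a => /=; lra.
Qed.

Lemma markov_le v : markov v <= 2^-1 ^+ (size v).-1./2.
Proof.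
case: v => [|a v] /=; first by rewrite expr0.
have h := markov_tail_le a v; have h0 := markov_tail_ge0 a v.
apply: (@le_trans _ _ (markov_tail a v)).
  by rewrite ler_piMl//; case: a {h h0}; lra.
apply: le_trans h _; apply: ler_wiXn2l; [lra|lra|].
by apply: half_leq; rewrite leq_addr.
Qed.

Lemma golden_markov : exists m : probability Omega R, golden m /\ word_weight m = markov.
Proof.
apply: golden_of_weight; first exact: weight_markov.
- by rewrite /= mul0r mulr0.
- apply: (@squeeze_cvgr _ _ _ _ (fun=> 0) (fun n => 2 * 2^-1 ^+ n)); last 2 first.
  + exact: cvg_cst.
  + rewrite -[X in _ --> X](mulr0 (2 : R)); apply: cvgM; first exact: cvg_cst.
    by apply: cvg_expr; rewrite ger0_norm// invf_lt1// ltr1n.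
  have bound n : markov (nseq n.+1 false) <= 2 * 2^-1 ^+ n.+1.
    have -> : markov (nseq n.+1 false) = 2 / 3 * 2^-1 ^+ n.
      rewrite /=; congr (_ * _).
      by elim: n => [|n IH] /=; [rewrite expr0|rewrite IH exprS].
    rewrite exprS mulrA divff// mul1r ler_piMl ?exprn_ge0//; lra.
  near=> n; rewrite (weight_ge0 weight_markov)/=.
  have n0 : (0 < n)%N by near: n; exact: nbhs_infty_gt.
  by rewrite -(prednK n0); exact: bound.
Unshelve. all: by end_near.
Qed.

(** Words of length [n] have weight at most [2^-1] to the power [(n - 1) / 2], rounded down, which
    is at least [n / 4] for [n >= 4]; hence the lower bound [ln 2 / 4]. *)
Lemma symbol_rate_markov m : golden m -> word_weight m = markov -> 0 < symbol_rate m.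
Proof.
move=> [mS _ _] hm.
have c0 : 0 < ln 2 :> R by rewrite ln_gt0// ltr1n.
apply: (@lt_le_trans _ _ (ln 2 / 4)); first by rewrite divr_gt0.
apply: (ler_cvg_to (cvg_cst (ln 2 / 4)) (symbol_rate_cvg mS)).
near=> n; rewrite hm.
have n4 : (4 <= n)%N by near: n; exact: nbhs_infty_ge.
have nR : 0 < n%:R :> R by rewrite ltr0n; lia.
rewrite ler_pdivlMr//.
apply: (@le_trans _ _ (\sum_(v : {ffun 'I_n -> bool}) markov (block_word v) * (ln 2 *+ n.-1./2))).
  rewrite -mulr_suml sum_weight ?mul1r; last exact: weight_markov.
  rewrite -[_ *+ n.-1./2]mulr_natr -mulrA ler_pM2l// ler_pdivrMl//.
  by rewrite -[4]/(4%:R) -natrM ler_nat -divn2; lia.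
apply: ler_sum => v _; rewrite /negxlnx.
have := markov_le (block_word v); rewrite size_block_word => hv.
have := weight_ge0 weight_markov (block_word v); rewrite le_eqVlt => /orP[/eqP <-|p0].
  by rewrite !mul0r oppr0.
rewrite -mulrN ler_pM2l// lerNr; apply: le_trans (_ : ln (2^-1 ^+ n.-1./2) <= _).
  by rewrite ler_ln ?posrE ?exprn_gt0.
by rewrite lnXn// lnV ?posrE// mulNrn.
Unshelve. all: by end_near.
Qed.

End word_weights.

(** * Attainment of the supremum *)

Section symbolic_maximizer.
Context {R : realType}.
Variables (sigma : R).
Hypothesis hsigma : 0 < sigma < 1 / 3.
Implicit Types (m : probability Omega R) (p : seq bool -> R).

Lemma exponent_ge m : golden m -> - jac_bound sigma <= exponent sigma m.
Proof.
move=> hm; rewrite -[leLHS](expect_cst m); apply: expect_le.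
- exact: intg_cst.
- exact: intg_jac.
- apply: nearW => w; have := jac_le_bound hsigma w.
  by rewrite ler_norml => /andP[].
Qed.

Definition slope m : R := symbol_rate m / (1 - exponent sigma m).

Definition t_crit : R := sup [set slope m | m in golden].

Let den_ge1 m : golden m -> 1 <= 1 - exponent sigma m.
Proof. by move=> hm; have := exponent_lt0 hsigma hm; lra. Qed.

Let den_gt0 m : golden m -> 0 < 1 - exponent sigma m.
Proof. by move=> /den_ge1; lra. Qed.

Let has_sup_slope : has_sup [set slope m | m in golden].
Proof.
have [m0 [g0 _]] := @golden_markov R.
split; first by exists (slope m0), m0.
exists 2 => _ [m hm <-]; rewrite ler_pdivrMr ?den_gt0//.
have [mS _ _] := hm; apply: le_trans (symbol_rate_le2 mS) _.
by rewrite ler_peMr// den_ge1.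
Qed.

Lemma symbol_rate_le_t_crit m : golden m ->
  symbol_rate m <= t_crit * (1 - exponent sigma m).
Proof.
move=> hm; rewrite -ler_pdivrMr ?den_gt0//; apply: sup_upper_bound => //.
by exists m.
Qed.

Lemma t_crit_gt0 : 0 < t_crit.
Proof.
have [m [hm e]] := @golden_markov R.
have := symbol_rate_le_t_crit hm; have := symbol_rate_markov hm e => h1 h2.
by rewrite -(pmulr_lgt0 _ (den_gt0 hm)); exact: lt_le_trans h2.
Qed.

Section cluster_weight.
Variable m_ : nat -> probability Omega R.
Hypothesis hm_ : forall n, golden (m_ n).
Variable U : set_system nat.
Hypothesis FU : UltraFilter U.

Let PU : ProperFilter U := @ultra_proper _ U FU.

(** An ultrafilter makes all word probabilities converge at once, by compactness of [[0, 1]], with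
    no diagonal extraction. *)
Lemma word_weight_cluster : exists p, forall v,
  word_weight (m_ n) v @[n --> U] --> p v.
Proof.
suff /choice[p hp] : forall v, exists l : R, word_weight (m_ n) v @[n --> U] --> l by exists p.
move=> v; have := @segment_compact R 0 1; rewrite compact_ultra.
pose f n := word_weight (m_ n) v.
have PF : ProperFilter (f @ U) by exact: fmap_proper_filter.
have UF : UltraFilter (f @ U).
  split=> // G PG sub; apply/seteqP; split=> A; last exact: sub.
  move=> GA; have [//|nA] := in_ultra_setVsetC (f @^-1` A) FU.
  have /sub GnA : (f @ U) (~` A) by [].
  have FG : Filter G by exact: filter_filter.
  have := @filterI _ G FG _ _ GA GnA; rewrite setICr.
  by move=> h; case: (@filter_not_empty _ G PG h).
move=> /(_ _ UF)[]; last by move=> l [_ hl]; exists l.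
apply: nearW => n; rewrite /= in_itv/= pr_ge0 pr_le1//; exact: measurable_word.
Qed.

Variable p : seq bool -> R.
Hypothesis hp : forall v, word_weight (m_ n) v @[n --> U] --> p v.

Let wp n : weight (word_weight (m_ n)).
Proof. by have [mS _ _] := hm_ n; exact: weight_word_weight. Qed.

Lemma weight_limit : weight p.
Proof.
split.
- move=> v; apply: (ler_cvg_to (cvg_cst (0 : R)) (@hp v)).
  by apply: nearW => n; exact: weight_ge0 (wp n) v.
- apply: (cvg_unique _ (@hp [::])) => //.
  rewrite (_ : (fun n => _) = fun=> 1); first exact: cvg_cst.
  by apply/funext => n; exact: weight_nil (wp n).
- move=> v; apply: (cvg_unique _ (@hp v)) => //.
  rewrite (_ : (fun n => word_weight (m_ n) v) = fun n =>
    word_weight (m_ n) (rcons v false) + word_weight (m_ n) (rcons v true)).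
    by apply: cvgD; exact: hp.
  by apply/funext => n; exact: weight_rcons (wp n) v.
- move=> v; apply: (cvg_unique _ (@hp v)) => //.
  rewrite (_ : (fun n => word_weight (m_ n) v) = fun n =>
    word_weight (m_ n) (false :: v) + word_weight (m_ n) (true :: v)).
    by apply: cvgD; exact: hp.
  by apply/funext => n; exact: weight_cons (wp n) v.
Qed.

Lemma limit11 : p [:: true; true] = 0.
Proof.
apply: (cvg_unique _ (@hp _)) => //.
rewrite (_ : (fun n => _) = fun=> 0); first exact: cvg_cst.
by apply/funext => n; exact: golden_weight11.
Qed.

Lemma word_entropy_limit k :
  word_entropy (word_weight (m_ n)) k @[n --> U] --> word_entropy p k.
Proof.
apply: cvg_sumr => v.
apply: (@cvg_comp _ _ _ (fun n => word_weight (m_ n) (block_word v)) (@negxlnx R)); last exact: continuous_negxlnx.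
exact: hp.
Qed.

End cluster_weight.

Lemma zero_weight_noninc p n : weight p -> p (nseq n.+1 false) <= p (nseq n false).
Proof.
move=> hp; rewrite [leRHS](weight_cons hp) /= lerDl; exact: weight_ge0.
Qed.

(** The mass that the measure of weight [p] gives to the zero sequence, as the decreasing limit of
    its cylinders. *)
Definition zero_mass p : R := inf [set p (nseq n false) | n in setT].

Lemma zero_mass_cvg p : weight p -> p (nseq n false) @[n --> \oo] --> zero_mass p.
Proof.
move=> hp; apply: nonincreasing_cvgn.
  by apply/nonincreasing_seqP => n; exact: zero_weight_noninc.
by exists 0 => _ [n _ <-]; exact: weight_ge0.
Qed.

Lemma zero_mass_le p n : weight p -> zero_mass p <= p (nseq n false).
Proof.
move=> hp; apply: ge_inf; last by exists n.
by exists 0 => _ [k _ <-]; exact: weight_ge0.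
Qed.

Lemma zero_mass_ge0 p : weight p -> 0 <= zero_mass p.
Proof.
by move=> hp; apply: lb_le_inf => [|_ [n _ <-]]; [exists (p (nseq 0 false)), 0%N|exact: weight_ge0].
Qed.

Definition psi_code n : {ffun 'I_n.+1 -> bool} -> R := projT1 (cid (psi__expect hsigma n)).

Lemma psi_code_le0 n v : @psi_code n v <= 0.
Proof. by rewrite /psi_code; case: cid => G []. Qed.

Lemma psi_codeE n w : psi_ sigma n w = psi_code (block (- n%:Z) n.+1 w).
Proof. by rewrite /psi_code; case: cid => G []. Qed.

(** [psi_] vanishes when the present symbol is 0, so mass on the zero sequence does not contribute
    to the cylinder averages. *)
Lemma psi_code0 n : psi_code (zero_word n.+1) = 0.
Proof.
have -> : zero_word n.+1 = block (- n%:Z) n.+1 (fun=> false).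
  by apply/ffunP => i; rewrite !ffunE.
by rewrite -psi_codeE.
Qed.

Definition psi_sum p n : R := \sum_v @psi_code n v * p (block_word v).

Lemma expect_psi_ m n : golden m -> expect m (psi_ sigma n) = psi_sum (word_weight m) n.
Proof.
move=> [mS _ _].
have [_ e] := expect_simple m (@psi_code n) (@simple_block (- n%:Z) n.+1).
rewrite (_ : psi_ sigma n = @psi_code n \o block (- n%:Z) n.+1); last first.
  by apply/funext => w; exact: psi_codeE.
by rewrite e; apply: eq_bigr => v _; rewrite word_weight_block_shift.
Qed.

(** The weight of the measure conditioned on the complement of the zero sequence. *)
Definition unzero p (v : seq bool) : R :=
  (p v - (if v == nseq (size v) false then zero_mass p else 0)) / (1 - zero_mass p).

Lemma weight_unzero p : weight p -> zero_mass p < 1 -> weight (unzero p).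
Proof.
move=> hp a1; have b0 : 0 < 1 - zero_mass p by rewrite subr_gt0.
split.
- move=> v; rewrite /unzero divr_ge0 ?(ltW b0)// subr_ge0.
  case: eqP => [->|_]; last exact: weight_ge0.
  exact: zero_mass_le.
- by rewrite /unzero /= (weight_nil hp) divff// gt_eqF.
- move=> v; rewrite /unzero -mulrDl; congr (_ / _).
  rewrite !size_rcons (weight_rcons hp).
  have e c : (rcons v c == nseq (size v).+1 false) = (v == nseq (size v) false) && ~~ c.
    by rewrite -addn1 nseqD cats1 eqseq_rcons; case: c.
  by rewrite !e andbT andbF; case: ifP => _; ring.
- move=> v; rewrite /unzero -mulrDl; congr (_ / _).
  rewrite (weight_cons hp) /= !eqseq_cons /=.
  by case: ifP => _; ring.
Qed.

Lemma unzeroE p v : zero_mass p < 1 -> p v =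
  (if v == nseq (size v) false then zero_mass p else 0) + (1 - zero_mass p) * unzero p v.
Proof.
move=> a1; rewrite /unzero mulrC divfK; last by rewrite gt_eqF// subr_gt0.
by rewrite addrC subrK.
Qed.

Lemma block_word_eq0 n (v : {ffun 'I_n -> bool}) :
  (block_word v == nseq (size (block_word v)) false) = (v == zero_word n).
Proof.
rewrite size_block_word -block_word0; apply/eqP/eqP => [/block_word_inj//|->//].
Qed.

(** The atom is concentrated on one word of each length, so it adds at most [negxlnx a <= 1], and
    normalization at most [negxlnx (1 - a) <= 1], whatever the length. *)
Lemma word_entropy_unzero p n : weight p -> zero_mass p < 1 ->
  word_entropy p n <= (1 - zero_mass p) * word_entropy (unzero p) n + 2.
Proof.
move=> hp a1; set a := zero_mass p in a1 *; have a0 : 0 <= a by exact: zero_mass_ge0.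
have b0 : 0 <= 1 - a by rewrite subr_ge0 ltW.
have hq := weight_unzero hp a1.
pose ind (v : {ffun 'I_n -> bool}) : R := if v == zero_word n then a else 0.
apply: (@le_trans _ _ (\sum_(v : {ffun 'I_n -> bool}) (negxlnx (ind v) +
   ((1 - a) * negxlnx (unzero p (block_word v)) + unzero p (block_word v) * negxlnx (1 - a))))).
  apply: ler_sum => v _; rewrite {1}(unzeroE (block_word v) a1) block_word_eq0 -/a -/(ind v).
  have q0 := weight_ge0 hq (block_word v).
  rewrite -negxlnxM// negxlnx_addl//; last exact: mulr_ge0.
  by rewrite /ind; case: ifP.
rewrite big_split/= big_split/= -mulr_sumr -mulr_suml sum_weight// mul1r.
rewrite (bigD1 (zero_word n))//= big1 => [|v vn].
  rewrite /ind eqxx; have := negxlnx_le a0; have := negxlnx_le b0; rewrite -/(word_entropy _ _); lra.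
by rewrite /ind (negPf vn) negxlnx0.
Qed.

Lemma psi_sum_unzero p n : zero_mass p < 1 ->
  psi_sum p n = (1 - zero_mass p) * psi_sum (unzero p) n.
Proof.
move=> a1; rewrite /psi_sum mulr_sumr; apply: eq_bigr => v _.
rewrite {1}(unzeroE _ a1) block_word_eq0 mulrDr mulrCA; case: eqP => [->|_].
  by rewrite psi_code0 !mul0r mulr0 addr0.
by rewrite mulr0 add0r.
Qed.

Lemma t_crit_attained : exists m, golden m /\
  symbol_rate m = t_crit * (1 - exponent sigma m).
Proof.
have /choice[m_ hm_] n : exists m, golden m /\ t_crit - harmonic n < slope m.
  have [_ [m hm <-] h] := sup_adherent (harmonic_gt0 n) has_sup_slope.
  by exists m.
have gm n : golden (m_ n) by case: (hm_ n).
have [U [FU sU]] := ultraFilterLemma eventually_filter.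
have PU : ProperFilter U by exact: ultra_proper.
have [p hp] := word_weight_cluster m_ FU.
have wp := weight_limit gm FU (@hp).
pose K := 1 + jac_bound sigma.
have K0 : 0 <= K by rewrite /K; have := jac_bound_ge1 hsigma; lra.
have t0 := t_crit_gt0.
have hU : harmonic n @[n --> U] --> (0 : R).
  apply: cvg_trans (@cvg_harmonic R) => A /=; exact: sU.
(* Near-maximality of [m_ n], multiplied out, is first weakened to finite words: the [k]-block
   average above the entropy, [psi_ j] above the exponent. Then the limit is taken along [U]; [K]
   bounds [1 - exponent], so the error [harmonic n] disappears. *)
have key k j : (0 < k)%N -> t_crit <= word_entropy p k / k%:R + t_crit * psi_sum p j.
  move=> k0.
  have c1 : t_crit - harmonic n * K @[n --> U] --> t_crit.
    have {2}-> : t_crit = t_crit - 0 * K by rewrite mul0r subr0.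
    by apply: cvgB; [exact: cvg_cst|apply: cvgM => //; exact: cvg_cst].
  have c2 : word_entropy (word_weight (m_ n)) k / k%:R +
      t_crit * psi_sum (word_weight (m_ n)) j @[n --> U] -->
      word_entropy p k / k%:R + t_crit * psi_sum p j.
    apply: cvgD.
      by apply: cvgM; [exact: word_entropy_limit|exact: cvg_cst].
    apply: cvgM; first exact: cvg_cst.
    by apply: cvg_sumr => v; apply: cvgM; [exact: cvg_cst|exact: hp].
  apply: (ler_cvg_to c1 c2); apply: nearW => n.
  have [gn hn] := hm_ n; have [mS _ _] := gn.
  have h1 := symbol_rate_le mS k0.
  have h2 := exponent_le_psi_ hsigma gn j; rewrite expect_psi_// in h2.
  have h3 := exponent_ge gn.
  have d0 := den_gt0 gn.
  move: hn; rewrite /slope ltr_pdivlMr// => hn.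
  have h4 : t_crit * exponent sigma (m_ n) <= t_crit * psi_sum (word_weight (m_ n)) j.
    by rewrite ler_pM2l.
  have h5 : harmonic n * (1 - exponent sigma (m_ n)) <= harmonic n * K.
    by rewrite ler_pM2l ?harmonic_gt0// /K; lra.
  move: hn; rewrite mulrBl mulrBr mulr1 => hn; lra.
have a0 := zero_mass_ge0 wp.
(* If all mass escaped to the zero sequence, the entropy of one symbol would be 0 and [key] would
   give [t_crit <= t_crit * psi_sum p 0 <= 0]. *)
have a1 : zero_mass p < 1.
  rewrite ltNge; apply/negP => a1.
  have h := key 1%N 0%N isT.
  have p1 : p [:: false] = 1.
    apply/eqP; rewrite eq_le (le_trans a1 (@zero_mass_le _ 1 wp)) andbT.
    by rewrite -(weight_nil wp) (weight_cons wp [::]) lerDl; exact: weight_ge0.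
  have p2 : p [:: true] = 0.
    by have := weight_cons wp [::]; rewrite (weight_nil wp) p1; lra.
  have : word_entropy p 1 = 0.
    apply: big1 => v _.
    have -> : block_word v = [:: v ord0].
      apply: (@eq_from_nth _ false); rewrite size_block_word// => -[|//] hi.
      by rewrite (nth_block_word _ (Ordinal hi)); congr (v _); apply: val_inj.
    by case: (v ord0); rewrite ?p1 ?p2 ?negxlnx0 ?negxlnx1.
  move=> e; move: h; rewrite e mul0r add0r => h.
  have : psi_sum p 0 <= 0.
    by apply: sumr_le0 => v _; rewrite mulr_le0_ge0 ?psi_code_le0//; exact: weight_ge0.
  by rewrite -(pmulr_rle0 _ t0); lra.
have wq := weight_unzero wp a1.
have b0 : 0 < 1 - zero_mass p by rewrite subr_gt0.
have q11 : unzero p [:: true; true] = 0.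
  by rewrite /unzero /= (limit11 gm FU (@hp)) subr0 mul0r.
have q0 : unzero p (nseq n false) @[n --> \oo] --> 0.
  rewrite (_ : (fun n => _) = fun n => (p (nseq n false) - zero_mass p) / (1 - zero_mass p)).
    have -> : 0 = (zero_mass p - zero_mass p) / (1 - zero_mass p) :> R by rewrite subrr mul0r.
    apply: cvgM; last exact: cvg_cst.
    by apply: cvgB; [exact: zero_mass_cvg|exact: cvg_cst].
  by apply/funext => n; rewrite /unzero size_nseq eqxx.
have [m [hm em]] := golden_of_weight wq q11 q0.
have [mS _ _] := hm.
exists m; split => //.
have h1 := symbol_rate_le_t_crit hm.
(* Since [h + t l <= t] with [t = t_crit], the factor [1 - zero_mass p <= 1] on the right leaves no
   room: [h + t l] must equal [t]. *)
suff h2 : t_crit <= (1 - zero_mass p) * (symbol_rate m + t_crit * exponent sigma m).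
  have h3 : symbol_rate m + t_crit * exponent sigma m <= t_crit by lra.
  have h4 : (1 - zero_mass p) * (symbol_rate m + t_crit * exponent sigma m) <=
      symbol_rate m + t_crit * exponent sigma m.
    by rewrite ler_piMl; [| |lra]; nra.
  lra.
have key2 k j : (0 < k)%N -> t_crit <= (1 - zero_mass p) *
    (word_entropy (word_weight m) k / k%:R + t_crit * psi_sum (word_weight m) j) + 2 * k%:R^-1.
  move=> k0; apply: le_trans (key k j k0) _; rewrite em psi_sum_unzero//.
  have := word_entropy_unzero k wp a1; have kR : 0 < k%:R^-1 :> R by rewrite invr_gt0 ltr0n.
  rewrite -(ler_pM2r kR); lra.
have key3 j : t_crit <= (1 - zero_mass p) * (symbol_rate m + t_crit * psi_sum (word_weight m) j).
  rewrite -[leRHS]addr0; apply: (ler_cvg_to (cvg_cst t_crit) (_ :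
    (1 - zero_mass p) * (word_entropy (word_weight m) k / k%:R + t_crit * psi_sum (word_weight m) j)
      + 2 * k%:R^-1 @[k --> \oo] --> _)).
    apply: cvgD.
      apply: cvgM; first exact: cvg_cst.
      by apply: cvgD; [exact: symbol_rate_cvg|exact: cvg_cst].
    rewrite -[X in _ --> X](mulr0 (2 : R)); apply: cvgM; first exact: cvg_cst.
    apply/gtr0_cvgV0; last exact: cvgr_idn.
    by near=> k; rewrite ltr0n; near: k; exact: nbhs_infty_gt.
  by near=> k; apply: key2; near: k; exact: nbhs_infty_gt.
apply: (ler_cvg_to (cvg_cst t_crit) (_ :
  (1 - zero_mass p) * (symbol_rate m + t_crit * psi_sum (word_weight m) j) @[j --> \oo] --> _)).
  apply: cvgM; first exact: cvg_cst.
  apply: cvgD; first exact: cvg_cst.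
  apply: cvgM; first exact: cvg_cst.
  have -> : psi_sum (word_weight m) = fun j => expect m (psi_ sigma j).
    by apply/funext => j; rewrite expect_psi_.
  exact: psi__expect_cvg.
by apply: nearW => j; exact: key3.
Unshelve. all: by end_near.
Qed.

End symbolic_maximizer.

(** * The horseshoe *)

Lemma measurable_inv (R : realType) : measurable_fun setT (fun x : R => x^-1).
Proof.
rewrite (_ : (fun x => _) = fun x : R => if 0 < x then expR (- ln x) else
    if x < 0 then - expR (- ln (- x)) else 0); last first.
  apply/funext => x; case: ltgtP => h.
  - by rewrite expRN lnK.
  - by rewrite expRN lnK ?posrE ?oppr_gt0// invrN opprK.
  - by rewrite -h invr0.
have ml (u : R -> R) : measurable_fun setT u -> measurable_fun setT (fun x => expR (- ln (u x))).
  move=> mu; apply: measurableT_comp; first exact: measurable_expR.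
  apply: measurableT_comp => //; apply: measurableT_comp mu; exact: measurable_ln.
apply: measurable_fun_ifT.
- by apply: measurable_fun_ltr.
- exact: ml.
- apply: measurable_fun_ifT; last exact: measurable_cst.
    by apply: measurable_fun_ltr.
  apply: measurableT_comp => //; apply: ml.
  exact: oppr_measurable.
Qed.

Lemma measurable_to_Omega d (T : measurableType d) (f : T -> Omega) :
  (forall k, measurable [set x | f x k]) -> measurable_fun setT f.
Proof.
move=> hf; apply: (@measurability _ _ T Omega setT _ cylinders) => //.
move=> _ [A [N [b ->]] <-]; rewrite setTI.
apply: (@measurable_simple_pred _ _ _ (block (- N%:Z) N.*2 \o f)) => v.
rewrite (_ : _ @^-1` _ = \bigcap_(i in [set: 'I_N.*2])
    (if v i then [set x | f x (- N%:Z + i%:Z)] else ~` [set x | f x (- N%:Z + i%:Z)])).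
  apply: fin_bigcap_measurable => // i _.
  by case: (v i) => //; exact: measurableC.
apply/seteqP; split=> x /=.
  by move=> <- i _; rewrite ffunE; case: ifP => //= /negbT/negP.
move=> h; apply/ffunP => i; rewrite ffunE; have := h i Logic.I.
by case: (v i) => //= /negP/negbTE.
Qed.

(** * Conjugacy with the golden mean shift *)

Section horseshoe_dynamics.
Context {R : realType}.
Variables (lambda0 beta0 lambda1 sigma beta1 : R).
Hypotheses (hlambda0 : 0 < lambda0 < 1 / 3) (hbeta0 : 6 < beta0)
  (hlambda1 : 0 < lambda1 < 1 / 3) (hsigma : 0 < sigma < 1 / 3)
  (hbeta1 : 3 < beta1 < 4).

Local Notation F := (horseshoe lambda0 beta0 lambda1 sigma beta1).
Local Notation T3 := (R * R * R)%type.
Local Notation slabs := (slab0 R `|` slab1 R).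

(** The images of the two slabs are told apart by [x]: the first has [x < 1 / 3], the second
    [x > 3 / 4 - 1 / 3 = 5 / 12]. *)
Definition horseshoe_inv (X : T3) : T3 :=
  let: (x, y, z) := X in
  if x <= 1 / 3 then (x / lambda0, timeone_inv y, z / beta0)
  else ((3 / 4 - x) / lambda1, 1 - y / sigma, z / beta1 + 5 / 6).

Local Notation G := horseshoe_inv.

Definition upper (X : T3) : bool := ~~ (X.2 <= 1 / 6).

Lemma slabsP X : slabs X -> [/\ 0 <= X.1.1 <= 1, 0 <= X.1.2 <= 1, 0 <= X.2 <= 1 &
  if upper X then 5 / 6 <= X.2 else X.2 <= 1 / 6].
Proof.
by rewrite /upper; move=> [[h1 h2 h3]|[h1 h2 h3]]; split=> //; try lra; case: leP => //=; lra.
Qed.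

Lemma horseshoe_branch X : slabs X -> (F X).1.1 = branch_x lambda0 lambda1 (upper X) X.1.1 /\
  (F X).1.2 = branch_y sigma (upper X) X.1.2 /\ X.2 = branch_z beta0 beta1 (upper X) (F X).2.
Proof.
have b0 : 0 < beta0 by move: hbeta0; lra.
have b1 : 0 < beta1 by move: hbeta1; lra.
move: X => [[x y] z] hX; rewrite /upper /horseshoe /=; case: ifP => _ /=; split=> //; split=> //.
  by rewrite /branch_z [beta0 * _]mulrC mulfK// gt_eqF.
by rewrite /branch_z [beta1 * _]mulrC mulfK ?subrK// gt_eqF.
Qed.

Lemma horseshoeK X : slabs X -> G (F X) = X.
Proof.
have l0 : 0 < lambda0 by move: hlambda0; lra.
have l1 : 0 < lambda1 by move: hlambda1; lra.
have b0 : 0 < beta0 by move: hbeta0; lra.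
have b1 : 0 < beta1 by move: hbeta1; lra.
have s0 : 0 < sigma by move: hsigma; lra.
move: X => [[x y] z] /slabsP[/= hx hy hz _]; rewrite /horseshoe; case: ifP => _ /=.
  have -> : lambda0 * x <= 1 / 3.
    by have := mul_itv (ltW l0) hx; move: hlambda0; lra.
  rewrite timeoneK// [lambda0 * _]mulrC [beta0 * _]mulrC mulfK ?gt_eqF//.
  by rewrite mulfK// gt_eqF.
have -> : (3 / 4 - lambda1 * x <= 1 / 3) = false.
  by apply/negbTE; rewrite -ltNge; have := mul_itv (ltW l1) hx; move: hlambda1; lra.
congr (_, _, _).
- by rewrite opprB addrC subrK [lambda1 * _]mulrC mulfK// gt_eqF.
- by rewrite [sigma * _]mulrC mulfK ?gt_eqF//; ring.
- by rewrite [beta1 * _]mulrC mulfK ?subrK// gt_eqF.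
Qed.

Lemma horseshoe_invK X : slabs X -> F (G X) = X.
Proof.
have l0 : 0 < lambda0 by move: hlambda0; lra.
have l1 : 0 < lambda1 by move: hlambda1; lra.
have b0 : 0 < beta0 by move: hbeta0; lra.
have b1 : 0 < beta1 by move: hbeta1; lra.
have s0 : 0 < sigma by move: hsigma; lra.
move: X => [[x y] z] /slabsP[/= hx hy hz _]; rewrite /horseshoe; case: ifP => _ /=.
  have -> : z / beta0 <= 1 / 6.
    by rewrite ler_pdivrMr//; move: hbeta0; lra.
  rewrite timeone_invK// [lambda0 * _]mulrC [beta0 * _]mulrC divfK ?gt_eqF//.
  by rewrite divfK// gt_eqF.
have zb : 0 <= z / beta1 by rewrite divr_ge0 ?(ltW b1)//; lra.
have -> : (z / beta1 + 5 / 6 <= 1 / 6) = false.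
  by apply/negbTE; rewrite -ltNge; lra.
congr (_, _, _).
- by rewrite [lambda1 * _]mulrC divfK ?gt_eqF//; ring.
- by rewrite opprB addrC subrK [sigma * _]mulrC divfK// gt_eqF.
- by rewrite addrK [beta1 * _]mulrC divfK// gt_eqF.
Qed.

Definition full_orbit (X : T3) (n : int) : T3 :=
  match n with Posz k => iter k F X | Negz k => iter k.+1 G X end.

(** Injectivity on the slabs identifies the backward half of an orbit with iterates of the explicit
    inverse. This leaves countably many conditions on [X], hence measurability. *)
Lemma maximal_invariantE : maximal_invariant F =
  [set X | forall n, slabs (iter n F X) /\ slabs (iter n G X)].
Proof.
apply/seteqP; split=> X /=.
  move=> [u [u0 hu]] n; split.
    have -> : iter n F X = u n%:Z.
      elim: n => [|n IH] /=; first by rewrite u0.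
      by rewrite IH (hu n).2; congr u; lia.
    by case: (hu n%:Z).
  have -> : iter n G X = u (- n%:Z).
    elim: n => [|n IH] /=; first by rewrite u0.
    rewrite IH; have [h1 h2] := hu (- n.+1%:Z).
    have e : - n.+1%:Z + 1 = - n%:Z by lia.
    by rewrite -e -h2 horseshoeK.
  by case: (hu (- n%:Z)).
move=> h; exists (full_orbit X); split=> // -[n|n].
  split; first by case: (h n).
  by rewrite -PoszD addn1.
split; first by case: (h n.+1).
have -> : Negz n + 1 = - n%:Z by lia.
rewrite /full_orbit -/(full_orbit _ _) /= horseshoe_invK; last by case: (h n).
by case: n.
Qed.

Lemma full_orbitP X : maximal_invariant F X -> forall n,
  slabs (full_orbit X n) /\ F (full_orbit X n) = full_orbit X (n + 1).
Proof.
rewrite maximal_invariantE => h [n|n].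
  split; first by case: (h n).
  by rewrite -PoszD addn1.
split; first by case: (h n.+1).
have -> : Negz n + 1 = - n%:Z by lia.
rewrite /full_orbit /= horseshoe_invK; last by case: (h n).
by case: n.
Qed.

Definition itinerary (X : T3) : Omega := fun n => upper (full_orbit X n).

Lemma full_orbitF X n : maximal_invariant F X ->
  full_orbit (F X) n = full_orbit X (n + 1).
Proof.
move=> hX; case: n => n.
  by rewrite -PoszD addn1 /full_orbit -iterSr.
have -> : Negz n + 1 = - n%:Z by lia.
have [s0 _] := full_orbitP hX 0.
rewrite /full_orbit iterSr horseshoeK//.
by case: n.
Qed.

Lemma itineraryF X : maximal_invariant F X -> itinerary (F X) = shiftz 1 (itinerary X).
Proof. by move=> hX; apply/funext => n; rewrite /itinerary full_orbitF. Qed.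

Let code_x := coord_x lambda0 lambda1.
Let code_z := coord_z beta0 beta1.

Definition horseshoe_point (w : Omega) : T3 := (code_x w, yhigh sigma w, code_z w).

Lemma low_x w : low (branch_x lambda0 lambda1) id 0 1 (past w) = code_x w.
Proof.
exact: (@contraction_low_high R (branch_x lambda0 lambda1) id 0 1 ler01
  (branch_x_itv hlambda0 hlambda1) (branch_x_mono hlambda0 hlambda1) (past w)
  (branch_x_contr hlambda0 hlambda1)).
Qed.

Let le54 : (0 : R) <= 5 / 4. Proof. by rewrite divr_ge0. Qed.

Lemma low_z w : low (branch_z beta0 beta1) xpred0 0 (5 / 4) (future w) = code_z w.
Proof.
exact: (@contraction_low_high R (branch_z beta0 beta1) xpred0 0 (5 / 4) le54
  (branch_z_itv hbeta0 hbeta1) (branch_z_mono hbeta0 hbeta1) (future w)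
  (branch_z_contr hbeta0 hbeta1)).
Qed.

(** [x] and [z] come from uniform contractions and are determined; [y] is only enclosed, as the
    time-one map does not contract the interval. *)
Lemma itinerary_code X : maximal_invariant F X ->
  [/\ X.1.1 = code_x (itinerary X), X.2 = code_z (itinerary X) &
      ylow sigma (itinerary X) <= X.1.2 <= yhigh sigma (itinerary X)].
Proof.
move=> hX; have hu := full_orbitP hX; set u := full_orbit X in hu.
have e n : - n.+1%:Z + 1 = - n%:Z by lia.
have bk n := horseshoe_branch (hu (- n.+1%:Z)).1.
split.
- apply/eqP; rewrite eq_le andbC -{1}low_x.
  apply: (@orbit_ends R (branch_x lambda0 lambda1) id 0 1 ler01
    (branch_x_itv hlambda0 hlambda1) (branch_x_mono hlambda0 hlambda1)
    (past (itinerary X)) (fun n => (u (- n%:Z)).1.1)).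
    by move=> n; have [s _] := hu (- n%:Z); case: (slabsP s).
  by move=> n; have [<- _] := bk n; rewrite (hu _).2 e.
- apply/eqP; rewrite eq_le andbC -{1}low_z.
  apply: (@orbit_ends R (branch_z beta0 beta1) xpred0 0 (5 / 4) le54
    (branch_z_itv hbeta0 hbeta1) (branch_z_mono hbeta0 hbeta1)
    (future (itinerary X)) (fun n => (u n%:Z).2)).
    move=> n; have [s _] := hu n%:Z; have [_ _ + _] := slabsP s; lra.
  move=> n; have [s Fu] := hu n%:Z; have [_ [_ ->]] := horseshoe_branch s.
  by rewrite Fu; congr (branch_z _ _ _ (u _).2); lia.
- apply: (@orbit_ends R (branch_y sigma) id 0 1 ler01
    (branch_y_itv hsigma) (branch_y_mono hsigma)
    (past (itinerary X)) (fun n => (u (- n%:Z)).1.2)).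
    by move=> n; have [s _] := hu (- n%:Z); case: (slabsP s).
  by move=> n; have [_ [<- _]] := bk n; rewrite (hu _).2 e.
Qed.

Lemma code_itinerary X : maximal_invariant F X ->
  ylow sigma (itinerary X) = yhigh sigma (itinerary X) -> horseshoe_point (itinerary X) = X.
Proof.
move=> hX e; have [hx hz] := itinerary_code hX; rewrite e => hy.
have -> : horseshoe_point (itinerary X) = (X.1.1, X.1.2, X.2).
  by rewrite /horseshoe_point -hx -hz; congr (_, _, _); apply/eqP; rewrite eq_le.
by case: X {hX e hx hz hy} => [[]].
Qed.

Lemma regular_slabs w : regular sigma w -> slabs (horseshoe_point w) /\ upper (horseshoe_point w) = w 0.
Proof.
move=> [sp rec _].
have b0 : 0 < beta0 by move: hbeta0; lra.
have b1 : 0 < beta1 by move: hbeta1; lra.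
have ib0 : 0 < beta0^-1 < 1 / 6.
  by rewrite invr_gt0 b0/= -[1 / 6]invrK ltf_pV2 ?posrE ?invr_gt0//; move: hbeta0; lra.
have ib1 : 0 < beta1^-1 < 1 / 3.
  by rewrite invr_gt0 b1/= -[1 / 3]invrK ltf_pV2 ?posrE ?invr_gt0//; move: hbeta1; lra.
have hz v : 0 <= code_z v <= 5 / 4 by exact: coord_z_itv.
have zrec v := coord_z_shift hbeta0 hbeta1 v; rewrite -/code_z in zrec.
(* The a priori bound 5/4 is improved in stages: a symbol 0 gives [z <= 5 / 24]; then a 1, followed
   by 0 by sparseness, gives [z <= 5 / 72 + 5 / 6 <= 1]; with [z <= 1] known, a symbol 0 gives
   [z <= 1 / 6]. *)
have z0 (v : Omega) : v 0 = false -> 0 <= code_z v <= 5 / 24.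
  move=> v0; rewrite zrec v0 /branch_z.
  have i0 : 0 <= beta0^-1 by lra.
  by have := mul_itv i0 (hz (shiftz 1 v)); rewrite (mulrC (code_z _)); lra.
have z1 (v : Omega) : v 0 -> ~~ v 1 -> 5 / 6 <= code_z v <= 1.
  move=> v0 /negbTE v1; rewrite zrec v0 /branch_z.
  have i1 : 0 <= beta1^-1 by lra.
  have v1' : shiftz 1 v 0 = false by rewrite /shiftz add0r.
  by have := mul_itv i1 (z0 _ v1'); rewrite (mulrC (code_z _)); lra.
have z01 (v : Omega) : (v 0 -> ~~ v 1) -> 0 <= code_z v <= 1.
  move=> h; have [v0|/negbTE v0] := boolP (v 0); first by have := z1 _ v0 (h v0); lra.
  by have := z0 _ v0; lra.
have hx : 0 <= code_x w <= 1 by exact: coord_x_itv.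
have hy : 0 <= yhigh sigma w <= 1 by exact: yhigh_itv.
have spk k : w k -> ~~ w (k + 1).
  by move=> wk; have := sp k; rewrite wk.
case w0 : (w 0).
  have := z1 w w0 (spk 0 w0); rewrite /upper /= => hzw.
  by split; [right|apply/negP; lra].
have hzw : 0 <= code_z w <= 1 / 6.
  rewrite zrec w0 /branch_z.
  have i0 : 0 <= beta0^-1 by lra.
  have h1 : 0 <= code_z (shiftz 1 w) <= 1.
    apply: z01; rewrite /shiftz add0r => w1; exact: (spk 1).
  by have := mul_itv i0 h1; rewrite (mulrC (code_z _)); lra.
by split; [left|apply/negbTE; rewrite negbK; case/andP: hzw].
Qed.

Lemma code_shiftz w : regular sigma w -> F (horseshoe_point w) = horseshoe_point (shiftz 1 w).
Proof.
move=> rw; have [sw up] := regular_slabs rw.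
have [hx [hy hz]] := horseshoe_branch sw.
have [_ ey] := regular_y hsigma rw.
have ex := coord_x_shift hlambda0 hlambda1 w.
have b0 : 0 < beta0 by move: hbeta0; lra.
have b1 : 0 < beta1 by move: hbeta1; lra.
have ez := coord_z_shift hbeta0 hbeta1 w.
have -> : F (horseshoe_point w) = ((F (horseshoe_point w)).1.1, (F (horseshoe_point w)).1.2, (F (horseshoe_point w)).2).
  by case: (F (horseshoe_point w)) => [[]].
rewrite hx hy up; congr (_, _, _); rewrite /= /code_x ?ex ?ey//.
move: hz; rewrite up /= /code_z ez /branch_z; case: ifP => _.
  have n1 : beta1^-1 != 0 by rewrite invr_eq0 gt_eqF.
  by move=> /addIr/(mulIf n1).
have n0 : beta0^-1 != 0 by rewrite invr_eq0 gt_eqF.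
by move=> /(mulIf n0).
Qed.

Lemma regular_code w : regular sigma w -> maximal_invariant F (horseshoe_point w) /\
  itinerary (horseshoe_point w) = w.
Proof.
move=> rw; have hu : exists u : int -> T3, u 0 = horseshoe_point w /\
    forall n, slabs (u n) /\ F (u n) = u (n + 1).
  exists (fun n => horseshoe_point (shiftz n w)); split; first by rewrite shiftz0.
  move=> n; have rn := regular_shiftz n rw.
  split; first by case: (regular_slabs rn).
  by rewrite code_shiftz// shiftzD addrC.
split=> //; apply/funext => n; rewrite /itinerary.
have -> : full_orbit (horseshoe_point w) n = horseshoe_point (shiftz n w).
  case: n => n.
    elim: n => [|n IH] /=; first by rewrite shiftz0.
    rewrite [iter n F _](_ : _ = horseshoe_point (shiftz n%:Z w))// code_shiftz; last exact: regular_shiftz.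
    by rewrite shiftzD; congr (horseshoe_point (shiftz _ w)); lia.
  have hG k : iter k G (horseshoe_point w) = horseshoe_point (shiftz (- k%:Z) w).
    elim: k => [|k IH] /=; first by rewrite shiftz0.
    have rk := regular_shiftz (- k.+1%:Z) rw.
    rewrite IH (_ : shiftz (- k%:Z) w = shiftz 1 (shiftz (- k.+1%:Z) w)).
      by rewrite -code_shiftz// horseshoeK//; case: (regular_slabs rk).
    by rewrite shiftzD; congr (shiftz _ w); lia.
  by rewrite /full_orbit hG NegzE.
by have [_ ->] := regular_slabs (regular_shiftz n rw); rewrite /shiftz add0r.
Qed.

End horseshoe_dynamics.

Lemma timeone_gt (R : realType) (y : R) : 0 < y < 1 -> y < timeone y.
Proof.
move=> hy; have h : 0 <= y <= 1 by lra.
have c1 : expR (-1) < 1 :> R by rewrite expR_lt1; lra.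
rewrite /timeone ltr_pdivlMr; last exact: timeone_den_gt0.
have : 0 < y * (1 - y) * (1 - expR (-1)) by rewrite !mulr_gt0//; lra.
by lra.
Qed.

Lemma timeone_ge (R : realType) (y : R) : 0 <= y <= 1 -> y <= timeone y.
Proof.
move=> /andP[]; rewrite le_eqVlt => /orP[/eqP<- _|y0]; first by rewrite timeone0.
rewrite le_eqVlt => /orP[/eqP->|y1]; first by rewrite timeone1.
by rewrite ltW// timeone_gt// y0.
Qed.

Lemma timeone_fixed (R : realType) (y : R) : timeone y = y -> 0 <= y <= 1 -> y = 0 \/ y = 1.
Proof.
move=> e /andP[]; rewrite le_eqVlt => /orP[/eqP<-|y0]; first by left.
rewrite le_eqVlt => /orP[/eqP->|y1]; first by right.
by have : 0 < y < 1; [rewrite y0|move/timeone_gt; rewrite e ltxx].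
Qed.

Lemma measurable_point (R : realType) (X : R * R * R) : measurable [set X].
Proof.
move: X => [[x y] z].
have -> : [set (x, y, z)] = ([set x] `*` [set y]) `*` [set z].
  by apply/seteqP; split=> [X ->//|[[x' y'] z'] /= [[-> ->] ->]].
by apply: measurableX => //; exact: measurableX.
Qed.

(** * Invariant measures and their symbolic images *)

Section horseshoe_measures.
Context {R : realType}.
Variables (lambda0 beta0 lambda1 sigma beta1 : R).
Hypotheses (hlambda0 : 0 < lambda0 < 1 / 3) (hbeta0 : 6 < beta0)
  (hlambda1 : 0 < lambda1 < 1 / 3) (hsigma : 0 < sigma < 1 / 3)
  (hbeta1 : 3 < beta1 < 4).

Local Notation F := (horseshoe lambda0 beta0 lambda1 sigma beta1).
Local Notation G := (horseshoe_inv lambda0 beta0 lambda1 sigma beta1).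
Local Notation T3 := (R * R * R)%type.
Local Notation Lam := (maximal_invariant F).
Local Notation itin := (itinerary lambda0 beta0 lambda1 sigma beta1).
Local Notation cod := (horseshoe_point lambda0 beta0 lambda1 sigma beta1).

Let mx : measurable_fun setT (fun X : T3 => X.1.1).
Proof. exact: (measurableT_comp measurable_fst measurable_fst). Qed.
Let my : measurable_fun setT (fun X : T3 => X.1.2).
Proof. exact: (measurableT_comp measurable_snd measurable_fst). Qed.
Let mz : measurable_fun setT (fun X : T3 => X.2).
Proof. exact: measurable_snd. Qed.

Let mcst (c : R) : measurable_fun setT (fun _ : T3 => c).
Proof. exact: measurable_cst. Qed.

Let mdiv (u v : T3 -> R) : measurable_fun setT u -> measurable_fun setT v ->
  measurable_fun setT (fun X => u X / v X).
Proof.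
move=> mu mv; apply: measurable_funM => //.
exact: (measurableT_comp (@measurable_inv R) mv).
Qed.

Lemma measurable_horseshoe : measurable_fun setT F.
Proof.
rewrite (_ : F = fun X : T3 => if X.2 <= 1 / 6
    then (lambda0 * X.1.1, X.1.2 / (X.1.2 + (1 - X.1.2) * expR (-1)), beta0 * X.2)
    else (3 / 4 - lambda1 * X.1.1, sigma * (1 - X.1.2), beta1 * (X.2 - 5 / 6))); last first.
  by apply/funext => -[[x y] z].
apply: measurable_fun_ifT; first exact: measurable_fun_ler.
- apply: measurable_fun_pair; first apply: measurable_fun_pair.
  + exact: measurable_funM.
  + by apply: mdiv => //; apply: measurable_funD => //; apply: measurable_funM => //; exact: measurable_funB.
  + exact: measurable_funM.
- apply: measurable_fun_pair; first apply: measurable_fun_pair.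
  + by apply: measurable_funB => //; exact: measurable_funM.
  + by apply: measurable_funM => //; exact: measurable_funB.
  + by apply: measurable_funM => //; exact: measurable_funB.
Qed.

Lemma measurable_horseshoe_inv : measurable_fun setT G.
Proof.
rewrite (_ : G = fun X : T3 => if X.1.1 <= 1 / 3
    then (X.1.1 / lambda0, X.1.2 * expR (-1) / (X.1.2 * expR (-1) + (1 - X.1.2)), X.2 / beta0)
    else ((3 / 4 - X.1.1) / lambda1, 1 - X.1.2 / sigma, X.2 / beta1 + 5 / 6)); last first.
  by apply/funext => -[[x y] z].
apply: measurable_fun_ifT; first exact: measurable_fun_ler.
- apply: measurable_fun_pair; first apply: measurable_fun_pair.
  + exact: mdiv.
  + by apply: mdiv; [|apply: measurable_funD]; try exact: measurable_funM; exact: measurable_funB.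
  + exact: mdiv.
- apply: measurable_fun_pair; first apply: measurable_fun_pair.
  + by apply: mdiv => //; exact: measurable_funB.
  + by apply: measurable_funB => //; exact: mdiv.
  + by apply: measurable_funD => //; exact: mdiv.
Qed.

Let mbool (b : T3 -> bool) : measurable_fun setT b -> measurable [set X | b X].
Proof.
move=> mb; rewrite (_ : [set X | b X] = setT `&` b @^-1` [set true]); last first.
  by apply/seteqP; split=> X /=; [|case].
exact: mb.
Qed.

Lemma measurable_upper : measurable [set X : T3 | upper X].
Proof.
rewrite (_ : [set X | _] = ~` [set X : T3 | X.2 <= 1 / 6]); last first.
  by apply/seteqP; split=> X /= /negP.
by apply: measurableC; apply: mbool; exact: measurable_fun_ler.
Qed.

Lemma measurable_slabs : measurable (slab0 R `|` slab1 R).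
Proof.
have m1 (u : T3 -> R) a b : measurable_fun setT u -> measurable [set X | a <= u X <= b].
  move=> mu; rewrite (_ : [set X | _] = [set X | a <= u X] `&` [set X | u X <= b]).
    by apply: measurableI; apply: mbool; exact: measurable_fun_ler.
  by apply/seteqP; split=> X /= /andP.
have m3 a b : measurable [set X : T3 | [/\ 0 <= X.1.1 <= 1, 0 <= X.1.2 <= 1 & a <= X.2 <= b]].
  rewrite (_ : [set X | _] = [set X : T3 | 0 <= X.1.1 <= 1] `&` [set X : T3 | 0 <= X.1.2 <= 1]
      `&` [set X : T3 | a <= X.2 <= b]).
    by apply: measurableI; [apply: measurableI|]; exact: m1.
  by apply/seteqP; split=> X /= [] => [? ? ?|[]].
by apply: measurableU; exact: m3.
Qed.

Lemma measurable_maximal_invariant : measurable Lam.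
Proof.
rewrite (maximal_invariantE hlambda0 hbeta0 hlambda1 hsigma hbeta1).
rewrite (_ : [set X | _] = \bigcap_n ((iter n F @^-1` (slab0 R `|` slab1 R)) `&`
    (iter n G @^-1` (slab0 R `|` slab1 R)))).
  apply: bigcapT_measurable => n; apply: measurableI.
    exact: (measurable_preimage_iter measurable_horseshoe n measurable_slabs).
  exact: (measurable_preimage_iter measurable_horseshoe_inv n measurable_slabs).
by apply/seteqP; split=> X /= h n; [move=> _|]; exact: h.
Qed.

Lemma measurable_itinerary : measurable_fun setT (itin : T3 -> Omega).
Proof.
apply: measurable_to_Omega => -[n|n].
  exact: (measurable_preimage_iter measurable_horseshoe n measurable_upper).
exact: (measurable_preimage_iter measurable_horseshoe_inv n.+1 measurable_upper).
Qed.

Lemma measurable_code : measurable_fun setT cod.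
Proof.
apply: measurable_fun_pair; first apply: measurable_fun_pair.
- exact: measurable_coord_x.
- exact: measurable_yhigh.
- exact: measurable_coord_z.
Qed.

(** An everywhere defined, measurable and bounded representative of the logarithmic jacobian,
    agreeing with it on the invariant set. *)
Definition jacobian3 (X : T3) : R := if upper X then ln sigma else
  if 0 <= X.1.2 <= 1 then ln (derive1 (@timeone R) X.1.2) else 0.

Lemma measurable_jacobian3 : measurable_fun setT jacobian3.
Proof.
rewrite (_ : jacobian3 = fun X : T3 => if X.2 <= 1 / 6 then
   (if (0 <= X.1.2) && (X.1.2 <= 1) then
     -1 - (ln (X.1.2 + (1 - X.1.2) * expR (-1)) + ln (X.1.2 + (1 - X.1.2) * expR (-1))) else 0)
   else ln sigma); last first.
  apply/funext => X; rewrite /jacobian3 /upper; case: (X.2 <= 1 / 6) => //=.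
  by case: ifP => // h; rewrite ln_derive_timeone// mulr2n.
apply: measurable_fun_ifT => //; first exact: measurable_fun_ler.
apply: measurable_fun_ifT => //.
  by apply: measurable_and; exact: measurable_fun_ler.
have ml : measurable_fun setT (fun X : T3 => ln (X.1.2 + (1 - X.1.2) * expR (-1))).
  apply: measurableT_comp; first exact: measurable_ln.
  by apply: measurable_funD => //; apply: measurable_funM => //; exact: measurable_funB.
by apply: measurable_funB => //; exact: measurable_funD.
Qed.

Lemma jacobian3_bound X : `|jacobian3 X| <= jac_bound sigma.
Proof.
have s0 : 0 < sigma by move: hsigma; lra.
have s1 : sigma < 1 by move: hsigma; lra.
rewrite /jacobian3; case: ifP => _.
  by rewrite ler0_norm ?ln_le0 ?ltW// /jac_bound; lra.
apply: le_trans (jac_bound_ge1 hsigma); case: ifP => h; last by rewrite normr0.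
exact: ln_derive_timeone_bound.
Qed.

Lemma log_central_jacobianE X : Lam X -> log_central_jacobian F X = jacobian3 X.
Proof.
have s0 : 0 < sigma by move: hsigma; lra.
move=> hX; have [sX _] := full_orbitP hlambda0 hbeta0 hlambda1 hsigma hbeta1 hX 0.
rewrite /= in sX; case: sX => sX.
  rewrite log_central_jacobian0// /jacobian3 /upper.
  have [_ hy /andP[_ ->]] := sX; rewrite hy /=.
  have d0 := timeone_den_gt0 hy.
  by rewrite gtr0_norm// derive1_timeone// divr_gt0 ?expR_gt0// exprn_gt0.
rewrite log_central_jacobian1// /jacobian3 /upper.
have [_ _ hz] := sX; rewrite (_ : X.2 <= 1 / 6 = false)//.
by apply/negbTE; rewrite -ltNge; lra.
Qed.

(** The upper slab is mapped to heights at most [beta1 / 6 < 2 / 3], below the upper slab. *)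
Lemma itinerary_sparse X : Lam X -> ~~ (itin X 0 && itin X 1).
Proof.
move=> hX; apply/negP => /andP[w0 w1].
have horb := full_orbitP hlambda0 hbeta0 hlambda1 hsigma hbeta1 hX.
have [s0 F0] := horb 0; have [s1 _] := horb 1.
have [_ _ hz] := slabsP s0; rewrite -/(itin X 0) w0 => hz'.
have [_ _ _] := slabsP s1; rewrite -/(itin X 1) w1 => hz1.
have [_ [_]] := @horseshoe_branch R lambda0 beta0 lambda1 sigma beta1 hbeta0 hbeta1 _ s0.
rewrite F0 add0r -/(itin X 0) w0 /branch_z => e.
have b1 : 0 < beta1 by move: hbeta1; lra.
have : (full_orbit lambda0 beta0 lambda1 sigma beta1 X 1).2 / beta1 <= 1 / 6 by lra.
by rewrite ler_pdivrMr//; move: hbeta1; lra.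
Qed.

(** The zero sequence is fixed by the shift, so [x] and [z] are fixed points of linear contractions,
    that is 0; [y] moves freely under the time-one map. *)
Lemma zero_itinerary X : Lam X -> (forall i, itin X i = false) ->
  [/\ X = (0, X.1.2, 0), (F X).1.2 = timeone X.1.2 & 0 <= X.1.2 <= 1].
Proof.
move=> hX zX; have [ex ez _] := itinerary_code hlambda0 hbeta0 hlambda1 hsigma hbeta1 hX.
have sw : shiftz 1 (itin X) = itin X by apply/funext => i; rewrite /shiftz !zX.
have rx := coord_x_shift hlambda0 hlambda1 (itin X).
have rz := coord_z_shift hbeta0 hbeta1 (itin X).
rewrite sw -ex zX /= in rx; rewrite sw -ez zX /= in rz.
have x0 : X.1.1 = 0 by move: rx hlambda0; rewrite /branch_x; nra.
have z0 : X.2 = 0.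
  have b0 : 0 < beta0 by move: hbeta0; lra.
  have : X.2 * beta0 = X.2 by rewrite {1}rz /branch_z divfK ?gt_eqF.
  by move: hbeta0; nra.
have [sX _] := full_orbitP hlambda0 hbeta0 hlambda1 hsigma hbeta1 hX 0.
have [_ hy _ _] := slabsP sX.
have [_ [eF _]] := @horseshoe_branch R lambda0 beta0 lambda1 sigma beta1 hbeta0 hbeta1 _ sX.
split=> //; last first.
  by move: eF; rewrite /full_orbit/= -/(itin X 0) (zX 0).
by move: X x0 z0 {hX zX ex ez sw rx rz sX hy eF} => [[x y] z] /= -> ->.
Qed.

Section invariant.
Variable nu : probability T3 R.
Hypothesis hnu : invariant_probability F nu.

Let nuF : preserves nu F. Proof. by case: hnu. Qed.

Lemma ae_Lam : \forall X \ae nu, Lam X.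
Proof.
apply: ae_pr1; first exact: measurable_maximal_invariant.
by rewrite /pr hnu.1.
Qed.

Lemma intg_jacobian3 : intg nu jacobian3.
Proof. exact: (bounded_intg nu measurable_jacobian3 jacobian3_bound). Qed.

Let integral_Lam f : intg nu f -> (\int[nu]_(X in Lam) (f X)%:E)%E = (expect nu f)%:E.
Proof.
move=> hf; rewrite -expectE//.
have mL := measurable_maximal_invariant; have mC := measurableC mL.
rewrite [RHS](negligible_integral mC measurableT hf).
  by congr integral; rewrite setTD setCK.
by apply: etrans (prE nu mC) _; rewrite prC// /pr hnu.1 subrr.
Qed.

Lemma central_exponentE : central_exponent F nu = (expect nu jacobian3)%:E.
Proof.
rewrite /central_exponent -integral_Lam; last exact: intg_jacobian3.
by apply: eq_integral => X; rewrite inE => hX; rewrite log_central_jacobianE.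
Qed.

Lemma pressure_potentialE t : pressure F (potential F t) nu =
  (metric_entropy nu F + (t * expect nu jacobian3)%:E)%E.
Proof.
have ij := intg_jacobian3.
have it : intg nu (fun X => t * jacobian3 X) by exact: (integrableZl measurableT t ij).
rewrite /pressure; congr (_ + _)%E.
rewrite -[X in X%:E](RintegralZl t measurableT ij) -integral_Lam//.
by apply: eq_integral => X; rewrite inE => hX; rewrite /potential log_central_jacobianE.
Qed.

Variable m : probability Omega R.
Hypothesis mE : forall A, measurable A -> m A = nu (itin @^-1` A).

Let ae_itin (P : Omega -> Prop) : (\forall w \ae m, P w) -> \forall X \ae nu, P (itin X).
Proof.
move=> [N [mN N0 sub]]; exists (itin @^-1` N); split.
- by rewrite -[X in measurable X]setTI; exact: measurable_itinerary.
- by rewrite -mE.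
- by move=> X PX; exact: sub.
Qed.

Lemma itinerary_preserves : preserves m (shiftz 1).
Proof.
move=> A mA.
have mSA : measurable (shiftz 1 @^-1` A : set Omega).
  by rewrite -[X in measurable X]setTI; exact: measurable_shiftz.
have mI (B : set Omega) : measurable B -> measurable (itin @^-1` B).
  by move=> mB; rewrite -[X in measurable X]setTI; exact: measurable_itinerary.
have mFI := measurable_preimage measurable_horseshoe (mI _ mA).
rewrite !mE// -[RHS]nuF; last exact: mI.
rewrite !prE//; last exact: mI.
congr EFin; apply: pr_ae_eq => //; first exact: mI.
by apply: filterS ae_Lam => X hX; rewrite /= itineraryF.
Qed.

Let mS := itinerary_preserves.

Lemma expect_itinerary : expect nu (jac sigma \o itin) = expect m (jac sigma).
Proof.
rewrite /expect /Rintegral; congr fine.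
have := @integral_pushforward _ _ T3 Omega R itin measurable_itinerary nu setT
  (EFin \o jac sigma).
rewrite preimage_setT => <-//.
- apply: eq_measure_integral; [exact: measurable_itinerary|by move=> mI A mA _; exact: esym (mE mA)].
- by apply/measurable_EFinP; exact: measurable_jac.
- apply: (bounded_intg nu (measurableT_comp (measurable_jac hsigma) measurable_itinerary)).
  by move=> X; exact: jac_le_bound.
Qed.

Lemma entropy_rate_itinerary (I : finType) (xi : T3 -> I) (ze : Omega -> I) :
  simple_map xi -> simple_map ze -> (\forall X \ae nu, xi X = ze (itin X)) ->
  entropy_rate nu F xi = entropy_rate m (shiftz 1) ze.
Proof.
move=> hx hz h.
have hall : \forall X \ae nu, forall n, xi (iter n F X) = ze (iter n (shiftz 1) (itin X)).
  have h1 : \forall X \ae nu, forall n, Lam (iter n F X) /\ xi (iter n F X) = ze (itin (iter n F X)).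
    apply: ae_foralln => n.
    apply: (@ae_preserves _ _ _ nu (iter n F) (measurable_iter measurable_horseshoe n)
      (preserves_iter measurable_horseshoe nuF n)
      (fun X => Lam X /\ xi X = ze (itin X))).
    by apply: filterS2 ae_Lam h => X.
  apply: filterS h1 => X hX n; rewrite (hX n).2; congr ze.
  elim: n => [//|n IH] /=; rewrite itineraryF ?IH//.
  exact: (hX n).1.
rewrite /entropy_rate; congr fekete_limit; apply/funext => n.
apply: eq_bigr => v _; congr negxlnx.
have mv := @simple_names _ Omega (shiftz 1) (measurable_shiftz 1) _ ze hz n v.
rewrite /dist {2}/pr mE// -/(pr nu _); apply: pr_ae_eq.
- exact: (simple_names measurable_horseshoe hx).
- by rewrite -[X in measurable X]setTI; exact: measurable_itinerary.
- apply: filterS hall => X hX /=.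
  have -> : names F xi n X = names (shiftz 1) ze n (itin X) by apply/ffunP => i; rewrite !ffunE.
  by [].
Qed.

Section golden_itinerary.
Hypothesis hm : golden m.

Let ae_good : \forall X \ae nu, Lam X /\ cod (itin X) = X.
Proof.
apply: filterS2 ae_Lam (ae_itin (ae_regular hsigma hm)) => X hX [_ _ /(_ 0)].
by rewrite shiftz0 => e; split => //; exact: code_itinerary.
Qed.

Lemma expect_jacobian3 : expect nu jacobian3 = exponent sigma m.
Proof.
rewrite /exponent -expect_itinerary; apply: expect_ae_eq.
- exact: measurable_jacobian3.
- exact: (measurableT_comp (measurable_jac hsigma) measurable_itinerary).
apply: filterS ae_good => X [hX e].
have [sX _] := full_orbitP hlambda0 hbeta0 hlambda1 hsigma hbeta1 hX 0.
have [_ hy _ _] := slabsP sX.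
have ey : yhigh sigma (itin X) = X.1.2 by rewrite -[in RHS]e.
by rewrite /jacobian3 /jac /= ey hy.
Qed.

(** Any partition, read through [cod], becomes a partition of sequences, and the symbol generates.
    Conversely the partition by [upper] has the itinerary as its names; [inord] only relabels
    booleans as elements of ['I_2]. *)
Lemma metric_entropy_itinerary : metric_entropy nu F = (symbol_rate m)%:E.
Proof.
rewrite (metric_entropyE measurable_horseshoe nuF).
apply/eqP; rewrite eq_le; apply/andP; split.
  apply: ge_ereal_sup => _ [k [xi [hx ->]]]; rewrite lee_fin.
  have hz : simple_map (xi \o cod).
    by move=> i; rewrite -[X in measurable X]setTI; exact: (measurable_code measurableT (hx i)).
  rewrite (entropy_rate_itinerary hx hz).
    exact: entropy_rate_le_symbol.
  by apply: filterS ae_good => X [_ /= ->].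
pose g (b : bool) : 'I_2 := inord b.
have gi (b : bool) : (g b == inord 1) = b.
  by apply/eqP; case: b => //; move/(congr1 (@nat_of_ord 2)); rewrite !inordK.
have hx : simple_map (g \o @upper R).
  apply: simple_comp => -[]; first exact: measurable_upper.
  rewrite (_ : _ @^-1` _ = ~` [set X : T3 | upper X]); first exact: measurableC measurable_upper.
  by apply/seteqP; split=> X /=; [move=> ->|move/negP/negbTE].
have hz : simple_map (g \o symbol) by apply: simple_comp; exact: simple_symbol.
apply: le_trans (_ : (entropy_rate nu F (g \o @upper R))%:E <= _)%E; last first.
  by apply: ereal_sup_ubound; exists 2%N, (g \o @upper R).
rewrite lee_fin (entropy_rate_itinerary hx hz); last exact: nearW.
apply: (@entropy_rate_le_window _ _ _ m (shiftz 1) (measurable_shiftz 1) mS _ _ symbol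
  (g \o symbol) 0 1 (fun v => v ord0 == inord 1)) => //; first exact: simple_symbol.
by move=> w; rewrite ffunE /= gi.
Qed.

End golden_itinerary.

(** On points of zero itinerary the time-one map moves [y] upward. An invariant measure allows this
    only where [y] is fixed, that is at [Q] and [P], which are not charged. *)
Lemma golden_itinerary : nu [set (0, 0, 0)] = 0%E -> nu [set (0, 1, 0)] = 0%E -> golden m.
Proof.
move=> nuQ nuP.
have mI (B : set Omega) : measurable B -> measurable (itin @^-1` B).
  by move=> mB; rewrite -[X in measurable X]setTI; exact: measurable_itinerary.
split; first exact: mS.
- have m11 : measurable [set w : Omega | w 0 && w 1].
    rewrite (_ : [set w | _] = [set w : Omega | w 0] `&` [set w : Omega | w 1]).
      by apply: measurableI; exact: measurable_coord.
    by apply/seteqP; split=> w /= /andP.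
  rewrite mE// prE; last exact: mI.
  congr EFin; apply: pr0_ae; first exact: mI.
  by apply: filterS ae_Lam => X hX /=; apply/negP; exact: itinerary_sparse.
rewrite mE; last exact: measurable_zero.
rewrite prE; last exact: mI measurable_zero.
congr EFin; set Z := itin @^-1` _.
have mZ : measurable Z by exact: mI measurable_zero.
have ZF X : Lam X -> (Z (F X) <-> Z X).
  move=> hX; rewrite /Z/= itineraryF// /shiftz; split=> h i; last exact: h.
  by have := h (i - 1); rewrite subrK.
pose u (X : T3) : R := if X \in Z then - X.1.2 else 0.
have mu : measurable_fun setT u.
  apply: measurable_fun_ifT => //.
    apply: (measurable_fun_bool true); rewrite setTI.
    by rewrite (_ : _ @^-1` _ = Z)//; apply/seteqP; split=> X; [exact: set_mem|exact: mem_set].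
  exact: (measurableT_comp (@oppr_measurable R setT) my).
have hle : \forall X \ae nu, u (F X) <= u X.
  apply: filterS ae_Lam => X hX; rewrite /u.
  have [zX|zX] := pselect (Z X); last by rewrite !memNset// ZF.
  have [_ -> hy] := zero_itinerary hX zX.
  rewrite !mem_set ?ZF// lerN2; exact: timeone_ge.
have := ae_invariant_of_le measurable_horseshoe nuF mu hle.
have nQ := ae_notin (measurable_point (0, 0, 0)) nuQ.
have nP := ae_notin (measurable_point (0, 1, 0)) nuP.
move=> heq; apply: pr0_ae => //; apply: filterS (filterI (filterI nQ nP) (filterI ae_Lam heq)).
move=> X [[nXQ nXP] [hX]] + zX; rewrite /u !mem_set ?ZF//.
have [eX -> hy] := zero_itinerary hX zX; move/oppr_inj/timeone_fixed => /(_ hy)[] y0.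
- by apply: nXQ; rewrite /= eX y0.
- by apply: nXP; rewrite /= eX y0.
Qed.

End invariant.
End horseshoe_measures.

(** * Equilibrium states *)

Section atoms.
Context {d : measure_display} {T : measurableType d} {R : realType}.

Lemma expect_mix (mu mu1 mu2 : probability T R) (a : R) (f : T -> R) (K : R) :
  0 <= a <= 1 ->
  (forall A, measurable A -> pr mu A = a * pr mu1 A + (1 - a) * pr mu2 A) ->
  measurable_fun setT f -> (forall x, `|f x| <= K) ->
  expect mu f = a * expect mu1 f + (1 - a) * expect mu2 f.
Proof.
move=> /andP[a0 a1] muE mf hf; have b0 : 0 <= 1 - a by rewrite subr_ge0.
have iK (m : probability T R) : intg m (fun x => f x + K).
  by apply: intgD; [exact: bounded_intg hf|exact: intg_cst].
have eK (m : probability T R) : expect m (fun x => f x + K) = expect m f + K.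
  by rewrite expectD ?expect_cst//; [exact: bounded_intg hf|exact: intg_cst].
(* Adding [K] makes the integrand nonnegative, so that additivity of the integral in the measure
   applies. *)
suff : expect mu (fun x => f x + K) =
    a * expect mu1 (fun x => f x + K) + (1 - a) * expect mu2 (fun x => f x + K).
  by rewrite !eK; lra.
have mfK : measurable_fun setT (fun x => (f x + K)%:E).
  by apply/measurable_EFinP; exact: intg_measurable (iK mu).
have f0 x : (0 <= (f x + K)%:E)%E by rewrite lee_fin; have := hf x; rewrite ler_norml; lra.
apply: EFin_inj; rewrite EFinD !EFinM -!expectE//.
rewrite -(ge0_integral_mscale mu1 measurableT (NngNum a0))//.
rewrite -(ge0_integral_mscale mu2 measurableT (NngNum b0))//.
rewrite -ge0_integral_measure_add//; apply: eq_measure_integral => A mA _.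
apply: etrans (esym (measure_addE (mscale (NngNum a0) mu1) (mscale (NngNum b0) mu2) A)).
apply: etrans (prE mu mA) _; rewrite muE// EFinD !EFinM.
by congr (_ + _)%E; congr (_ * _)%E; exact: esym (prE _ mA).
Qed.

Lemma pr_dirac (p : T) (A : set T) : pr (\d_p : probability T R) A = (p \in A)%:R.
Proof. by rewrite /pr (_ : (\d_p : probability T R) A = ((p \in A)%:R)%:E)//; exact: diracE. Qed.

Lemma entropy_dirac (p : T) (P : probability T R) (I : finType) (xi : T -> I) :
  (forall A, measurable A -> P A = \d_p A) -> simple_map xi -> entropy P xi = 0.
Proof.
move=> PE hx; rewrite /entropy big1// => i _.
rewrite /dist /pr PE// diracE; case: (_ \in _) => /=; first exact: negxlnx1.
exact: negxlnx0.
Qed.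

Lemma preserves_dirac (p : T) (P : probability T R) (F : T -> T) :
  (forall A, measurable A -> P A = \d_p A) -> measurable_fun setT F -> F p = p ->
  preserves P F.
Proof.
move=> PE mF Fp A mA; rewrite !PE//; last exact: measurable_preimage.
by rewrite !diracE; congr (_%:R)%:E; congr nat_of_bool; apply/idP/idP; rewrite !inE /= Fp.
Qed.

Lemma entropy_rate_dirac (p : T) (P : probability T R) (F : T -> T) (I : finType) (xi : T -> I) :
  (forall A, measurable A -> P A = \d_p A) -> measurable_fun setT F -> F p = p ->
  simple_map xi -> entropy_rate P F xi = 0.
Proof.
move=> PE mF Fp hx.
apply/eqP; rewrite eq_le entropy_rate_ge0// andbT.
have := entropy_rate_le P mF hx (ltn0Sn 0).
by rewrite (entropy_dirac PE) ?mul0r//; exact: simple_names.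
Qed.

(** [nu] is the normalized restriction to the complement of [p]; it is invariant because [mu] and
    the Dirac measure at the fixed point are and the decomposition is linear. *)
Lemma split_atom (mu : probability T R) (F : T -> T) (p : T) :
  measurable_fun setT F -> preserves mu F -> F p = p -> measurable [set p] ->
  pr mu [set p] < 1 ->
  exists nu : probability T R, [/\ preserves nu F, pr nu [set p] = 0 &
    forall A, measurable A ->
      pr mu A = pr mu [set p] * pr \d_p A + (1 - pr mu [set p]) * pr nu A].
Proof.
move=> mF muF Fp mp; set a := pr mu [set p] => a1.
have b0 : 0 < 1 - a by rewrite subr_gt0.
have mC := measurableC mp.
pose nu : probability T R := mnormalize (mrestr mu mC) \d_p.
have ev : mrestr mu mC setT = (1 - a)%:E by rewrite /mrestr setTI prE// prC.
have nuE A : measurable A -> nu A = ((pr mu (A `\` [set p])) / (1 - a))%:E.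
  move=> mA; rewrite /nu /= /mnormalize.
  have -> : (measure_function_mrestr__canonical__measure_function_Measure mu mC setT) = (1 - a)%:E := ev.
  rewrite eqe gt_eqF//=.
  by rewrite /mrestr -setDE prE//; exact: measurableD.
have prN A : measurable A -> pr nu A = pr mu (A `\` [set p]) / (1 - a).
  by move=> mA; apply: EFin_inj; exact: etrans (esym (prE nu mA)) (nuE A mA).
have muE A : measurable A -> pr mu A = a * pr \d_p A + (1 - a) * pr nu A.
  move=> mA; rewrite prN// [_ * (_ / _)]mulrC divfK ?gt_eqF// prD// pr_dirac.
  have [pA|pA] := boolP (p \in A).
    rewrite (_ : A `&` [set p] = [set p]) /= ?mulr1 -/a; first by lra.
    by apply/seteqP; split=> [x []//|x ->]; split => //; exact: set_mem.
  rewrite (_ : A `&` [set p] = set0) /= ?mulr0 /pr ?measure0/=; first by lra.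
  by apply/seteqP; split=> // x [Ax /= e]; move: pA; rewrite -e => /negP; apply; exact: mem_set.
exists nu; split=> //; last by rewrite prN// setDv {1}/pr measure0 mul0r.
move=> A mA; have mFA := measurable_preimage mF mA.
rewrite !prE//; congr EFin; apply: (mulfI (lt0r_neq0 b0)).
have := muE _ mFA; have := muE _ mA.
have -> : pr mu (F @^-1` A) = pr mu A by rewrite /pr muF.
have -> : pr \d_p (F @^-1` A) = pr \d_p A :> R.
  by rewrite !pr_dirac; congr (_%:R); congr nat_of_bool; apply/idP/idP; rewrite !inE /= Fp.
by move=> -> /addrI ->.
Qed.

Lemma metric_entropy_dirac (p : T) (P : probability T R) (F : T -> T) :
  (forall A, measurable A -> P A = \d_p A) -> measurable_fun setT F -> F p = p ->
  metric_entropy P F = 0%E.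
Proof.
move=> PE mF Fp; rewrite metric_entropyE//; last exact: preserves_dirac Fp.
apply/eqP; rewrite eq_le; apply/andP; split.
  by apply: ge_ereal_sup => _ [k [xi [hx ->]]]; rewrite (entropy_rate_dirac PE).
have hc : simple_map (fun _ : T => ord0 : 'I_1).
  by move=> i; rewrite (_ : _ @^-1` _ = setT)//; apply/seteqP; split=> // x _; rewrite /= [i]ord1.
apply: ereal_sup_ubound; exists 1%N, (fun=> ord0); split => //.
by rewrite (entropy_rate_dirac PE).
Qed.

Lemma metric_entropy_split (mu nu : probability T R) (F : T -> T) (p : T) (a : R) :
  measurable_fun setT F -> preserves mu F -> preserves nu F -> F p = p -> 0 <= a < 1 ->
  (forall A, measurable A -> pr mu A = a * pr \d_p A + (1 - a) * pr nu A) ->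
  metric_entropy mu F = ((1 - a)%:E * metric_entropy nu F)%E.
Proof.
move=> mF muF nuF Fp /andP[a0 a1] muE; rewrite !metric_entropyE//.
have b0 : 0 < 1 - a by rewrite subr_gt0.
have dF : preserves (\d_p : probability T R) F by exact: preserves_dirac Fp.
have rate k (xi : T -> 'I_k) : simple_map xi ->
    entropy_rate mu F xi = (1 - a) * entropy_rate nu F xi.
  move=> hx; rewrite (entropy_rate_mix _ muE)//; last by rewrite a0 ltW.
  by rewrite (@entropy_rate_dirac p)// mulr0 add0r.
rewrite -ereal_sup_pZl//; congr ereal_sup; apply/seteqP; split=> h /=.
  move=> [k [xi [hx ->]]]; exists (entropy_rate nu F xi)%:E; first by exists k, xi.
  by rewrite rate// EFinM.
move=> [_ [k [xi [hx ->]]] <-]; exists k, xi; split => //.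
by rewrite rate// EFinM.
Qed.

End atoms.

Lemma pr1_dirac d (T : measurableType d) (R : realType) (mu : probability T R) (p : T) :
  measurable [set p] -> pr mu [set p] = 1 -> forall A, measurable A -> mu A = \d_p A.
Proof.
move=> mp h A mA; rewrite prE// diracE; congr EFin.
have ha := ae_pr1 mp h; have [pA|pA] := boolP (p \in A).
  by apply: pr1_ae => //; apply: filterS ha => x ->; exact: set_mem.
apply: pr0_ae => //; apply: filterS ha => x -> /mem_set; exact/negP.
Qed.

Lemma expect_dirac d (T : measurableType d) (R : realType) (mu : probability T R) (p : T)
    (f : T -> R) : measurable [set p] -> (forall A, measurable A -> mu A = \d_p A) ->
  measurable_fun setT f -> expect mu f = f p.
Proof.
move=> mp muE mf; rewrite -[RHS](expect_cst mu); apply: expect_ae_eq => //.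
apply: filterS (ae_pr1 mp _) => [x ->//|].
by rewrite /pr muE// diracE mem_set.
Qed.

(** * The pressure bound and the three regimes *)

Section equilibria.
Context {R : realType}.
Variables (lambda0 beta0 lambda1 sigma beta1 : R).
Hypotheses (hlambda0 : 0 < lambda0 < 1 / 3) (hbeta0 : 6 < beta0)
  (hlambda1 : 0 < lambda1 < 1 / 3) (hsigma : 0 < sigma < 1 / 3)
  (hbeta1 : 3 < beta1 < 4).

Local Notation F := (horseshoe lambda0 beta0 lambda1 sigma beta1).
Local Notation T3 := (R * R * R)%type.
Local Notation Lam := (maximal_invariant F).
Local Notation itin := (itinerary lambda0 beta0 lambda1 sigma beta1).
Local Notation cod := (horseshoe_point lambda0 beta0 lambda1 sigma beta1).
Local Notation J := (jacobian3 sigma).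
Local Notation Q := ((0, 0, 0) : T3).
Local Notation P := ((0, 1, 0) : T3).

Let mF : measurable_fun setT F := measurable_horseshoe lambda0 beta0 lambda1 sigma beta1.
Let mJ : measurable_fun setT J := measurable_jacobian3 sigma.
Let bJ := jacobian3_bound hsigma.
Let mL := measurable_maximal_invariant hlambda0 hbeta0 hlambda1 hsigma hbeta1.

Lemma horseshoe_fixed y : timeone y = y -> F (0, y, 0) = (0, y, 0).
Proof. by move=> e; rewrite /horseshoe e !mulr0 divr_ge0. Qed.

Lemma fixed_Lam y : 0 <= y <= 1 -> timeone y = y -> Lam (0, y, 0).
Proof.
move=> hy e; exists (fun=> (0, y, 0)); split=> // n; split; last exact: horseshoe_fixed.
by left; split=> //=; rewrite lexx ?ler01 ?divr_ge0.
Qed.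

Lemma itinerary_fixed y i : 0 <= y <= 1 -> timeone y = y -> itin (0, y, 0) i = false.
Proof.
move=> hy e; have Fy := horseshoe_fixed e.
have [sy _] := full_orbitP hlambda0 hbeta0 hlambda1 hsigma hbeta1 (fixed_Lam hy e) 0.
have Gy : horseshoe_inv lambda0 beta0 lambda1 sigma beta1 (0, y, 0) = (0, y, 0).
  by rewrite -{1}Fy (horseshoeK hlambda0 hbeta0 hlambda1 hsigma hbeta1).
rewrite /itinerary (_ : full_orbit _ _ _ _ _ _ _ = (0, y, 0)).
  by rewrite /upper/= divr_ge0.
by case: i => n; rewrite /full_orbit; elim: n => [|n IH] //=; rewrite /= in IH; rewrite IH.
Qed.

Lemma jacobian3_Q : J Q = 1.
Proof.
rewrite /jacobian3 /upper/= divr_ge0//= lexx ler01 ln_derive_timeone ?lexx ?ler01//.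
by rewrite add0r subr0 mul1r expRK/= mulr2n; lra.
Qed.

Lemma jacobian3_P : J P = -1.
Proof.
rewrite /jacobian3 /upper/= divr_ge0//= lexx ler01 ln_derive_timeone ?lexx ?ler01//.
by rewrite subrr mul0r addr0 ln1 mul0rn subr0/=.
Qed.

(** The measure is transported by the coding; on regular sequences [itinerary] inverts it, so the
    image has the given measure as its symbolic law. *)
Lemma golden_image m : golden m -> exists nu : probability T3 R,
  [/\ invariant_probability F nu, nu [set Q] = 0%E,
      metric_entropy nu F = (symbol_rate m)%:E & expect nu J = exponent sigma m].
Proof.
move=> hm; have [mS _ m0] := hm.
have mc := measurable_code hlambda0 hbeta0 hlambda1 hsigma hbeta1.
have [nu nuE] := image_probability m mc.
have mcI A : measurable A -> measurable (cod @^-1` A).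
  by move=> mA; rewrite -[X in measurable X]setTI; exact: mc.
have hreg := ae_regular hsigma hm.
have rc w := @regular_code R _ _ _ _ _ hlambda0 hbeta0 hlambda1 hsigma hbeta1 w.
have nuL : nu Lam = 1%E.
  rewrite nuE prE; last exact: mcI mL.
  congr EFin; apply: pr1_ae; first exact: mcI mL.
  by apply: filterS hreg => w /rc[].
have hnu : invariant_probability F nu.
  split=> // A mA; have mFA := measurable_preimage mF mA.
  have mSA := measurable_preimage (measurable_shiftz 1) (mcI A mA).
  rewrite !nuE -[RHS](mS _ (mcI A mA)) !prE//; last exact: mcI.
  congr EFin; apply: pr_ae_eq => //; first exact: mcI.
  apply: filterS hreg => w rw; rewrite -[X in X <-> _]/(A (F (cod w))).
  by rewrite (code_shiftz hlambda0 hbeta0 hlambda1 hsigma hbeta1 rw).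
have mE A : measurable A -> m A = nu (itin @^-1` A).
  move=> mA; have mIA : measurable (itin @^-1` A).
    by rewrite -[X in measurable X]setTI; exact: measurable_itinerary.
  rewrite nuE !prE//; last exact: mcI.
  congr EFin; apply: pr_ae_eq => //; first exact: mcI.
  by apply: filterS hreg => w /rc[_ e] /=; rewrite e.
exists nu; split=> //.
- have mQ := measurable_point Q.
  rewrite nuE prE; last exact: mcI.
  congr EFin; apply: pr0_ae; first exact: mcI.
  apply: filterS2 hreg (ae_notin measurable_zero m0) => w /rc[_ e] nz /= eQ.
  by apply: nz => i; rewrite -e eQ; apply: itinerary_fixed; rewrite ?timeone0// lexx ler01.
- exact: (metric_entropy_itinerary hlambda0 hbeta0 hlambda1 hsigma hbeta1 hnu mE hm).
- exact: (expect_jacobian3 hlambda0 hbeta0 hlambda1 hsigma hbeta1 hnu mE hm).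
Qed.

(** The clause on null sets ensures that removing the atom at [P] does not create one at [Q]. *)
Lemma invariant_split (mu : probability T3 R) y : invariant_probability F mu ->
  0 <= y <= 1 -> timeone y = y -> pr mu [set (0, y, 0)] < 1 ->
  exists nu : probability T3 R, [/\ invariant_probability F nu,
    nu [set (0, y, 0)] = 0%E, forall A, measurable A -> mu A = 0%E -> nu A = 0%E,
    metric_entropy mu F = ((1 - pr mu [set (0, y, 0)])%:E * metric_entropy nu F)%E &
    expect mu J = pr mu [set (0, y, 0)] * J (0, y, 0) +
      (1 - pr mu [set (0, y, 0)]) * expect nu J].
Proof.
move=> [muL muF] hy ey; set p := (0, y, 0); set a := pr mu [set p] => a1.
have mp := measurable_point p; have Fp := horseshoe_fixed ey.
have a0 : 0 <= a by exact: pr_ge0.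
have [nu [nuF nup muE]] := split_atom mF muF Fp mp a1; rewrite -/a in muE.
have nuL : nu Lam = 1%E.
  rewrite prE//; congr EFin; have := muE _ mL.
  rewrite pr_dirac mem_set; last exact: fixed_Lam.
  rewrite /pr muL /= -/(pr nu _) => e.
  have b0 : 1 - a != 0 by rewrite gt_eqF// subr_gt0.
  by apply: (mulfI b0); rewrite mulr1; move: e; lra.
exists nu; split=> //.
- by rewrite prE// nup.
- move=> A mA mA0; rewrite prE//; congr EFin.
  have := muE _ mA; rewrite {1}/pr mA0 /= => e.
  have h1 : 0 <= a * pr (\d_p : probability T3 R) A by rewrite mulr_ge0// pr_ge0.
  have b0 : 1 - a != 0 by rewrite gt_eqF// subr_gt0.
  have h2 : 0 <= (1 - a) * pr nu A by rewrite mulr_ge0 ?pr_ge0// subr_ge0 ltW.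
  by apply: (mulfI b0); rewrite mulr0; lra.
- by apply: (metric_entropy_split mF muF nuF Fp _ muE); rewrite a0.
- rewrite (expect_mix _ muE mJ bJ); last by rewrite a0 ltW.
  by congr (_ * _ + _); apply: expect_dirac.
Qed.

Local Notation t0 := (t_crit sigma).

Let bound_golden (mu : probability T3 R) : invariant_probability F mu ->
  mu [set Q] = 0%E -> mu [set P] = 0%E ->
  exists h, [/\ metric_entropy mu F = h%:E, h <= t0 * (1 - expect mu J) & expect mu J < 0].
Proof.
move=> hmu mQ mP.
have mI := measurable_itinerary lambda0 beta0 lambda1 sigma beta1.
have [m mE'] := image_probability mu mI.
have mE A : measurable A -> m A = mu (itin @^-1` A) by [].
have hm := golden_itinerary hlambda0 hbeta0 hlambda1 hsigma hbeta1 hmu mE mQ mP.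
exists (symbol_rate m).
rewrite (expect_jacobian3 hlambda0 hbeta0 hlambda1 hsigma hbeta1 hmu mE hm).
split; last exact: exponent_lt0.
- exact: (metric_entropy_itinerary hlambda0 hbeta0 hlambda1 hsigma hbeta1 hmu mE hm).
- exact: symbol_rate_le_t_crit.
Qed.

(** An atom of mass [b] at [P] multiplies the entropy by [1 - b] and turns [1 - l] into
    [(1 - b) (1 - l) + 2 b], so the inequality only improves. *)
Lemma entropy_bound (mu : probability T3 R) : invariant_probability F mu ->
  mu [set Q] = 0%E ->
  exists h, [/\ metric_entropy mu F = h%:E, h <= t0 * (1 - expect mu J) & expect mu J < 0].
Proof.
move=> hmu mQ; have [muL muF] := hmu.
have mP := measurable_point P; have F1 : timeone 1 = 1 :> R by exact: timeone1.
have h01 : 0 <= (1 : R) <= 1 by rewrite ler01 lexx.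
have tc := t_crit_gt0 hsigma.
have := pr_le1 mu mP; rewrite le_eqVlt => /orP[/eqP b1|b1].
  have muE := pr1_dirac mP b1; exists 0.
  rewrite (expect_dirac mP muE mJ) jacobian3_P; split; [|nra|lra].
  exact: metric_entropy_dirac muE mF (horseshoe_fixed F1).
have [nu [hnu nuP ac hE ->]] := invariant_split hmu h01 F1 b1.
have [h [nuh hle l0]] := bound_golden hnu (ac _ (measurable_point Q) mQ) nuP.
rewrite nuh -EFinM in hE; rewrite jacobian3_P.
exists ((1 - pr mu [set P]) * h); split=> //.
- have b0 := pr_ge0 mu [set P]; set b := pr mu [set P] in b1 b0 *.
  have : (1 - b) * h <= (1 - b) * (t0 * (1 - expect nu J)).
    by rewrite ler_wpM2l// subr_ge0 ltW.
  have : 0 <= t0 * b by rewrite mulr_ge0// ltW.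
  lra.
- have b0 := pr_ge0 mu [set P]; nra.
Qed.

Local Notation dQ := (\d_Q : probability T3 R).

Lemma invariant_dirac : invariant_probability F dQ.
Proof.
have F0 : timeone 0 = 0 :> R by exact: timeone0.
split; last exact: (preserves_dirac (p := Q)) (horseshoe_fixed F0).
have e : dQ Lam = ((Q \in Lam)%:R)%:E by exact: diracE.
by rewrite e mem_set//; apply: fixed_Lam => //; rewrite lexx ler01.
Qed.

Lemma pressure_dirac t (mu : probability T3 R) : invariant_probability F mu ->
  (forall A, measurable A -> mu A = \d_Q A) -> pressure F (potential F t) mu = t%:E.
Proof.
move=> hmu muE; have F0 : timeone 0 = 0 :> R by exact: timeone0.
rewrite (pressure_potentialE hlambda0 hbeta0 hlambda1 hsigma hbeta1 hmu).
rewrite (metric_entropy_dirac muE mF (horseshoe_fixed F0)).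
by rewrite (expect_dirac (measurable_point Q) muE mJ) jacobian3_Q mulr1 add0e.
Qed.

(** An atom of mass [a] at [Q], of entropy 0 and exponent 1, multiplies both the entropy and [1 - l]
    by [1 - a], so the inequality is preserved. As the remaining part has negative exponent, [l = 1]
    forces [a = 1]. *)
Lemma pressure_bound (mu : probability T3 R) : invariant_probability F mu ->
  exists h, [/\ metric_entropy mu F = h%:E,
    forall t, pressure F (potential F t) mu = (h + t * expect mu J)%:E,
    h <= t0 * (1 - expect mu J), expect mu J <= 1 &
    expect mu J = 1 -> forall A, measurable A -> mu A = \d_Q A].
Proof.
move=> hmu.
suff [h [hE hle l1 uniq]] : exists h, [/\ metric_entropy mu F = h%:E,
    h <= t0 * (1 - expect mu J), expect mu J <= 1 &
    expect mu J = 1 -> forall A, measurable A -> mu A = \d_Q A].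
  exists h; split=> // t.
  by rewrite (pressure_potentialE hlambda0 hbeta0 hlambda1 hsigma hbeta1 hmu) hE.
have F0 : timeone 0 = 0 :> R by exact: timeone0.
have h0 : 0 <= (0 : R) <= 1 by rewrite lexx ler01.
have mQ := measurable_point Q.
have := pr_le1 mu mQ; rewrite le_eqVlt => /orP[/eqP a1|a1].
  have muE := pr1_dirac mQ a1; exists 0.
  rewrite (expect_dirac mQ muE mJ) jacobian3_Q subrr mulr0; split=> //.
  exact: metric_entropy_dirac muE mF (horseshoe_fixed F0).
have [nu [hnu nuQ _ hE ->]] := invariant_split hmu h0 F0 a1.
have [h [nuh hle l0]] := entropy_bound hnu nuQ.
have a0 := pr_ge0 mu [set Q]; set a := pr mu [set Q] in hE a0 a1 *.
exists ((1 - a) * h); rewrite jacobian3_Q mulr1; split.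
- by rewrite hE nuh EFinM.
- have : (1 - a) * h <= (1 - a) * (t0 * (1 - expect nu J)).
    by rewrite ler_wpM2l// subr_ge0 ltW.
  lra.
- by nra.
- by move=> e; exfalso; nra.
Qed.

Lemma maximizer : exists nu : probability T3 R, [/\ invariant_probability F nu,
  nu [set Q] = 0%E, expect nu J < 0 &
  metric_entropy nu F = (t0 * (1 - expect nu J))%:E].
Proof.
have [m [hm e]] := t_crit_attained hsigma.
have [nu [hnu nuQ hE lE]] := golden_image hm.
by exists nu; rewrite hE lE e; split=> //; exact: exponent_lt0.
Qed.

Lemma singular_dirac (mu : probability T3 R) : mu [set Q] = 0%E -> mutually_singular mu dQ.
Proof.
move=> mQ; exists [set Q]; split=> //; first exact: measurable_point.
have e : dQ (~` [set Q]) = ((Q \in ~` [set Q])%:R)%:E by exact: diracE.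
by rewrite e memNset//= => /(_ erefl).
Qed.

Lemma equilibrium_dirac t : t0 <= t -> equilibrium_state F (potential F t) dQ.
Proof.
move=> tt; split; first exact: invariant_dirac.
move=> nu hnu; rewrite (pressure_dirac t invariant_dirac)//.
have [h [_ -> hle l1 _]] := pressure_bound hnu; rewrite lee_fin.
by have : 0 <= (t - t0) * (1 - expect nu J); [rewrite mulr_ge0 ?subr_ge0|lra].
Qed.

(** Comparison with the Dirac measure gives [t <= h + t l <= t0 (1 - l) + t l], that is
    [(t - t0) (1 - l) <= 0], so [l = 1]. *)
Lemma equilibrium_unique t (mu : probability T3 R) : t0 < t ->
  equilibrium_state F (potential F t) mu -> forall A, measurable A -> mu A = \d_Q A.
Proof.
move=> tt [hmu mx]; have [h [_ pE hle l1 uniq]] := pressure_bound hmu.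
have := mx _ invariant_dirac; rewrite (pressure_dirac t invariant_dirac)// pE lee_fin => h2.
by apply: uniq; nra.
Qed.

(** A maximizer [nu] of the quotient has pressure [t + (t0 - t) (1 - l nu)], and [mu] has at most
    the same expression with [l mu]. As [mu] has at least the pressure of [nu], this gives
    [l mu <= l nu < 0]. *)
Lemma equilibrium_negative t (mu : probability T3 R) : t < t0 ->
  equilibrium_state F (potential F t) mu -> expect mu J < 0 /\ mu [set Q] = 0%E.
Proof.
move=> tt [hmu mx]; have [h [hE pE hle l1 _]] := pressure_bound hmu.
have [nu [hnu _ ln nuE]] := maximizer.
have [h' [h'E pE' _ _ _]] := pressure_bound hnu.
move: h'E; rewrite nuE => -[eh]; have := mx _ hnu; rewrite pE pE' -eh lee_fin => hp.
have lmu : expect mu J < 0 by nra.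
split=> //; have mQ := measurable_point Q.
have F0 : timeone 0 = 0 :> R by exact: timeone0.
have h0 : 0 <= (0 : R) <= 1 by rewrite lexx ler01.
have := pr_le1 mu mQ; rewrite le_eqVlt => /orP[/eqP a1|a1].
  by move: lmu; rewrite (expect_dirac mQ (pr1_dirac mQ a1) mJ) jacobian3_Q ltr10.
(* Pressure is affine along the splitting: that of [mu] is [a t] plus [1 - a] times that of [ka],
   which is no larger than that of [mu]. Since the pressure of [mu] exceeds [t], the mass [a] is
   0. *)
have [ka [hka _ _ kE lE]] := invariant_split hmu h0 F0 a1.
have [k [kaE pK _ _ _]] := pressure_bound hka.
have := mx _ hka; rewrite pE pK lee_fin => hk.
rewrite prE//; congr EFin; have a0 := pr_ge0 mu [set Q].
set a := pr mu [set Q] in kE lE a0 a1 *.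
move: kE; rewrite hE kaE -EFinM => -[e1]; rewrite jacobian3_Q mulr1 in lE.
have pt : t < h + t * expect mu J.
  have : 0 < (t0 - t) * (1 - expect nu J) by rewrite mulr_gt0 ?subr_gt0//; lra.
  lra.
have : a * (h + t * expect mu J - t) <= 0.
  have : (1 - a) * (k + t * expect ka J) <= (1 - a) * (h + t * expect mu J).
    by rewrite ler_wpM2l// subr_ge0 ltW.
  by rewrite lE e1; lra.
by move=> h3; apply/eqP; rewrite eq_le a0 andbT; nra.
Qed.

End equilibria.

Theorem theorem2p3 (R : realType) (lambda0 beta0 lambda1 sigma beta1 : R)
  (hlambda0 : 0 < lambda0 < 1 / 3) (hbeta0 : 6 < beta0)
  (hlambda1 : 0 < lambda1 < 1 / 3) (hsigma : 0 < sigma < 1 / 3)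
  (hbeta1 : 3 < beta1 < 4) :
  let F := horseshoe lambda0 beta0 lambda1 sigma beta1 in
  let deltaQ : probability (R * R * R)%type R := \d_((0, 0, 0) : R * R * R) in
  exists t0 : R, 0 < t0 /\
    [/\ forall t : R, t0 < t ->
          equilibrium_state F (potential F t) deltaQ /\
          forall mu : probability (R * R * R)%type R,
            equilibrium_state F (potential F t) mu ->
            forall A : set (R * R * R), measurable A -> mu A = deltaQ A,
        forall t : R, t < t0 ->
          forall mu : probability (R * R * R)%type R,
            equilibrium_state F (potential F t) mu ->
            (central_exponent F mu < 0)%E /\ mutually_singular mu deltaQ
      & equilibrium_state F (potential F t0) deltaQ /\
        exists mu : probability (R * R * R)%type R,
          equilibrium_state F (potential F t0) mu /\
          mutually_singular mu deltaQ].
Proof.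
move=> F deltaQ; exists (t_crit sigma); split; first exact: t_crit_gt0.
split=> [t tt|t tt mu hmu|].
- split; first by apply: equilibrium_dirac => //; exact: ltW.
  by move=> mu hmu; exact: (equilibrium_unique hlambda0 hbeta0 hlambda1 hsigma hbeta1 tt hmu).
- have [lmu mQ] := equilibrium_negative hlambda0 hbeta0 hlambda1 hsigma hbeta1 tt hmu.
  split; last exact: singular_dirac.
  by rewrite (central_exponentE hlambda0 hbeta0 hlambda1 hsigma hbeta1 hmu.1) lte_fin.
- have dE := equilibrium_dirac hlambda0 hbeta0 hlambda1 hsigma hbeta1 (lexx (t_crit sigma)).
  split=> //.
  (* At the critical parameter the pressure of [nu] is [t0 (1 - l) + t0 l = t0], the same as for the
     Dirac measure. *)
  have [nu [hnu nuQ _ nuE]] := maximizer hlambda0 hbeta0 hlambda1 hsigma hbeta1.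
  exists nu; split; last exact: singular_dirac.
  split=> // ka hka; apply: le_trans (dE.2 _ hka) _.
  have [h [hE -> _ _ _]] := pressure_bound hlambda0 hbeta0 hlambda1 hsigma hbeta1 hnu.
  rewrite (pressure_dirac hlambda0 hbeta0 hlambda1 hsigma hbeta1 (t_crit sigma) dE.1)// lee_fin.
  by move: hE; rewrite nuE => -[<-]; lra.
Qed.
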